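(* Consider the stochastic bilevel problem and the STABLE iteration described in the context. Suppose Assumptions 1--4 hold and set $\rho>|\mu_F|$. There is a constant $c>0$, independent of the stepsizes $\alpha_k,\beta_k,\tau_k$ and of the number of iterations $K$, such that if the stepsizes are chosen as $\tau_k=\frac{1}{\sqrt K}$, $$\beta_k\le \min\left\{\frac{1}{\sqrt K},\ \frac{\mu_g/L_g}{32(\mu_g+L_g)\,c}\right\},$$ $$\alpha_k\le\min\left\{\beta_k,\ \frac{1}{\sqrt K}\left(c+\frac{4\rho C_{g_{xy}}^2C_{f_y}^2}{(\mu_F+\rho)\mu_g^4}\right)^{-1},\ \frac{1}{\sqrt K}\left(c+\frac{4\rho C_{f_y}^2}{(\mu_F+\rho)\mu_g^2}\right)^{-1},\ \frac{\mu_gL_g\,\beta_k/(\mu_g+L_g)}{2\left(c+2\rho L_f^2/(\mu_F+\rho)\right)}\right\},$$ then the iterates $\{x^k\}$ and $\{y^k\}$ satisfy $$\frac1K\sum_{k=1}^K\mathbb{E}\left[\|\widehat x(x^k)-x^k\|^2\right]=\mathcal{O}\left(\frac{1}{\sqrt K}\right)\quad\text{and}\quad \mathbb{E}\left[\|y^K-y^*(x^K)\|^2\right]=\mathcal{O}\left(\frac{1}{\sqrt K}\right),$$ where $y^*(x^K)$ is the minimizer of the lower-level problem at $x=x^K$.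
   Context: **Problem.** $\min_{x\in\mathcal{X}}F(x):=f(x,y^*(x))$ subject to $y^*(x)\in\arg\min_{y\in\mathbb{R}^{d_y}}g(x,y)$, where $f(x,y)=\mathbb{E}_\xi[f(x,y;\xi)]$, $g(x,y)=\mathbb{E}_\phi[g(x,y;\phi)]$, $\xi,\phi$ are random variables, and $\mathcal{X}\subset\mathbb{R}^d$ is closed and convex. The functions $f,g$ are differentiable, as often as needed for the expressions below. $\|\cdot\|$ is the $\ell_2$ norm for vectors and the Frobenius norm for matrices. $\nabla^2_{xy}g$ is the $d\times d_y$ matrix with $(i,j)$ entry $\partial^2 g/\partial x_i\partial y_j$; $\nabla_{yy}^2g$ is the Hessian in $y$. **Assumptions** (for $x\in\mathcal{X}$, $y\in\mathbb{R}^{d_y}$). 1. For any $x$, $\nabla_xf(x,\cdot)$, $\nabla_yf(x,\cdot)$, $\nabla_yg(x,\cdot)$, $\nabla^2_{xy}g(x,\cdot;\phi)$, $\nabla^2_{yy}g(x,\cdot;\phi)$ are $L_{f_x},L_{f_y},L_g,L_{g_{xy}},L_{g_{yy}}$-Lipschitz continuous respectively. For any fixed $y$, $\nabla_xf(\cdot,y;\xi)$, $\nabla_yf(\cdot,y;\xi)$, $\nabla^2_{xy}g(\cdot,y;\phi)$, $\nabla^2_{yy}g(\cdot,y;\phi)$ are $\bar L_{f_x},\bar L_{f_y},\bar L_{g_{xy}},\bar L_{g_{yy}}$-Lipschitz continuous respectively. 2. For any fixed $x$, $g(x,y)$ is $\mu_g$-strongly convex in $y$: $\nabla^2_{yy}g(x,y)\succeq\mu_gI$.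 3. $\nabla_xf(x,y;\xi)$, $\nabla_yf(x,y;\xi)$, $\nabla_yg(x,y;\phi)$, $\nabla^2_{xy}g(x,y;\phi)$, $\nabla^2_{yy}g(x,y;\phi)$ are unbiased estimators of $\nabla_xf(x,y)$, $\nabla_yf(x,y)$, $\nabla_yg(x,y)$, $\nabla^2_{xy}g(x,y)$, $\nabla^2_{yy}g(x,y)$, with variances bounded by $\sigma_{f_x}^2,\sigma_{f_y}^2,\sigma_{g_y}^2,\sigma_{g_{xy}}^2,\sigma_{g_{yy}}^2$ respectively. Moreover $\mathbb{E}_\xi\|\nabla_xf(x,y;\xi)\|^p\le C_{f_x}^p$ and $\mathbb{E}_\xi\|\nabla_yf(x,y;\xi)\|^p\le C_{f_y}^p$ for $p=2,4$; $\mathbb{E}_\phi\|\nabla^2_{xy}g(x,y;\phi)\|^2\le C_{g_{xy}}^2$; $\mathbb{E}_\phi\|\nabla^2_{yy}g(x,y;\phi)\|^2\le C_{g_{yy}}^2$. 4. $F$ is $\mu_F$-weakly convex: $\nabla^2F(x)\succeq\mu_FI$ ($\mu_F$ not necessarily positive). **STABLE iteration.** At each iteration $k$ fresh independent samples $\phi^k$ (distributed as $\phi$) and $\xi^k$ (distributed as $\xi$) are drawn. Initial $x^0,y^0,H_{xy}^0,H_{yy}^0$ are given. Let $h_g^k=\nabla_yg(x^k,y^k;\phi^k)$, $h_{xy}^k(\phi)=\nabla^2_{xy}g(x^k,y^k;\phi)$, $h_{yy}^k(\phi)=\nabla^2_{yy}g(x^k,y^k;\phi)$. The second-order estimates are updated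 by $$H_{xy}^k=\overline{\mathcal P}\big((1-\tau_k)(H_{xy}^{k-1}-h_{xy}^{k-1}(\phi^k))+h_{xy}^k(\phi^k)\big),$$ $$H_{yy}^k=\underline{\mathcal P}\big((1-\tau_k)(H_{yy}^{k-1}-h_{yy}^{k-1}(\phi^k))+h_{yy}^k(\phi^k)\big),\qquad k\ge1,$$ with $\overline{\mathcal P}$, $\underline{\mathcal P}$ the projections onto $\{X:\|X\|\le C_{g_{xy}}\}$ and $\{X: X\succeq\mu_gI\}$, and the iterates by $$x^{k+1}=\mathcal{P}_{\mathcal X}\big(x^k-\alpha_k(\nabla_xf(x^k,y^k;\xi^k)-H_{xy}^k(H_{yy}^k)^{-1}\nabla_yf(x^k,y^k;\xi^k))\big),$$ $$y^{k+1}=y^k-\beta_kh_g^k-(H_{yy}^k)^{-1}(H_{xy}^k)^\top(x^{k+1}-x^k),\qquad k=0,\dots,K-1,$$ where $\mathcal{P}_{\mathcal X}$ is the projection onto $\mathcal X$ and $\alpha_k,\beta_k,\tau_k>0$ are stepsizes. **Proximal map and constant.** $\widehat x(z):=\arg\min_{x\in\mathcal{X}}\{F(x)+\frac{\rho}{2}\|x-z\|^2\}$ and $$L_f:=L_{f_x}+\frac{C_{g_{xy}}L_{f_y}}{\mu_g}+\frac{C_{f_y}}{\mu_g}\left(L_{g_{xy}}+\frac{C_{g_{xy}}L_{g_{yy}}}{\mu_g}\right).$$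
   Formalization: The stepsizes are also required to satisfy α_k ≥ c_0/√K for a fixed c_0>0 (the O-constant may depend on c_0), F is assumed bounded below on X, x^0 ∈ X, and H_yy^0 invertible; with only upper bounds on α_k the first rate is false (α_k=K^{-3}, f=x²/2, g=y²/2, X=[-1,1], x^0=1). *)

(* Defs.v *)
From HB Require Import structures.
From mathcomp Require Import all_boot all_order all_algebra finmap.
From mathcomp Require Import all_classical all_reals all_analysis.

Set Implicit Arguments.
Unset Strict Implicit.
Unset Printing Implicit Defensive.

Import Order.TTheory GRing.Theory Num.Theory.
Import numFieldNormedType.Exports.

Local Open Scope classical_set_scope.
Local Open Scope ring_scope.

(* Frobenius norm; on column vectors this is the Euclidean norm.  The norm
   `|A| that the library puts on matrices is the sup norm. *)
Definition l2 (R : realType) (m n : nat) (A : 'M[R]_(m, n)) : R :=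
  Num.sqrt (\sum_i \sum_j A i j ^+ 2).

Definition lipschitz_l2 (R : realType) (m n p q : nat) (L : R)
    (S : set 'M[R]_(m, n)) (h : 'M[R]_(m, n) -> 'M[R]_(p, q)) : Prop :=
  forall u v, S u -> S v -> l2 (h u - h v) <= L * l2 (u - v).

Definition argmin_on (R : realType) (T : Type) (S : set T) (h : T -> R) : set T :=
  [set u | S u /\ forall v, S v -> h u <= h v].

Definition proj (R : realType) (m n : nat) (S : set 'M[R]_(m, n))
    (v : 'M[R]_(m, n)) : 'M[R]_(m, n) :=
  get (argmin_on S (fun u => l2 (u - v))).

(* The Loewner order A >= B; the difference is required to be symmetric. *)
Definition loewner_ge (R : realType) (n : nat) (A B : 'M[R]_n) : Prop :=
  (A - B)^T = A - B /\ forall v : 'cV[R]_n, 0 <= (v^T *m (A - B) *m v) 0 0.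

Definition grad (R : realType) (n : nat) (h : 'cV[R]_n -> R) (x : 'cV[R]_n) :
    'cV[R]_n :=
  \col_i 'D_(delta_mx i 0) h x.

Definition hess (R : realType) (n : nat) (h : 'cV[R]_n -> R) (x : 'cV[R]_n) :
    'M[R]_n :=
  \matrix_(i, j) 'D_(delta_mx i 0) (fun x' => grad h x' j 0) x.

Definition grad_x (R : realType) (d dy : nat)
    (f : 'cV[R]_d -> 'cV[R]_dy -> R) (x : 'cV[R]_d) (y : 'cV[R]_dy) : 'cV[R]_d :=
  grad (fun x' => f x' y) x.

Definition grad_y (R : realType) (d dy : nat)
    (f : 'cV[R]_d -> 'cV[R]_dy -> R) (x : 'cV[R]_d) (y : 'cV[R]_dy) : 'cV[R]_dy :=
  grad (f x) y.

(* The (i, j) entry is the x_i-derivative of the y_j-derivative. *)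
Definition hess_xy (R : realType) (d dy : nat)
    (g : 'cV[R]_d -> 'cV[R]_dy -> R) (x : 'cV[R]_d) (y : 'cV[R]_dy) :
    'M[R]_(d, dy) :=
  \matrix_(i, j) 'D_(delta_mx i 0) (fun x' => grad_y g x' y j 0) x.

Definition hess_yy (R : realType) (d dy : nat)
    (g : 'cV[R]_d -> 'cV[R]_dy -> R) (x : 'cV[R]_d) (y : 'cV[R]_dy) :
    'M[R]_dy :=
  hess (g x) y.

Definition joint_differentiable (R : realType) (d dy : nat) (V : normedModType R)
    (h : 'cV[R]_d -> 'cV[R]_dy -> V) : Prop :=
  forall z : 'cV[R]_d * 'cV[R]_dy,
    differentiable (fun z' : 'cV[R]_d * 'cV[R]_dy => h z'.1 z'.2) z.

Definition mean_fun (R : realType) (d dy : nat) (dS : measure_display)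
    (S : measurableType dS) (P : probability S R)
    (h : S -> 'cV[R]_d -> 'cV[R]_dy -> R) (x : 'cV[R]_d) (y : 'cV[R]_dy) : R :=
  fine ('E_P[fun s => h s x y])%E.

(* The derivatives of f and g (and of their samples) that the assumptions and
   the iteration refer to exist; sample values are integrable, so that the
   means are genuine expectations. *)
Record smooth_problem (R : realType) (d dy : nat)
    (dXi : measure_display) (Xi : measurableType dXi) (Pxi : probability Xi R)
    (dPhi : measure_display) (Phi : measurableType dPhi)
    (Pphi : probability Phi R)
    (fs : Xi -> 'cV[R]_d -> 'cV[R]_dy -> R)
    (gs : Phi -> 'cV[R]_d -> 'cV[R]_dy -> R) : Prop := SmoothProblem {
  integrable_f : forall x y, Pxi.-integrable setT (fun s => (fs s x y)%:E);
  integrable_g : forall x y, Pphi.-integrable setT (fun s => (gs s x y)%:E);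
  diff_f : joint_differentiable (mean_fun Pxi fs);
  diff_g : joint_differentiable (mean_fun Pphi gs);
  diff_grad_g : joint_differentiable (grad_y (mean_fun Pphi gs));
  diff_fs : forall s, joint_differentiable (fs s);
  diff_gs : forall s, joint_differentiable (gs s);
  diff_grad_gs : forall s, joint_differentiable (grad_y (gs s))
}.

Record constants (R : realType) := Constants {
  L_fx : R; L_fy : R; L_g : R; L_gxy : R; L_gyy : R;
  Lbar_fx : R; Lbar_fy : R; Lbar_gxy : R; Lbar_gyy : R;
  mu_g : R; mu_F : R;
  sigma_fx : R; sigma_fy : R; sigma_gy : R; sigma_gxy : R; sigma_gyy : R;
  C_fx : R; C_fy : R; C_gxy : R; C_gyy : R
}.

(* mu_F may have any sign, and only the squares of the sigmas matter. *)
Record valid_constants (R : realType) (p : constants R) : Prop :=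
    ValidConstants {
  mu_g_gt0 : 0 < p.(mu_g);
  L_ge0 : [/\ 0 <= p.(L_fx), 0 <= p.(L_fy), 0 <= p.(L_g), 0 <= p.(L_gxy)
            & 0 <= p.(L_gyy)];
  Lbar_ge0 : [/\ 0 <= p.(Lbar_fx), 0 <= p.(Lbar_fy), 0 <= p.(Lbar_gxy)
               & 0 <= p.(Lbar_gyy)];
  C_ge0 : [/\ 0 <= p.(C_fx), 0 <= p.(C_fy), 0 <= p.(C_gxy) & 0 <= p.(C_gyy)]
}.

Definition L_f (R : realType) (p : constants R) : R :=
  p.(L_fx) + p.(C_gxy) * p.(L_fy) / p.(mu_g)
  + p.(C_fy) / p.(mu_g) * (p.(L_gxy) + p.(C_gxy) * p.(L_gyy) / p.(mu_g)).

Record lipschitz_assumption (R : realType) (d dy : nat)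
    (dXi : measure_display) (Xi : measurableType dXi) (Pxi : probability Xi R)
    (dPhi : measure_display) (Phi : measurableType dPhi)
    (Pphi : probability Phi R)
    (fs : Xi -> 'cV[R]_d -> 'cV[R]_dy -> R)
    (gs : Phi -> 'cV[R]_d -> 'cV[R]_dy -> R)
    (X : set 'cV[R]_d) (p : constants R) : Prop := LipschitzAssumption {
  lip_fx_y : forall x, X x ->
    lipschitz_l2 p.(L_fx) setT (grad_x (mean_fun Pxi fs) x);
  lip_fy_y : forall x, X x ->
    lipschitz_l2 p.(L_fy) setT (grad_y (mean_fun Pxi fs) x);
  lip_gy_y : forall x, X x ->
    lipschitz_l2 p.(L_g) setT (grad_y (mean_fun Pphi gs) x);
  lip_gxy_y : forall s x, X x -> lipschitz_l2 p.(L_gxy) setT (hess_xy (gs s) x);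
  lip_gyy_y : forall s x, X x -> lipschitz_l2 p.(L_gyy) setT (hess_yy (gs s) x);
  lip_fx_x : forall s y, lipschitz_l2 p.(Lbar_fx) X (fun x => grad_x (fs s) x y);
  lip_fy_x : forall s y, lipschitz_l2 p.(Lbar_fy) X (fun x => grad_y (fs s) x y);
  lip_gxy_x : forall s y,
    lipschitz_l2 p.(Lbar_gxy) X (fun x => hess_xy (gs s) x y);
  lip_gyy_x : forall s y,
    lipschitz_l2 p.(Lbar_gyy) X (fun x => hess_yy (gs s) x y)
}.

Definition strong_convexity_assumption (R : realType) (d dy : nat)
    (g : 'cV[R]_d -> 'cV[R]_dy -> R) (X : set 'cV[R]_d) (mug : R) : Prop :=
  forall x y, X x -> loewner_ge (hess_yy g x y) mug%:M.

Definition unbiased_estimator (R : realType) (m n : nat)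
    (dS : measure_display) (S : measurableType dS) (P : probability S R)
    (G : S -> 'M[R]_(m, n)) (M : 'M[R]_(m, n)) : Prop :=
  forall i j, P.-integrable setT (fun s => (G s i j)%:E) /\
              ('E_P[fun s => G s i j] = (M i j)%:E)%E.

Definition variance_le (R : realType) (m n : nat)
    (dS : measure_display) (S : measurableType dS) (P : probability S R)
    (G : S -> 'M[R]_(m, n)) (M : 'M[R]_(m, n)) (v : R) : Prop :=
  ('E_P[fun s => (l2 (G s - M) ^+ 2)%R] <= v%:E)%E.

Definition moment_le (R : realType) (m n : nat)
    (dS : measure_display) (S : measurableType dS) (P : probability S R)
    (G : S -> 'M[R]_(m, n)) (q : nat) (C : R) : Prop :=
  ('E_P[fun s => (l2 (G s) ^+ q)%R] <= (C ^+ q)%:E)%E.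

Record stochastic_assumption (R : realType) (d dy : nat)
    (dXi : measure_display) (Xi : measurableType dXi) (Pxi : probability Xi R)
    (dPhi : measure_display) (Phi : measurableType dPhi)
    (Pphi : probability Phi R)
    (fs : Xi -> 'cV[R]_d -> 'cV[R]_dy -> R)
    (gs : Phi -> 'cV[R]_d -> 'cV[R]_dy -> R)
    (X : set 'cV[R]_d) (p : constants R) : Prop := StochasticAssumption {
  unbiased_fx : forall x y, X x ->
    unbiased_estimator Pxi (fun s => grad_x (fs s) x y)
                           (grad_x (mean_fun Pxi fs) x y);
  unbiased_fy : forall x y, X x ->
    unbiased_estimator Pxi (fun s => grad_y (fs s) x y)
                           (grad_y (mean_fun Pxi fs) x y);
  unbiased_gy : forall x y, X x ->
    unbiased_estimator Pphi (fun s => grad_y (gs s) x y)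
                            (grad_y (mean_fun Pphi gs) x y);
  unbiased_gxy : forall x y, X x ->
    unbiased_estimator Pphi (fun s => hess_xy (gs s) x y)
                            (hess_xy (mean_fun Pphi gs) x y);
  unbiased_gyy : forall x y, X x ->
    unbiased_estimator Pphi (fun s => hess_yy (gs s) x y)
                            (hess_yy (mean_fun Pphi gs) x y);
  variance_fx : forall x y, X x ->
    variance_le Pxi (fun s => grad_x (fs s) x y)
                    (grad_x (mean_fun Pxi fs) x y) (p.(sigma_fx) ^+ 2);
  variance_fy : forall x y, X x ->
    variance_le Pxi (fun s => grad_y (fs s) x y)
                    (grad_y (mean_fun Pxi fs) x y) (p.(sigma_fy) ^+ 2);
  variance_gy : forall x y, X x ->
    variance_le Pphi (fun s => grad_y (gs s) x y)
                     (grad_y (mean_fun Pphi gs) x y) (p.(sigma_gy) ^+ 2);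
  variance_gxy : forall x y, X x ->
    variance_le Pphi (fun s => hess_xy (gs s) x y)
                     (hess_xy (mean_fun Pphi gs) x y) (p.(sigma_gxy) ^+ 2);
  variance_gyy : forall x y, X x ->
    variance_le Pphi (fun s => hess_yy (gs s) x y)
                     (hess_yy (mean_fun Pphi gs) x y) (p.(sigma_gyy) ^+ 2);
  moment_fx : forall x y q, X x -> q = 2%N \/ q = 4%N ->
    moment_le Pxi (fun s => grad_x (fs s) x y) q p.(C_fx);
  moment_fy : forall x y q, X x -> q = 2%N \/ q = 4%N ->
    moment_le Pxi (fun s => grad_y (fs s) x y) q p.(C_fy);
  moment_gxy : forall x y, X x ->
    moment_le Pphi (fun s => hess_xy (gs s) x y) 2 p.(C_gxy);
  moment_gyy : forall x y, X x ->
    moment_le Pphi (fun s => hess_yy (gs s) x y) 2 p.(C_gyy)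
}.

Definition outer_obj (R : realType) (d dy : nat)
    (f : 'cV[R]_d -> 'cV[R]_dy -> R) (ystar : 'cV[R]_d -> 'cV[R]_dy)
    (x : 'cV[R]_d) : R :=
  f x (ystar x).

Definition weak_convexity_assumption (R : realType) (d : nat)
    (F : 'cV[R]_d -> R) (X : set 'cV[R]_d) (muF : R) : Prop :=
  forall x, X x ->
    [/\ differentiable F x, differentiable (grad F) x
      & loewner_ge (hess F x) muF%:M].

Definition prox (R : realType) (d : nat) (F : 'cV[R]_d -> R)
    (X : set 'cV[R]_d) (rho : R) (z : 'cV[R]_d) : 'cV[R]_d :=
  get (argmin_on X (fun x => F x + rho / 2 * l2 (x - z) ^+ 2)).

Definition mutually_independent (R : realType) (dO : measure_display)
    (Omega : measurableType dO) (P : probability Omega R)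
    (I : choiceType) (E : I -> set (set Omega)) : Prop :=
  forall (J : {fset I}) (A : I -> set Omega),
    (forall i, i \in J -> E i (A i)) ->
    (P (\bigcap_(i in [set` J]) A i) = \prod_(i <- J) P (A i))%E.

(* The events generated by xi k (index inl k) and by phi k (index inr k). *)
Definition sample_events (R : realType) (dO : measure_display)
    (Omega : measurableType dO) (P : probability Omega R)
    (dXi : measure_display) (Xi : measurableType dXi)
    (dPhi : measure_display) (Phi : measurableType dPhi)
    (xi : nat -> {RV P >-> Xi}) (phi : nat -> {RV P >-> Phi})
    (i : nat + nat) : set (set Omega) :=
  match i with
  | inl k => preimage_set_system setT (xi k) measurable
  | inr k => preimage_set_system setT (phi k) measurable
  end.

Record fresh_samples (R : realType) (dO : measure_display)
    (Omega : measurableType dO) (P : probability Omega R)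
    (dXi : measure_display) (Xi : measurableType dXi) (Pxi : probability Xi R)
    (dPhi : measure_display) (Phi : measurableType dPhi)
    (Pphi : probability Phi R)
    (xi : nat -> {RV P >-> Xi}) (phi : nat -> {RV P >-> Phi}) : Prop :=
    FreshSamples {
  law_xi : forall k A, measurable A -> distribution P (xi k) A = Pxi A;
  law_phi : forall k A, measurable A -> distribution P (phi k) A = Pphi A;
  indep_samples : mutually_independent P (sample_events xi phi)
}.

Record state (R : realType) (d dy : nat) := State {
  st_x : 'cV[R]_d; st_y : 'cV[R]_dy;
  st_Hxy : 'M[R]_(d, dy); st_Hyy : 'M[R]_dy
}.

(* From (x^k, y^k, H_xy^k, H_yy^k) to the same data at k + 1, with
   a = alpha_k, b = beta_k, t = tau_(k+1), and the sampled functions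
   fk = f(.,.;xi^k), gk = g(.,.;phi^k), gk1 = g(.,.;phi^(k+1)). *)
Definition stable_step (R : realType) (d dy : nat)
    (X : set 'cV[R]_d) (Cgxy mug : R) (a b t : R)
    (fk gk gk1 : 'cV[R]_d -> 'cV[R]_dy -> R) (s : state R d dy) :
    state R d dy :=
  let: State x y Hxy Hyy := s in
  let x1 := proj X
    (x - a *: (grad_x fk x y - Hxy *m invmx Hyy *m grad_y fk x y)) in
  let y1 := y - b *: grad_y gk x y - invmx Hyy *m Hxy^T *m (x1 - x) in
  let Hxy1 := proj [set H | l2 H <= Cgxy]
    ((1 - t) *: (Hxy - hess_xy gk1 x y) + hess_xy gk1 x1 y1) in
  let Hyy1 := proj [set H | loewner_ge H mug%:M]
    ((1 - t) *: (Hyy - hess_yy gk1 x y) + hess_yy gk1 x1 y1) in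
  State x1 y1 Hxy1 Hyy1.

Fixpoint stable_iter (R : realType) (d dy : nat)
    (X : set 'cV[R]_d) (Cgxy mug : R) (alpha beta tau : nat -> R)
    (f_ g_ : nat -> 'cV[R]_d -> 'cV[R]_dy -> R) (s0 : state R d dy)
    (k : nat) : state R d dy :=
  match k with
  | 0%N => s0
  | k'.+1 =>
      stable_step X Cgxy mug (alpha k') (beta k') (tau k'.+1)
        (f_ k') (g_ k') (g_ k'.+1)
        (stable_iter X Cgxy mug alpha beta tau f_ g_ s0 k')
  end.

(* Main.v *)
Require Import Defs.
From HB Require Import structures.
From mathcomp Require Import all_boot all_order all_algebra finmap.
From mathcomp Require Import ring lra.
From mathcomp Require Import all_classical all_reals all_analysis measurable_realfun.

Set Implicit Arguments.
Unset Strict Implicit.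
Unset Printing Implicit Defensive.

Import Order.TTheory GRing.Theory Num.Theory.
Import numFieldNormedType.Exports.

Local Open Scope classical_set_scope.
Local Open Scope ring_scope.

(** Why the rates hold.

    Write [A_k] for the mean square distance of [y^k] from [ystar x^k], [B_k] for
    the mean square error of the two second-order estimates at [(x^k, y^k)], and
    [eta = 1 / sqrt K].

    Three recursions drive the argument.

    - The inner update is a stochastic gradient step, which contracts [A_k] by
      [1 - beta mu_g], followed by a correction that follows the motion of the
      solution map.  The solution map has a second-order expansion whose linear
      part is minus the inverse Hessian times the mixed derivative
      ([ystar_expansion]), so the correction misses the true motion only by the
      error of the second-order estimates times [|x^(k+1) - x^k|], plus a quadratic
      remainder ([drift_moment2]); the fourth moments of the gradients control
      the latter.  The result is [expected_inner_error].

    - The momentum update of the second-order estimates contracts [B_k] by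
      [1 - eta]; since the same sample is used at both points, the noise it adds is
      of order [eta^2] and the length of the last move squared
      ([momentum_error], [expected_estimate_error]).

    - The Moreau envelope of the outer objective decreases, in expectation, by a
      multiple of [alpha |prox x^k - x^k|^2], up to [alpha (A_k + B_k)] and
      [alpha^2] ([expected_envelope]).  This rests on weak convexity along the
      segment from [x^k] to its proximal point, and on the identification of the
      gradient of the outer objective, along the constraint set, with the
      hypergradient ([grad_outer_obj_segment], [outer_obj_lower_bound]).

    If [alpha / beta] and [beta] are small, which is what the constant [c]
    ensures, a weighted sum of [A_k] and [B_k] contracts by [1 - rate eta] up to
    [eta^2] ([lyapunov_recursion]). Hence it is bounded by a geometric term plus
    a term of order [eta], and after [K] steps the geometric term is of order
    [eta] as well: this is the second rate. Summing the envelope inequality over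
    [k] leaves a bounded right-hand side, while each step contributes at least a
    multiple of [c0 eta |prox x^k - x^k|^2] on the left; dividing by [K eta = 1
    / eta] gives the first rate.

    All the conditioning is done through [integral_fresh]: the iterates are
    measurable with respect to the samples already drawn ([path_adapted]), these
    are independent of the next sample ([past_indep]), and Tonelli's theorem then
    allows the next sample to be averaged with the past frozen.  No
    measurability of the proximal map enters: its squared displacement is only
    ever bounded from above by measurable functions ([expectation_decrease]). *)

Local Notation proj := Defs.proj.

(** * Frobenius inner product and norm *)

Ltac mx_ring := apply/matrixP => ? ?; rewrite !mxE; ring.

Section frobenius.
Context {R : realType}.

Lemma le_of_eq (a b : R) : a = b -> a <= b.
Proof. by move->. Qed.

Definition dotm (m n : nat) (A B : 'M[R]_(m, n)) : R := \tr (A^T *m B).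

Section dot.
Context {m n : nat}.
Implicit Types A B C : 'M[R]_(m, n).

Lemma dotmE A B : dotm A B = \sum_i \sum_j A i j * B i j.
Proof.
rewrite /dotm /mxtrace exchange_big; apply: eq_bigr => j _.
by rewrite mxE; apply: eq_bigr => i _; rewrite mxE.
Qed.

Lemma dotmC A B : dotm A B = dotm B A.
Proof. by rewrite /dotm -mxtrace_tr trmx_mul trmxK. Qed.

Lemma dotmDr A B C : dotm A (B + C) = dotm A B + dotm A C.
Proof. by rewrite /dotm mulmxDr mxtraceD. Qed.

Lemma dotmZr a A B : dotm A (a *: B) = a * dotm A B.
Proof. by rewrite /dotm -scalemxAr mxtraceZ. Qed.

Lemma dotmNr A B : dotm A (- B) = - dotm A B.
Proof. by rewrite -scaleN1r dotmZr mulN1r. Qed.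

Lemma dotmBr A B C : dotm A (B - C) = dotm A B - dotm A C.
Proof. by rewrite dotmDr dotmNr. Qed.

Lemma dotmDl A B C : dotm (B + C) A = dotm B A + dotm C A.
Proof. by rewrite dotmC dotmDr !(dotmC A). Qed.

Lemma dotmZl a A B : dotm (a *: A) B = a * dotm A B.
Proof. by rewrite dotmC dotmZr dotmC. Qed.

Lemma dotmNl A B : dotm (- A) B = - dotm A B.
Proof. by rewrite dotmC dotmNr dotmC. Qed.

Lemma dotmBl A B C : dotm (B - C) A = dotm B A - dotm C A.
Proof. by rewrite dotmDl dotmNl. Qed.

Lemma dot0m A : dotm 0 A = 0.
Proof. by rewrite -(scale0r 0) dotmZl mul0r. Qed.

Lemma dotm0 A : dotm A 0 = 0.
Proof. by rewrite dotmC dot0m. Qed.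

Lemma dotm_ge0 A : 0 <= dotm A A.
Proof. by rewrite dotmE; do 2!(apply: sumr_ge0 => ? _); rewrite -expr2 sqr_ge0. Qed.

Lemma l2_ge0 A : 0 <= l2 A.
Proof. exact: sqrtr_ge0. Qed.

Lemma l2_sqr A : l2 A ^+ 2 = dotm A A.
Proof.
rewrite dotmE sqr_sqrtr; last by do 2!(apply: sumr_ge0 => ? _); rewrite sqr_ge0.
by apply: eq_bigr => i _; apply: eq_bigr => j _; rewrite expr2.
Qed.

Lemma l2_sqrE A : l2 A ^+ 2 = \sum_i \sum_j A i j ^+ 2.
Proof.
by rewrite l2_sqr dotmE; apply: eq_bigr => i _; apply: eq_bigr => j _; rewrite expr2.
Qed.

Lemma l2_le A c : 0 <= c -> (l2 A <= c) = (dotm A A <= c ^+ 2).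
Proof. by move=> c0; rewrite -l2_sqr ler_pXn2r// nnegrE l2_ge0. Qed.

Lemma ler_entry_l2 A i j : `|A i j| <= l2 A.
Proof.
rewrite -sqrtr_sqr ler_sqrt; last by do 2!(apply: sumr_ge0 => ? _); rewrite sqr_ge0.
rewrite (bigD1 i)//= (bigD1 j)//= -addrA lerDl.
by rewrite addr_ge0//; do ?(apply: sumr_ge0 => ? _); rewrite ?sumr_ge0// => *; rewrite sqr_ge0.
Qed.

Lemma l2_eq0 A : l2 A = 0 -> A = 0.
Proof.
move=> A0; apply/matrixP => i j; rewrite mxE; apply/eqP.
by rewrite -normr_le0 (le_trans (ler_entry_l2 _ _ _))// A0.
Qed.

Lemma l20 : l2 (0 : 'M[R]_(m, n)) = 0.
Proof. by apply/eqP; rewrite -sqrf_eq0 l2_sqr dotm0. Qed.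

Lemma l2Z a A : l2 (a *: A) = `|a| * l2 A.
Proof.
apply/eqP; rewrite -(eqrXn2 (n := 2))// ?mulr_ge0 ?l2_ge0//.
by rewrite exprMn !l2_sqr dotmZl dotmZr mulrA real_normK ?num_real.
Qed.

Lemma l2N A : l2 (- A) = l2 A.
Proof. by rewrite -scaleN1r l2Z normrN1 mul1r. Qed.

Lemma l2B A B : l2 (A - B) = l2 (B - A).
Proof. by rewrite -l2N opprB. Qed.

Lemma cauchy_schwarz A B : `|dotm A B| <= l2 A * l2 B.
Proof.
rewrite -(ler_pXn2r (n := 2))// ?nnegrE ?mulr_ge0 ?l2_ge0//.
rewrite exprMn !l2_sqr real_normK ?num_real//.
have [B0|B0] := eqVneq (dotm B B) 0.
  have -> : B = 0 by apply: l2_eq0; apply/eqP; rewrite -sqrf_eq0 l2_sqr B0.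
  by rewrite !dotm0 expr0n mulr0.
have Bp : 0 < dotm B B by rewrite lt_neqAle eq_sym B0 dotm_ge0.
have := dotm_ge0 (dotm B B *: A - dotm A B *: B).
rewrite dotmBl !dotmBr !dotmZl !dotmZr (dotmC B A) => h.
rewrite -subr_ge0 -(pmulr_rge0 _ Bp).
by apply: le_trans h _; apply: le_of_eq; ring.
Qed.

Lemma ler_dotm A B : dotm A B <= l2 A * l2 B.
Proof. exact: le_trans (ler_norm _) (cauchy_schwarz _ _). Qed.

Lemma l2_sqrD A B : l2 (A + B) ^+ 2 = l2 A ^+ 2 + 2 * dotm A B + l2 B ^+ 2.
Proof. by rewrite !l2_sqr dotmDl !dotmDr (dotmC B A); ring. Qed.

Lemma l2_sqrBE A B : l2 (A - B) ^+ 2 = l2 A ^+ 2 - 2 * dotm A B + l2 B ^+ 2.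
Proof. by rewrite l2_sqrD dotmNr l2N mulrN. Qed.

Lemma l2_triangle A B : l2 (A + B) <= l2 A + l2 B.
Proof.
rewrite -(ler_pXn2r (n := 2))// ?nnegrE ?addr_ge0 ?l2_ge0//.
by rewrite l2_sqrD sqrrD lerD2r lerD2l -[leRHS]mulr_natl ler_pM2l//; exact: ler_dotm.
Qed.

Lemma l2_triangleB A B C : l2 (A - C) <= l2 (A - B) + l2 (B - C).
Proof. by rewrite -{1}(subrK B A) -addrA l2_triangle. Qed.

Lemma l2_sub_le A B : l2 (A - B) <= l2 A + l2 B.
Proof. by rewrite -(l2N B) l2_triangle. Qed.

Lemma ler_l2B A B : `|l2 A - l2 B| <= l2 (A - B).
Proof.
rewrite ler_norml; apply/andP; split.
  by rewrite lerNl opprB lerBlDr (l2B A) -{1}(subrK A B) l2_triangle.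
by rewrite lerBlDr -{1}(subrK B A) l2_triangle.
Qed.

Lemma l2_sqrD_le A B : l2 (A + B) ^+ 2 <= 2 * (l2 A ^+ 2 + l2 B ^+ 2).
Proof.
rewrite l2_sqrD; have := sqr_ge0 (l2 (A - B)).
by have := l2_sqrBE A B => /[swap] h; rewrite expr2; nra.
Qed.

Lemma l2_sqrB_le A B : l2 (A - B) ^+ 2 <= 2 * (l2 A ^+ 2 + l2 B ^+ 2).
Proof. by rewrite -(l2N B) l2_sqrD_le. Qed.

(** Young's inequality in the form that trades a factor slightly above one on
    the dominant term against a large factor on the perturbation. *)
Lemma l2_sqrD_young A B e : 0 < e ->
  l2 (A + B) ^+ 2 <= (1 + e) * l2 A ^+ 2 + (1 + e^-1) * l2 B ^+ 2.
Proof.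
move=> e0; rewrite l2_sqrD !mulrDl !mul1r.
have h : 2 * dotm A B <= e * l2 A ^+ 2 + e^-1 * l2 B ^+ 2; last by lra.
have /(_ (dotm_ge0 (e *: A - B))) : 0 <= dotm (e *: A - B) (e *: A - B) ->
   0 <= e^-1 * dotm (e *: A - B) (e *: A - B).
  by move=> ?; rewrite mulr_ge0// invr_ge0 ltW.
rewrite dotmBl !dotmBr !dotmZl !dotmZr (dotmC B A) !l2_sqr => h.
rewrite -subr_ge0; apply: le_trans h _; apply: le_of_eq.
by field; rewrite gt_eqF.
Qed.

Lemma l2_le_sum A : l2 A <= \sum_i \sum_j `|A i j|.
Proof.
have h0 : 0 <= \sum_i \sum_j `|A i j| by do 2!(apply: sumr_ge0 => ? _).
rewrite l2_le// dotmE expr2 mulr_suml; apply: ler_sum => i _.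
rewrite mulr_suml; apply: ler_sum => j _.
apply: le_trans (ler_norm _) _; rewrite normrM ler_wpM2l//.
rewrite (bigD1 i)//= (bigD1 j)//= -addrA lerDl.
by rewrite addr_ge0//; do ?(apply: sumr_ge0 => ? _); rewrite ?sumr_ge0.
Qed.

(** The sup norm of the matrix topology and the Frobenius norm are
    equivalent. *)
Lemma mx_norm_le_l2 A : `|A| <= l2 A.
Proof.
rewrite [leLHS]/Num.norm/= mx_normrE; apply/bigmax_leP; split; first exact: l2_ge0.
by move=> -[i j] _ /=; exact: ler_entry_l2.
Qed.

Lemma l2_le_mx_norm A : l2 A <= (m * n)%:R * `|A|.
Proof.
apply: le_trans (l2_le_sum A) _.
have h i j : `|A i j| <= `|A|.
  by rewrite [leRHS]/Num.norm/= mx_normrE; apply/bigmax_geP; right; exists (i, j).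
apply: (@le_trans _ _ (\sum_(i < m) \sum_(j < n) `|A|)).
  by apply: ler_sum => i _; apply: ler_sum => j _.
by rewrite !sumr_const !card_ord -mulrnA mulr_natl mulnC.
Qed.

End dot.

Lemma l2_tr m n (A : 'M[R]_(m, n)) : l2 A^T = l2 A.
Proof.
rewrite /l2 exchange_big; congr Num.sqrt.
by apply: eq_bigr => i _; apply: eq_bigr => j _; rewrite mxE.
Qed.

Lemma dotm_mull m n k (A : 'M[R]_(m, n)) (B : 'M[R]_(m, k)) (C : 'M[R]_(k, n)) :
  dotm A (B *m C) = dotm (B^T *m A) C.
Proof. by rewrite /dotm trmx_mul trmxK mulmxA. Qed.

Lemma dotm_cV n (u v : 'cV[R]_n) : dotm u v = \sum_i u i 0 * v i 0.
Proof. by rewrite dotmE; apply: eq_bigr => i _; rewrite big_ord1. Qed.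

Lemma l2_mulmx m n k (A : 'M[R]_(m, n)) (B : 'M[R]_(n, k)) :
  l2 (A *m B) <= l2 A * l2 B.
Proof.
rewrite -(ler_pXn2r (n := 2))// ?nnegrE ?mulr_ge0 ?l2_ge0//.
rewrite exprMn [leLHS]l2_sqrE.
have h i j : (A *m B) i j ^+ 2 <= (\sum_l A i l ^+ 2) * (\sum_l B l j ^+ 2).
  have := cauchy_schwarz (row i A)^T (col j B).
  rewrite -(ler_pXn2r (n := 2))// ?nnegrE ?mulr_ge0 ?l2_ge0//.
  rewrite exprMn real_normK ?num_real// dotm_cV.
  rewrite !l2_sqrE (_ : \sum_i0 (_ * _) = (A *m B) i j); last first.
    by rewrite [RHS]mxE; apply: eq_bigr => l _; rewrite !mxE.
  move/le_trans; apply; apply: le_of_eq.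
  by congr (_ * _); apply: eq_bigr => l _; rewrite big_ord1 !mxE.
apply: (@le_trans _ _ (\sum_i \sum_j ((\sum_l A i l ^+ 2) * (\sum_l B l j ^+ 2)))).
  by apply: ler_sum => i _; apply: ler_sum => j _; exact: h.
rewrite !l2_sqrE [X in _ * X]exchange_big mulr_suml.
by apply: ler_sum => i _; rewrite mulr_sumr.
Qed.

End frobenius.

(** * Projections and minimizers *)

Section projection.
Context {R : realType}.

Definition segment_closed (m n : nat) (S : set 'M[R]_(m, n)) :=
  forall u v t, S u -> S v -> 0 <= t -> t <= 1 -> S (u + t *: (v - u)).

Lemma convex_set_segment_closed (n : nat) (S : set 'cV[R]_n) :
  convex_set S -> segment_closed S.
Proof.
move=> cS u v t Su Sv t0 t1.
have t01 : Itv.spec (@Itv.num_sem R) (Itv.Real `[Posz 0, Posz 1]) t.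
  by rewrite /Itv.spec /Itv.num_sem/= num_real/= in_itv/= t0 t1.
have /= := cS v u (Itv.mk t01); rewrite !inE => /(_ Sv Su).
move=> h; have -> // : u + t *: (v - u) = t *: v + (1 - t) *: u by mx_ring.
Qed.

Section closed_bounded.
Context {m n : nat}.

(** The topology on matrices comes from the sup norm, while all the estimates are
    in the Frobenius norm. *)
Lemma l2_continuousP (V : normedModType R) (h : 'M[R]_(m, n) -> V) u :
  {for u, continuous h} <->
  (forall e, 0 < e -> exists2 d, 0 < d & forall v, l2 (u - v) < d -> `|h u - h v| < e).
Proof.
split=> [hc e e0|hd A /= /(nbhs_ballP (h u)) [e e0 es]].
  have : nbhs (h u) (ball (h u) e) by exact: nbhsx_ballx.
  move=> /hc /(nbhs_ballP u) [d d0 ds]; exists d => // v uv.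
  have := ds v; rewrite /= -!ball_normE/=; apply.
  exact: le_lt_trans (mx_norm_le_l2 _) uv.
have [d d0 dh] := hd e e0.
pose N : R := (m * n)%:R + 1; have N0 : 0 < N by rewrite ltr_wpDl.
apply/(nbhs_ballP u); exists (d / N); first exact: divr_gt0.
move=> v /=; rewrite -ball_normE/= ltr_pdivlMr// => uv; apply: es.
rewrite -ball_normE/=; apply: dh; apply: le_lt_trans uv.
by apply: le_trans (l2_le_mx_norm _) _; rewrite mulrC ler_wpM2l// lerDl.
Qed.

Lemma continuous_l2 : continuous (fun u : 'M[R]_(m, n) => l2 u).
Proof.
move=> u; apply/(@l2_continuousP R^o) => e e0; exists e => // v; apply: le_lt_trans.
exact: ler_l2B.
Qed.

Lemma l2_lipschitz_continuous (p q : nat) (h : 'M[R]_(m, n) -> 'M[R]_(p, q)) (L : R) :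
  (forall u v, l2 (h u - h v) <= L * l2 (u - v)) -> continuous h.
Proof.
move=> hL u; apply/l2_continuousP => e e0; exists (e / (`|L| + 1)).
  by rewrite divr_gt0// ltr_wpDl.
move=> v; rewrite ltr_pdivlMr ?ltr_wpDl// => uv.
apply: le_lt_trans (mx_norm_le_l2 _) _; apply: le_lt_trans (hL _ _) _.
apply: le_lt_trans uv; rewrite mulrC ler_wpM2l ?l2_ge0//.
by apply: le_trans (ler_norm _) _; rewrite lerDl.
Qed.

End closed_bounded.

(** Heine-Borel for row vectors, transported along the isometry [vec_mx]. *)
Lemma bounded_closed_compact_mx (m n : nat) (A : set 'M[R]_(m, n)) r :
  (forall u, A u -> l2 u <= r) -> closed A -> compact A.
Proof.
move=> Ar Acl.
have l2_vec (u : 'rV[R]_(m * n)) : l2 (vec_mx u) = l2 u.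
  congr Num.sqrt; rewrite big_ord1 (reindex _ (curry_mxvec_bij _ _))/= pair_bigA.
  by apply: eq_bigr => -[i j] _ /=; rewrite mxE.
have vec_cont : continuous (@vec_mx R m n).
  by apply: (@l2_lipschitz_continuous _ _ _ _ _ 1) => u v; rewrite -raddfB l2_vec mul1r.
rewrite (_ : A = vec_mx @` (vec_mx @^-1` A)); last first.
  apply/seteqP; split=> [u Au|_ [u Au <-]//]; exists (mxvec u) => /=.
    by rewrite mxvecK.
  by rewrite mxvecK.
apply: continuous_compact; first exact/continuous_subspaceT.
apply: bounded_closed_compact; last by apply: preimage_closed.
exists r; split; first exact: num_real.
move=> x rx u /= /Ar; rewrite l2_vec => /(le_trans (mx_norm_le_l2 _)) /le_trans; apply.
exact: ltW.
Qed.

(** The sublevel set of [h] at [u0] is bounded, so a minimum over the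
    compact set of points of [S] of norm at most [r] is a minimum over [S]. *)
Lemma argmin_on_nonempty (m n : nat) (S : set 'M[R]_(m, n)) (h : 'M[R]_(m, n) -> R) u0 r :
  closed S -> S u0 -> (forall u, S u -> {for u, continuous h}) ->
  (forall u, S u -> h u <= h u0 -> l2 u <= r) -> argmin_on S h !=set0.
Proof.
move=> Scl Su0 hc hr.
pose A := S `&` [set u | l2 u <= r].
have Au0 : A u0 by split => //; exact: hr.
have Ac : compact A.
  apply: (@bounded_closed_compact_mx _ _ _ r); first by move=> u [].
  apply: closedI => //; apply: (preimage_closed _ (@closed_le _ r)) => u _.
  exact: continuous_l2.
have [|c /[!inE] -[Sc _] cmin] := compact_EVT_min (ex_intro _ _ Au0) Ac (f := h).
  apply: continuous_in_subspaceT => u /[!inE] -[Su _]; exact: hc.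
exists c; split => // v Sv.
have [hv|hv] := leP (h v) (h u0); first by apply: cmin; rewrite inE; split => //; exact: hr.
by apply: le_trans (ltW hv); apply: cmin; rewrite inE.
Qed.

Section proj.
Context {m n : nat} (S : set 'M[R]_(m, n)) (u0 : 'M[R]_(m, n)).
Hypotheses (Scl : closed S) (Scv : segment_closed S) (Su0 : S u0).

Lemma proj_argmin v : argmin_on S (fun u => l2 (u - v)) (proj S v).
Proof.
apply: getPex.
apply: (@argmin_on_nonempty _ _ _ _ u0 (l2 v + l2 (u0 - v))) => //.
  move=> u _; apply: continuous_comp; last exact: continuous_l2.
  by apply: (@l2_lipschitz_continuous _ _ _ _ _ 1) => a b; rewrite opprB addrA subrK mul1r.
move=> u Su h; rewrite -{1}(subrK v u); apply: le_trans (l2_triangle _ _) _.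
by rewrite addrC lerD2l.
Qed.

Lemma proj_in v : S (proj S v).
Proof. by have [] := proj_argmin v. Qed.

(** First-order optimality: moving from the projection towards another point of
    the convex set cannot shorten the distance. *)
Lemma proj_variational v u : S u -> dotm (v - proj S v) (u - proj S v) <= 0.
Proof.
move=> Su; have [Sp pmin] := proj_argmin v.
set p := proj S v in Sp pmin *; set c := dotm _ _.
have key t : 0 < t -> t <= 1 -> 2 * c <= t * l2 (u - p) ^+ 2.
  move=> t0 t1.
  have /pmin : S (p + t *: (u - p)) by apply: Scv => //; exact: ltW.
  rewrite -(ler_pXn2r (n := 2)) ?nnegrE ?l2_ge0//.
  have -> : p + t *: (u - p) - v = t *: (u - p) - (v - p).
    by mx_ring.
  rewrite (l2B p v) (l2_sqrBE (t *: _)) l2Z dotmZl (dotmC (u - p)) -/c exprMn real_normK ?num_real//.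
  move=> h; rewrite -(ler_pM2l t0); nra.
rewrite leNgt; apply/negP => c0.
have q0 : 0 <= l2 (u - p) ^+ 2 by rewrite exprn_ge0// l2_ge0.
set q := l2 (u - p) ^+ 2 in key q0.
(* A step small enough for the linear term to dominate. *)
have := key (c / (c + q)); rewrite divr_gt0 ?ltr_wpDr// ler_pdivrMr ?ltr_wpDr// mul1r lerDl q0.
move=> /(_ isT isT); rewrite mulrAC ler_pdivlMr ?ltr_wpDr//; nra.
Qed.

(** Sum of the variational inequalities at the two projections. *)
Lemma proj_nonexpansive v w : l2 (proj S v - proj S w) <= l2 (v - w).
Proof.
have h1 := proj_variational v (proj_in w); have h2 := proj_variational w (proj_in v).
move: (proj S v) (proj S w) h1 h2 => p q h1 h2.
have h3 : l2 (p - q) ^+ 2 <= dotm (v - w) (p - q).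
  rewrite l2_sqr -subr_ge0.
  have -> : dotm (v - w) (p - q) - dotm (p - q) (p - q)
      = - dotm (v - p) (q - p) - dotm (w - q) (p - q).
    by rewrite !dotmBr !dotmBl (dotmC q p); ring.
  by lra.
have [->|n0] := eqVneq (l2 (p - q)) 0; first exact: l2_ge0.
have np : 0 < l2 (p - q) by rewrite lt_neqAle eq_sym n0 l2_ge0.
by rewrite -(ler_pM2r np) -expr2; apply: le_trans h3 (ler_dotm _ _).
Qed.

Lemma proj_id u : S u -> proj S u = u.
Proof.
move=> Su; have [_ /(_ _ Su)] := proj_argmin u.
rewrite subrr l20 => h; apply/eqP; rewrite -subr_eq0; apply/eqP.
by apply: l2_eq0; apply/le_anti; rewrite h l2_ge0.
Qed.

Lemma proj_le v u : S u -> l2 (proj S v - u) <= l2 (v - u).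
Proof. by move=> Su; rewrite -{1}(proj_id Su) proj_nonexpansive. Qed.

End proj.

End projection.

(** * The Loewner cone *)

Section loewner.
Context {R : realType}.

Lemma l2_lipschitz_continuousR (m n : nat) (h : 'M[R]_(m, n) -> R) (L : R) :
  (forall u v, `|h u - h v| <= L * l2 (u - v)) -> continuous h.
Proof.
move=> hL u; apply/(@l2_continuousP _ _ _ R^o) => e e0; exists (e / (`|L| + 1)).
  by rewrite divr_gt0// ltr_wpDl.
move=> v; rewrite ltr_pdivlMr ?ltr_wpDl// => uv; apply: le_lt_trans (hL _ _) _.
apply: le_lt_trans uv; rewrite mulrC ler_wpM2l ?l2_ge0//.
by apply: le_trans (ler_norm _) _; rewrite lerDl.
Qed.

Lemma closed_l2_ball (m n : nat) (C : R) : closed [set H : 'M[R]_(m, n) | l2 H <= C].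
Proof. by apply: (preimage_closed _ (@closed_le _ C)) => u _; exact: continuous_l2. Qed.

Lemma segment_closed_l2_ball (m n : nat) (C : R) :
  segment_closed [set H : 'M[R]_(m, n) | l2 H <= C].
Proof.
move=> u v t /= uC vC t0 t1.
have -> : u + t *: (v - u) = (1 - t) *: u + t *: v by mx_ring.
apply: le_trans (l2_triangle _ _) _; rewrite !l2Z !ger0_norm ?subr_ge0//.
have -> : C = (1 - t) * C + t * C by ring.
by apply: lerD; rewrite ler_wpM2l ?subr_ge0.
Qed.

Lemma quad_dotm n (v : 'cV[R]_n) (A : 'M[R]_n) : (v^T *m A *m v) 0 0 = dotm v (A *m v).
Proof. by rewrite /dotm mulmxA /mxtrace big_ord1. Qed.

(** Symmetry and each of the inequalities defining the order are closed
    conditions. *)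
Lemma closed_loewner n (M : 'M[R]_n) : closed [set H | loewner_ge H M].
Proof.
have -> : [set H | loewner_ge H M] = [set H | l2 ((H - M)^T - (H - M)) <= 0] `&`
   \bigcap_(v in [set: 'cV[R]_n]) [set H | 0 <= dotm v ((H - M) *m v)].
  apply/seteqP; split=> [H [/= Hs Hp]|H [/= Hs Hp]].
    by split=> /= [|v _ /=]; rewrite ?Hs ?subrr ?l20// -quad_dotm.
  split=> [|v]; last by rewrite quad_dotm; exact: Hp.
  apply/eqP; rewrite -subr_eq0; apply/eqP/l2_eq0/le_anti.
  by rewrite Hs l2_ge0.
apply: closedI; last first.
  apply: closed_bigI => v _; apply: (preimage_closed _ (@closed_ge _ 0)) => H _.
  apply: (@l2_lipschitz_continuousR _ _ _ (l2 v * l2 v)) => A B.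
  rewrite -dotmBr -mulmxBl opprB addrA subrK.
  apply: le_trans (cauchy_schwarz _ _) _; rewrite -mulrA ler_wpM2l ?l2_ge0//.
  by rewrite mulrC; exact: l2_mulmx.
apply: (preimage_closed _ (@closed_le _ 0)) => H _.
apply: (@l2_lipschitz_continuousR _ _ _ 2) => A B; apply: le_trans (ler_l2B _ _) _.
have -> : (A - M)^T - (A - M) - ((B - M)^T - (B - M)) = (A - B)^T - (A - B) by mx_ring.
by apply: le_trans (l2_sub_le _ _) _; rewrite l2_tr mulrDl !mul1r.
Qed.

Lemma segment_closed_loewner n (M : 'M[R]_n) : segment_closed [set H | loewner_ge H M].
Proof.
move=> u v t /= [us up] [vs vp] t0 t1.
have e : u + t *: (v - u) - M = (1 - t) *: (u - M) + t *: (v - M) by mx_ring.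
split=> [|w]; first by rewrite e linearD !linearZ/= us vs.
rewrite e quad_dotm mulmxDl dotmDr -!scalemxAl !dotmZr -!quad_dotm.
by rewrite addr_ge0// mulr_ge0 ?subr_ge0.
Qed.

Section loewner_ge_scalar.
Context {n : nat} {H : 'M[R]_n} {mu : R}.
Hypothesis Hmu : loewner_ge H mu%:M.

Lemma loewner_ge_sym : H^T = H.
Proof.
by have [/eqP + _] := Hmu; rewrite linearB/= tr_scalar_mx subr_eq subrK => /eqP.
Qed.

(** The trace form is the sum over the columns of [X] of the quadratic form. *)
Lemma loewner_ge_quad k (X : 'M[R]_(n, k)) : mu * l2 X ^+ 2 <= dotm X (H *m X).
Proof.
have [_ Hp] := Hmu.
suff : 0 <= dotm X ((H - mu%:M) *m X).
  by rewrite mulmxBl dotmBr mul_scalar_mx dotmZr subr_ge0 l2_sqr.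
rewrite /dotm /mxtrace; apply: sumr_ge0 => j _.
have := Hp (col j X); rewrite quad_dotm dotm_cV [in X in _ -> X]mxE.
congr (_ <= _); apply: eq_bigr => i _; rewrite !mxE; congr (_ * _).
by apply: eq_bigr => l _; rewrite [in RHS]mxE !mxE.
Qed.

Lemma loewner_ge_expand k (X : 'M[R]_(n, k)) : mu * l2 X <= l2 (H *m X).
Proof.
have [->|X0] := eqVneq (l2 X) 0; first by rewrite mulr0 l2_ge0.
have Xp : 0 < l2 X by rewrite lt_neqAle eq_sym X0 l2_ge0.
rewrite -(ler_pM2r Xp) -mulrA -expr2; apply: le_trans (loewner_ge_quad X) _.
by rewrite mulrC; exact: ler_dotm.
Qed.

Hypothesis mu0 : 0 < mu.

Lemma loewner_ge_unit : H \in unitmx.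
Proof.
rewrite -row_free_unit -kermx_eq0; apply/eqP/row_matrixP => i; rewrite row0.
have : row i (kermx H) *m H = 0 by apply/sub_kermxP; exact: row_sub.
move=> /(congr1 trmx); rewrite trmx_mul loewner_ge_sym trmx0 => e.
have := loewner_ge_expand (row i (kermx H))^T; rewrite e l20 l2_tr pmulr_rle0// => le0.
by apply: l2_eq0; apply/le_anti; rewrite le0 l2_ge0.
Qed.

(** The factor [l2 1] is there because the Frobenius norm of the identity is not
    one. *)
Lemma loewner_ge_inv : l2 (invmx H) <= l2 (1%:M : 'M[R]_n) / mu.
Proof.
rewrite ler_pdivlMr// mulrC; apply: le_trans (loewner_ge_expand _) _.
by rewrite mulmxV// loewner_ge_unit.
Qed.

Lemma loewner_ge_inv_le k (X : 'M[R]_(n, k)) : l2 (invmx H *m X) <= l2 X / mu.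
Proof.
rewrite ler_pdivlMr// mulrC; apply: le_trans (loewner_ge_expand _) _.
by rewrite mulmxA mulmxV ?mul1mx// loewner_ge_unit.
Qed.

End loewner_ge_scalar.

Lemma loewner_ge_refl n (M : 'M[R]_n) : M^T = M -> loewner_ge M M.
Proof.
by move=> Ms; split=> [|v]; [rewrite linearB/= Ms | rewrite subrr mulmx0 mul0mx mxE].
Qed.

End loewner.

(** * Derivatives along segments *)

Section segments.
Context {R : realType}.

Lemma is_derive_line (V W : normedModType R) (h : V -> W) (z v : V) (t0 : R) :
  differentiable h (z + t0 *: v) ->
  is_derive t0 1 (fun t : R => h (z + t *: v)) ('D_v h (z + t0 *: v)).
Proof.
move=> dh.
have e : (fun s : R => s^-1 *: (((fun t : R => h (z + t *: v)) \o shift t0) (s *: (1 : R)) - h (z + t0 *: v)))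
    = (fun s : R => s^-1 *: ((h \o shift (z + t0 *: v)) (s *: v) - h (z + t0 *: v))).
  apply/funext => s /=; congr (_ *: (h _ - _)).
  by rewrite [s *: 1]mulr1 scalerDl addrCA.
by split; rewrite /derivable /derive e//; exact: diff_derivable.
Qed.

Lemma derive_grad (n : nat) (h : 'cV[R]_n -> R) x v :
  differentiable h x -> 'D_v h x = dotm (grad h x) v.
Proof.
move=> dh; rewrite dotm_cV deriveE//.
have {1}-> : v = \sum_i v i 0 *: delta_mx i 0.
  rewrite {1}(matrix_sum_delta v); apply: eq_bigr => i _.
  by rewrite big_ord1.
rewrite linear_sum; apply: eq_bigr => i _.
by rewrite linearZ/= -deriveE// /grad mxE mulrC.
Qed.

Lemma is_derive_grad_line (n : nat) (h : 'cV[R]_n -> R) x v (t : R) :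
  differentiable h (x + t *: v) ->
  is_derive t 1 (fun s : R => h (x + s *: v)) (dotm (grad h (x + t *: v)) v).
Proof. by move=> dh; rewrite -derive_grad//; exact: is_derive_line. Qed.

Section joint.
Context {d dy : nat}.
Implicit Types (h : 'cV[R]_d -> 'cV[R]_dy -> R) (x v : 'cV[R]_d) (y w : 'cV[R]_dy).

Lemma joint_differentiable_x h x y :
  joint_differentiable h -> differentiable (fun x' => h x' y) x.
Proof.
move=> dh; apply: (@differentiable_comp _ _ _ _ (fun x' => (x', y)) (fun z => h z.1 z.2)) => //.
Qed.

Lemma joint_differentiable_y h x y :
  joint_differentiable h -> differentiable (h x) y.
Proof.
move=> dh; apply: (@differentiable_comp _ _ _ _ (fun y' => (x, y')) (fun z => h z.1 z.2)) => //.
Qed.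

(** Joint differentiability makes the directional derivative additive in the two
    blocks of variables. *)
Lemma derive_joint h x y v w : joint_differentiable h ->
  'D_(v, w) (fun z => h z.1 z.2) (x, y)
    = dotm (grad_x h x y) v + dotm (grad_y h x y) w.
Proof.
move=> dh.
have -> : (v, w) = (v, 0) + (0, w) by congr (_, _); rewrite /= ?addr0 ?add0r.
rewrite deriveE// linearD -!deriveE//; congr (_ + _).
  rewrite /grad_x -derive_grad; last exact: joint_differentiable_x.
  congr (lim (_ @ 0^')); apply/funext => s /=.
  by rewrite scaler0 add0r.
rewrite /grad_y -derive_grad; last exact: joint_differentiable_y.
congr (lim (_ @ 0^')); apply/funext => s /=.
by rewrite scaler0 add0r.
Qed.

Lemma is_derive_joint_line h x y v w (t : R) : joint_differentiable h ->
  is_derive t 1 (fun s : R => h (x + s *: v) (y + s *: w))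
    (dotm (grad_x h (x + t *: v) (y + t *: w)) v
     + dotm (grad_y h (x + t *: v) (y + t *: w)) w).
Proof.
move=> dh; rewrite -derive_joint//.
exact: (@is_derive_line _ _ (fun z : 'cV[R]_d * 'cV[R]_dy => h z.1 z.2) (x, y) (v, w) t).
Qed.

Lemma joint_differentiable_coord (n : nat) (G : 'cV[R]_d -> 'cV[R]_dy -> 'cV[R]_n) j :
  joint_differentiable G -> joint_differentiable (fun x y => G x y j 0).
Proof.
move=> dG z; apply: (@differentiable_comp _ _ _ _ (fun z => G z.1 z.2)
  (fun M : 'cV[R]_n => M j 0)) => //.
exact: differentiable_coord.
Qed.

Lemma is_derive_grad_y_line h x y v w q (t : R) : joint_differentiable (grad_y h) ->
  is_derive t 1 (fun s : R => dotm q (grad_y h (x + s *: v) (y + s *: w)))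
    (dotm q ((hess_xy h (x + t *: v) (y + t *: w))^T *m v
      + (hess_yy h (x + t *: v) (y + t *: w))^T *m w)).
Proof.
move=> dG.
have -> : (fun s : R => dotm q (grad_y h (x + s *: v) (y + s *: w))) =
    \sum_(j < dy) (fun s : R => q j 0 *: grad_y h (x + s *: v) (y + s *: w) j 0).
  by apply/funext => s; rewrite dotm_cV fct_sumE.
rewrite dotm_cV; apply: is_derive_sum => j.
have dj := joint_differentiable_coord j dG.
apply: is_deriveZ; apply: is_derive_eq; first exact: (is_derive_joint_line _ _ _ _ _ dj).
rewrite !mxE; congr (_ + _); rewrite dotm_cV; apply: eq_bigr => i _;
  by rewrite !mxE.
Qed.

End joint.

Lemma mvt_segment (phi dphi : R -> R) (b : R) : 0 <= b ->
  (forall t : R, 0 <= t -> t <= b -> is_derive t 1 phi (dphi t)) ->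
  exists2 t, 0 <= t <= b & phi b - phi 0 = dphi t * b.
Proof.
move=> b0 dp; have [|||t + ->] := @MVT_segment _ phi dphi 0 b => //.
- by move=> t; rewrite in_itv/= => /andP[/ltW ? /ltW ?]; exact: dp.
- apply: derivable_within_continuous => t; rewrite in_itv/= => /andP[t0 tb].
  by have [] := dp t t0 tb.
- by rewrite in_itv/= => ?; exists t; rewrite ?subr0.
Qed.

(** Taylor's inequality: integrate the lower bound on the second derivative
    twice. *)
Lemma taylor_lower_bound (phi dphi ddphi : R -> R) (c : R) :
  (forall t : R, 0 <= t -> t <= 1 -> is_derive t 1 phi (dphi t)) ->
  (forall t : R, 0 <= t -> t <= 1 -> is_derive t 1 dphi (ddphi t)) ->
  (forall t, 0 <= t -> t <= 1 -> c <= ddphi t) ->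
  dphi 0 + c / 2 <= phi 1 - phi 0.
Proof.
move=> d1 d2 hc.
have hd t : 0 <= t -> t <= 1 -> dphi 0 + c * t <= dphi t.
  move=> t0 t1; have [|s /andP[s0 st] e] := @mvt_segment dphi ddphi t t0.
    by move=> r r0 rt; apply: d2 => //; exact: le_trans rt t1.
  rewrite addrC -lerBrDr e ler_wpM2r// hc//; exact: le_trans st t1.
pose psi t := phi t - c / 2 * t ^+ 2.
have [|t /andP[t0 t1]] := @mvt_segment psi (fun t => dphi t - c * t) 1 ler01.
  move=> t t0 t1.
  have dq : is_derive t 1 ((c / 2) *: ((id : R -> R) ^+ 2)) (c * t).
    by apply: is_derive_eq; rewrite expr1 -mulr_natl /GRing.scale/=; field.
  exact: (is_deriveB (d1 t t0 t1) dq).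
by rewrite /psi mulr1 expr1n expr0n/= mulr0 subr0; have := hd t t0 t1; lra.
Qed.

(** A derivative is determined by one-sided values, so a bound on the right of
    the origin is enough. *)
Lemma is_derive_quadratic_eq0 (phi : R -> R) (D C : R) :
  is_derive (0 : R) 1 phi D ->
  (forall t, 0 <= t -> t <= 1 -> `|phi t| <= C * t ^+ 2) -> D = 0.
Proof.
move=> dphi hC.
have p0 : phi 0 = 0.
  by have := hC 0 (lexx _) ler01; rewrite expr0n/= mulr0 normr_le0 => /eqP.
have C0 : 0 <= C by have := hC 1 ler01 (lexx _); rewrite expr1n mulr1; apply: le_trans.
apply/eqP/negPn/negP => D0; have Dp : 0 < `|D| / 2 by rewrite divr_gt0// normr_gt0.
have [dp Dv] := dphi.
have /cvgrPdist_lt/(_ _ Dp)[del /= del0 H] :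
    (fun h : R => h^-1 *: ((phi \o shift 0) (h *: (1 : R)) - phi 0)) @ 0^' --> D.
  by rewrite -Dv; exact: dp.
pose s := Num.min (del / 2) (Num.min 1 (`|D| / 2 / (C + 1))).
have s0 : 0 < s.
  by rewrite !lt_min ltr01 (divr_gt0 del0)//= divr_gt0// ltr_wpDl.
have s1 : s <= 1 by rewrite !ge_min lexx orbT.
have sD : (C + 1) * s <= `|D| / 2.
  by rewrite mulrC -ler_pdivlMr ?ltr_wpDl// !ge_min lexx !orbT.
have sdel : s < del.
  by apply: (@le_lt_trans _ _ (del / 2)); [rewrite ge_min lexx | lra].
have := H s; rewrite /= sub0r normrN gtr0_norm// => /(_ sdel (lt0r_neq0 s0)).
rewrite addr0 [s *: 1]mulr1 p0 subr0 /GRing.scale/= => h.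
have hq : `|s^-1 * phi s| <= C * s.
  rewrite normrM gtr0_norm ?invr_gt0// ler_pdivrMl// mulrCA -expr2; exact: hC (ltW s0) s1.
have : `|D| <= `|D - s^-1 * phi s| + `|s^-1 * phi s|.
  by rewrite -{1}(subrK (s^-1 * phi s) D) ler_normD.
lra.
Qed.

End segments.

(** * The lower-level solution map and the hypergradient *)

Section bilevel.
Context {R : realType} {d dy : nat}.
Variables (f g : 'cV[R]_d -> 'cV[R]_dy -> R) (X : set 'cV[R]_d)
  (ystar : 'cV[R]_d -> 'cV[R]_dy) (mu Lg Cxy Lxy Lyy Cfy : R).
Hypotheses (Xcv : segment_closed X) (mu0 : 0 < mu)
  (Cxy0 : 0 <= Cxy) (Lxy0 : 0 <= Lxy) (Lyy0 : 0 <= Lyy) (Cfy0 : 0 <= Cfy)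
  (df : joint_differentiable f)
  (dg : joint_differentiable g) (dGg : joint_differentiable (grad_y g))
  (ystar_min : forall x, X x -> argmin_on setT (g x) (ystar x))
  (g_convex : strong_convexity_assumption g X mu)
  (lip_grad_g : forall x, X x -> lipschitz_l2 Lg setT (grad_y g x))
  (bnd_gxy : forall x y, X x -> l2 (hess_xy g x y) <= Cxy)
  (lip_gxy : forall x y x' y', X x -> X x' ->
     l2 (hess_xy g x y - hess_xy g x' y') <= Lxy * (l2 (x - x') + l2 (y - y')))
  (lip_gyy : forall x y x' y', X x -> X x' ->
     l2 (hess_yy g x y - hess_yy g x' y') <= Lyy * (l2 (x - x') + l2 (y - y')))
  (bnd_fy : forall x y, X x -> l2 (grad_y f x y) <= Cfy).

(** Fermat's rule on the line through [ystar x] in the direction of the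
    gradient. *)
Lemma grad_y_ystar x : X x -> grad_y g x (ystar x) = 0.
Proof.
move=> Xx; have [_ ymin] := ystar_min Xx.
set q := grad_y g x (ystar x).
have dline (t : R) : is_derive t 1 (fun s : R => g x (ystar x + s *: q))
    (dotm (grad (g x) (ystar x + t *: q)) q).
  by apply: is_derive_grad_line; exact: joint_differentiable_y.
have [||||_ d0] := @derive1_at_min R (fun s : R => g x (ystar x + s *: q)) (-1) 1 0.
- by rewrite lerNl opprK lerN10 || lra.
- by move=> t _; have [] := dline t.
- by rewrite in_itv/= ltr01 andbT; lra.
- by move=> t _; rewrite scale0r addr0; exact: ymin.
have [_] := dline 0; rewrite d0 scale0r addr0 => /esym.
rewrite -l2_sqr => /eqP; rewrite sqrf_eq0 => /eqP; exact: l2_eq0.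
Qed.

(** Mean value theorem for the gradient paired with [y' - y], along the segment
    from [y] to [y']. *)
Lemma grad_y_strong_monotone x y y' : X x ->
  mu * l2 (y' - y) ^+ 2 <= dotm (grad_y g x y' - grad_y g x y) (y' - y).
Proof.
move=> Xx; set w := y' - y.
have [|t _] := @mvt_segment R (fun s => dotm w (grad_y g x (y + s *: w)))
   (fun s => dotm w ((hess_yy g x (y + s *: w))^T *m w)) 1 ler01.
  move=> t _ _; have := is_derive_grad_y_line x y 0 w w t dGg.
  rewrite scaler0 addr0 mulmx0 add0r => h.
  by rewrite (_ : (fun s => _) = (fun s : R => dotm w (grad_y g (x + s *: 0) (y + s *: w))))//;
    apply/funext => s; rewrite scaler0 addr0.
have e1 : y + w = y' by rewrite /w addrC subrK.
rewrite mulr1 scale1r scale0r addr0 -dotmBr e1 dotmC => ->.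
by rewrite (loewner_ge_sym (g_convex _ Xx)); exact: (loewner_ge_quad (g_convex _ Xx)).
Qed.

Lemma grad_y_lipschitz_x x x' y : X x -> X x' ->
  l2 (grad_y g x' y - grad_y g x y) <= Cxy * l2 (x' - x).
Proof.
move=> Xx Xx'; set v := x' - x; set q := grad_y g x' y - grad_y g x y.
have [|t /andP[t0 t1]] := @mvt_segment R (fun s => dotm q (grad_y g (x + s *: v) y))
   (fun s => dotm q ((hess_xy g (x + s *: v) y)^T *m v)) 1 ler01.
  move=> t _ _; have := is_derive_grad_y_line x y v 0 q t dGg.
  rewrite scaler0 addr0 mulmx0 addr0 => h.
  by rewrite (_ : (fun s => _) = (fun s : R => dotm q (grad_y g (x + s *: v) (y + s *: 0))))//;
    apply/funext => s; rewrite scaler0 addr0.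
rewrite mulr1 scale1r scale0r addr0 -dotmBr {1}/v (addrC x) subrK -/q => e.
have h : l2 q ^+ 2 <= l2 q * (Cxy * l2 v).
  rewrite l2_sqr e; apply: le_trans (ler_dotm _ _) _; rewrite ler_wpM2l ?l2_ge0//.
  apply: le_trans (l2_mulmx _ _) _; rewrite l2_tr ler_wpM2r ?l2_ge0//.
  by apply: bnd_gxy; exact: Xcv.
have [->|q0] := eqVneq (l2 q) 0; first by rewrite mulr_ge0 ?l2_ge0.
by move: h; rewrite expr2 ler_pM2l// lt_neqAle eq_sym q0 l2_ge0.
Qed.

(** Strong monotonicity at [x'] against the variation of the gradient at
    [ystar x] between [x] and [x']. *)
Lemma ystar_lipschitz x x' : X x -> X x' ->
  l2 (ystar x' - ystar x) <= Cxy / mu * l2 (x' - x).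
Proof.
move=> Xx Xx'; set w := ystar x' - ystar x.
have := grad_y_strong_monotone (ystar x) (ystar x') Xx'.
rewrite grad_y_ystar// -/w sub0r -[grad_y g x' _]subr0 -(grad_y_ystar Xx) => h.
have h' : mu * l2 w ^+ 2 <= Cxy * l2 (x' - x) * l2 w.
  apply: le_trans h _; apply: le_trans (ler_dotm _ _) _.
  by rewrite l2N ler_wpM2r ?l2_ge0// grad_y_lipschitz_x.
have [->|w0] := eqVneq (l2 w) 0; first by rewrite !mulr_ge0 ?l2_ge0 ?invr_ge0// ltW.
have wp : 0 < l2 w by rewrite lt_neqAle eq_sym w0 l2_ge0.
by rewrite mulrAC ler_pdivlMr// mulrC -(ler_pM2r wp) -mulrA -expr2.
Qed.

Lemma gradient_step_contraction x y b : X x -> 0 <= b ->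
  l2 (y - b *: grad_y g x y - ystar x) ^+ 2
    <= (1 - 2 * b * mu + b ^+ 2 * Lg ^+ 2) * l2 (y - ystar x) ^+ 2.
Proof.
move=> Xx b0; have h1 := grad_y_strong_monotone (ystar x) y Xx.
have h2 : l2 (grad_y g x y) <= Lg * l2 (y - ystar x).
  by have := @lip_grad_g x Xx y (ystar x) I I; rewrite grad_y_ystar// subr0.
rewrite grad_y_ystar// subr0 in h1.
rewrite (_ : y - _ - _ = (y - ystar x) - b *: grad_y g x y); last by mx_ring.
rewrite (l2_sqrBE (y - ystar x)) dotmZr (dotmC _ (grad_y g x y)) l2Z exprMn real_normK ?num_real//.
have h3 : l2 (grad_y g x y) ^+ 2 <= Lg ^+ 2 * l2 (y - ystar x) ^+ 2.
  by rewrite -exprMn ler_pXn2r// nnegrE ?l2_ge0// (le_trans (l2_ge0 _) h2).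
move: (l2 (y - ystar x) ^+ 2) (l2 (grad_y g x y) ^+ 2) (dotm _ _) h1 h3 => A B D h1 h3.
have : b * (mu * A) <= b * D by rewrite ler_wpM2l.
have : b ^+ 2 * B <= b ^+ 2 * (Lg ^+ 2 * A) by rewrite ler_wpM2l// sqr_ge0.
lra.
Qed.

(** The direction in which the lower-level solution moves when the upper-level
    variable moves along [v]: minus the inverse Hessian times the mixed
    derivative, by the implicit function theorem. *)
Definition ystar_dir x v : 'cV[R]_dy :=
  - (invmx (hess_yy g x (ystar x)) *m (hess_xy g x (ystar x))^T *m v).

Definition ystar_curv : R := (Lxy + Lyy * (Cxy / mu)) * (1 + Cxy / mu) / mu.

(** Second-order expansion of the solution map, obtained without
    differentiating it twice: the lower-level gradient vanishes at both ends of
    the segment joining two solution pairs, so by Rolle's theorem its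
    derivative along that segment vanishes in a prescribed direction at some
    intermediate point; moving the Hessian blocks back to the left endpoint
    costs their Lipschitz constants times the length of the segment. *)
Lemma ystar_expansion x x' : X x -> X x' ->
  l2 (ystar x' - ystar x - ystar_dir x (x' - x)) <= ystar_curv * l2 (x' - x) ^+ 2.
Proof.
move=> Xx Xx'; set v := x' - x; set w := ystar x' - ystar x.
pose A := hess_xy g x (ystar x); pose B := hess_yy g x (ystar x).
have Bpos : loewner_ge B mu%:M by exact: g_convex.
(* The direction in which Rolle's theorem is applied: the defect to be bounded,
   before multiplication by the inverse Hessian. *)
pose q := A^T *m v + B *m w.
have [|t /andP[t0 t1]] := @mvt_segment R
   (fun s => dotm q (grad_y g (x + s *: v) (ystar x + s *: w)))
   (fun s => dotm q ((hess_xy g (x + s *: v) (ystar x + s *: w))^T *m v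
     + (hess_yy g (x + s *: v) (ystar x + s *: w))^T *m w)) 1 ler01.
  by move=> t _ _; exact: is_derive_grad_y_line.
have Xt : X (x + t *: v) by exact: Xcv.
rewrite mulr1 !scale1r !scale0r !addr0 {1}/v {1}/w !(addrC x) !(addrC (ystar x)) !subrK.
rewrite !grad_y_ystar// !dotm0 subrr.
rewrite (addrC _ x) (addrC _ (ystar x)).
set At := hess_xy g _ _; set Bt := hess_yy g _ _.
rewrite (loewner_ge_sym (g_convex _ Xt)) -/Bt => /esym e0.
have wle : l2 w <= Cxy / mu * l2 v by exact: ystar_lipschitz.
have steps : l2 (x - (x + t *: v)) + l2 (ystar x - (ystar x + t *: w)) <= l2 v + l2 w.
  rewrite !opprD !addNKr !l2N !l2Z ger0_norm//.
  by apply: lerD; rewrite ler_piMl ?l2_ge0.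
have hA : l2 (A - At) <= Lxy * (l2 v + l2 w).
  by apply: le_trans (lip_gxy _ _ _ _) _ => //; rewrite ler_wpM2l.
have hB : l2 (B - Bt) <= Lyy * (l2 v + l2 w).
  by apply: le_trans (lip_gyy _ _ _ _) _ => //; rewrite ler_wpM2l.
have hq : l2 q <= (Lxy * l2 v + Lyy * l2 w) * (l2 v + l2 w).
  have h : l2 q ^+ 2 <= l2 q * ((Lxy * l2 v + Lyy * l2 w) * (l2 v + l2 w)).
    have -> : l2 q ^+ 2 = dotm q ((A - At)^T *m v + (B - Bt) *m w).
      rewrite l2_sqr -[LHS]subr0 -e0 -dotmBr; congr dotm.
      have -> : (A - At)^T = A^T - At^T by rewrite [LHS]linearB.
      by rewrite /q (mulmxBl A^T) (mulmxBl B) opprD addrACA.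
    apply: le_trans (ler_dotm _ _) _; rewrite ler_wpM2l ?l2_ge0//.
    apply: le_trans (l2_triangle _ _) _.
    rewrite [leRHS]mulrDl.
    apply: lerD; apply: le_trans (l2_mulmx _ _) _.
      by rewrite l2_tr; have := ler_wpM2r (l2_ge0 v) hA; rewrite [in X in X -> _]mulrAC.
    by have := ler_wpM2r (l2_ge0 w) hB; rewrite [in X in X -> _]mulrAC.
  have [->|q0] := eqVneq (l2 q) 0.
    by rewrite mulr_ge0 ?addr_ge0 ?mulr_ge0 ?l2_ge0.
  by move: h; rewrite expr2 ler_pM2l// lt_neqAle eq_sym q0 l2_ge0.
have -> : w - ystar_dir x v = invmx B *m q.
  rewrite /ystar_dir -/A -/B opprK /q (mulmxDr (invmx B)) (mulmxA _ A^T) (mulmxA _ B).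
  by rewrite mulVmx ?(loewner_ge_unit Bpos mu0)// mul1mx addrC.
apply: le_trans (loewner_ge_inv_le Bpos mu0 _) _.
rewrite /ystar_curv mulrAC ler_wpM2r ?invr_ge0 ?(ltW mu0)//.
apply: le_trans hq _.
have v0 := l2_ge0 v; have w0 := l2_ge0 w.
move: (l2 v) (l2 w) v0 w0 wle => a b a0 b0 ab.
have -> : (Lxy + Lyy * (Cxy / mu)) * (1 + Cxy / mu) * a ^+ 2
    = (Lxy * a + Lyy * (Cxy / mu * a)) * (a + Cxy / mu * a) by ring.
by apply: ler_pM; rewrite ?addr_ge0 ?mulr_ge0// ?lerD ?ler_wpM2l.
Qed.

(** The total derivative of the outer objective predicted by implicit
    differentiation. *)
Definition hypergrad x : 'cV[R]_d :=
  grad_x f x (ystar x)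
  - hess_xy g x (ystar x) *m invmx (hess_yy g x (ystar x)) *m grad_y f x (ystar x).

Lemma f_lipschitz_y x y y' : X x -> `|f x y' - f x y| <= Cfy * l2 (y' - y).
Proof.
move=> Xx; set w := y' - y.
have [|t _] := @mvt_segment R (fun s => f x (y + s *: w))
   (fun s => dotm (grad_y f x (y + s *: w)) w) 1 ler01.
  by move=> t _ _; apply: is_derive_grad_line; exact: joint_differentiable_y.
rewrite mulr1 scale1r scale0r addr0 {1}/w (addrC y) subrK => ->.
by apply: le_trans (cauchy_schwarz _ _) _; rewrite ler_wpM2r ?l2_ge0// bnd_fy.
Qed.

(** The set may have empty interior and the solution map is arbitrary outside
    it, so only the components of the gradient along the set are determined;
    they are read off one-sided difference quotients. *)
Lemma grad_outer_obj_segment x x' : X x -> X x' ->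
  differentiable (outer_obj f ystar) x ->
  dotm (grad (outer_obj f ystar) x) (x' - x) = dotm (hypergrad x) (x' - x).
Proof.
move=> Xx Xx' dF; set v := x' - x; set F := outer_obj f ystar.
pose w := ystar_dir x v; pose y := ystar x.
have d1 : is_derive (0 : R) 1 (fun t : R => F (x + t *: v)) (dotm (grad F x) v).
  have := @is_derive_grad_line _ _ F x v 0.
  by rewrite scale0r addr0; apply.
have d2 : is_derive (0 : R) 1 (fun t : R => f (x + t *: v) (y + t *: w))
     (dotm (grad_x f x y) v + dotm (grad_y f x y) w).
  have := is_derive_joint_line x y v w 0 df.
  by rewrite !scale0r !addr0.
have := is_derive_quadratic_eq0 (is_deriveB d1 d2) (C := Cfy * (ystar_curv * l2 v ^+ 2)).
rewrite /hypergrad dotmBl -/y => /(_ _)/eqP.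
have -> : dotm (grad_y f x y) w
   = - dotm (hess_xy g x y *m invmx (hess_yy g x y) *m grad_y f x y) v.
  rewrite /w /ystar_dir dotmNr -/y; congr (- _).
  rewrite dotm_mull trmx_mul trmxK trmx_inv (loewner_ge_sym (g_convex _ Xx)).
  by [].
rewrite subr_eq0 => h; apply/eqP/h => t t0 t1 /=.
have Xt : X (x + t *: v) by exact: Xcv.
apply: le_trans (f_lipschitz_y _ _ Xt) _; rewrite -mulrA ler_wpM2l//.
have := ystar_expansion Xx Xt; rewrite (addrC x) addrK -(addrC x) l2Z exprMn real_normK ?num_real//.
have -> : ystar (x + t *: v) - ystar x - ystar_dir x (t *: v) = ystar (x + t *: v) - (y + t *: w).
  by rewrite /ystar_dir -scalemxAr -scalerN opprD addrA.
by move/le_trans; apply; rewrite mulrCA mulrC mulrA.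
Qed.

(** Weak convexity bounds the second derivative along the segment from below. *)
Lemma outer_obj_lower_bound muF x x' :
  weak_convexity_assumption (outer_obj f ystar) X muF -> X x -> X x' ->
  dotm (hypergrad x) (x' - x) + muF / 2 * l2 (x' - x) ^+ 2
    <= outer_obj f ystar x' - outer_obj f ystar x.
Proof.
move=> wc Xx Xx'; rewrite -grad_outer_obj_segment//; last by have [] := wc _ Xx.
set F := outer_obj f ystar; set v := x' - x.
have Xt (t : R) : 0 <= t -> t <= 1 -> X (x + t *: v) by move=> ? ?; exact: Xcv.
have := @taylor_lower_bound R (fun t => F (x + t *: v))
  (fun t => dotm (grad F (x + t *: v)) v)
  (fun t => dotm v ((hess F (x + t *: v)) *m v)) (muF * l2 v ^+ 2).
rewrite scale0r addr0 scale1r {5}/v (addrC x) subrK mulrAC; apply.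
- by move=> t t0 t1; apply: is_derive_grad_line; have [] := wc _ (Xt t t0 t1).
- move=> t t0 t1; have [dF dG hF] := wc _ (Xt t t0 t1).
  have -> : (fun s : R => dotm (grad F (x + s *: v)) v)
     = \sum_(j < d) (fun s : R => v j 0 *: grad F (x + s *: v) j 0).
    by apply/funext => s; rewrite dotmC dotm_cV fct_sumE.
  rewrite dotm_cV; apply: is_derive_sum => j; apply: is_deriveZ.
  have dGj : differentiable (fun u => grad F u j 0) (x + t *: v).
    apply: (@differentiable_comp _ _ _ _ (grad F) (fun M : 'cV[R]_d => M j 0)) => //.
    exact: differentiable_coord.
  apply: is_derive_eq; first exact: (is_derive_grad_line dGj).
  rewrite -(loewner_ge_sym hF) dotm_cV mxE; apply: eq_bigr => i _.
  by rewrite !mxE.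
- move=> t t0 t1; have [_ _ hF] := wc _ (Xt t t0 t1).
  exact: loewner_ge_quad hF _ v.
Qed.

End bilevel.

(** * Moreau envelope *)

Section envelope.
Context {R : realType} {d : nat}.
Variables (F : 'cV[R]_d -> R) (X : set 'cV[R]_d) (rho m : R) (x0 : 'cV[R]_d).
Hypotheses (Xcl : closed X) (Xcv : segment_closed X) (Xx0 : X x0) (rho0 : 0 < rho)
  (F_cont : forall x, X x -> {for x, continuous F}) (F_ge : forall x, X x -> m <= F x).

(** The Moreau envelope, the value of the minimization problem solved by [prox]. *)
Definition envelope z := F (prox F X rho z) + rho / 2 * l2 (prox F X rho z - z) ^+ 2.

Let rho2 : 0 < rho / 2. Proof. by rewrite divr_gt0. Qed.

Lemma le_of_sqr_le (a b : R) : a ^+ 2 <= b -> a <= b + 1.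
Proof. by have := sqr_ge0 (a - 1); rewrite sqrrB1 => h1 h2; nra. Qed.

(** The lower bound [m] makes the regularized objective coercive. *)
Lemma prox_argmin z :
  argmin_on X (fun x => F x + rho / 2 * l2 (x - z) ^+ 2) (prox F X rho z).
Proof.
apply: getPex.
apply: (@argmin_on_nonempty _ _ _ _ _ x0
  (((F x0 + rho / 2 * l2 (x0 - z) ^+ 2 - m) / (rho / 2) + 1) + l2 z)) => //.
  move=> x Xx; apply: (@continuousD R R^o); first exact: F_cont.
  apply: (@continuousM R); first exact: cst_continuous.
  apply: (@continuousM R); apply: continuous_comp; try exact: continuous_l2.
    by apply: (@l2_lipschitz_continuous _ _ _ _ _ _ 1) => a b; rewrite opprB addrA subrK mul1r.
  by apply: (@l2_lipschitz_continuous _ _ _ _ _ _ 1) => a b; rewrite opprB addrA subrK mul1r.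
move=> u Xu h; rewrite -{1}(subrK z u); apply: le_trans (l2_triangle _ _) _.
rewrite lerD2r; apply: le_of_sqr_le; rewrite ler_pdivlMr// mulrC.
by have := F_ge Xu; lra.
Qed.

Lemma prox_in z : X (prox F X rho z).
Proof. by have [] := prox_argmin z. Qed.

Lemma envelope_le z x : X x -> envelope z <= F x + rho / 2 * l2 (x - z) ^+ 2.
Proof. by have [_ h] := prox_argmin z; exact: h. Qed.

Lemma envelope_ge z : m + rho / 2 * l2 (prox F X rho z - z) ^+ 2 <= envelope z.
Proof. by rewrite lerD2r F_ge//; exact: prox_in. Qed.

Lemma envelope_sub_ge0 z : 0 <= envelope z - m.
Proof.
rewrite subr_ge0; apply: le_trans (envelope_ge z).
by rewrite lerDl; apply: mulr_ge0; [exact: ltW | rewrite exprn_ge0// l2_ge0].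
Qed.

(** The proximal point of [z] is a competitor in the problem at [z']. *)
Lemma envelope_shift z z' : l2 (z - z') <= 1 ->
  envelope z' <= envelope z + rho / 2 * ((2 * l2 (prox F X rho z - z) + 1) * l2 (z - z')).
Proof.
move=> d1; apply: le_trans (envelope_le z' (prox_in z)) _.
rewrite /envelope -addrA lerD2l -mulrDr ler_wpM2l ?(ltW rho2)//.
have := l2_triangleB (prox F X rho z) z z'.
have := l2_ge0 (prox F X rho z - z'); have := l2_ge0 (prox F X rho z - z); have := l2_ge0 (z - z').
move: (l2 (z - z')) (l2 (prox F X rho z - z')) (l2 (prox F X rho z - z)) d1.
move=> a b c a1 a0 c0 b0 h.
have : b ^+ 2 <= (c + a) ^+ 2 by rewrite ler_pXn2r// nnegrE addr_ge0.
rewrite sqrrD; nra.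
Qed.

(** Two applications of [envelope_shift], with the roles of the points
    exchanged; the displacement at the second point is bounded through the first
    application. *)
Lemma envelope_continuous : continuous (envelope : 'cV[R]_d -> R).
Proof.
move=> z; apply/(@l2_continuousP _ _ _ R^o) => e e0.
pose r := l2 (prox F X rho z - z).
pose T := (envelope z - m) / (rho / 2) + (2 * r + 1) + 1.
have r0 : 0 <= r by exact: l2_ge0.
have T0 : 0 <= T.
  by rewrite !addr_ge0 ?mulr_ge0// ?invr_ge0 ?(ltW rho2)// envelope_sub_ge0.
pose L := rho / 2 * (2 * (r + T) + 1).
have L0 : 0 < L by rewrite mulr_gt0// ltr_wpDl// mulr_ge0// addr_ge0.
exists (Num.min 1 (e / L)); first by rewrite lt_min ltr01 divr_gt0.
move=> z'; rewrite lt_min => /andP[/ltW d1]; rewrite ltr_pdivlMr// => de.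
have h1 := envelope_shift d1.
have d1' : l2 (z' - z) <= 1 by rewrite l2B.
have h2 := envelope_shift d1'; rewrite (l2B z' z) in h2.
have h3 := envelope_ge z'.
set r' := l2 (prox F X rho z' - z') in h2 h3.
have a0 := l2_ge0 (z - z'); set a := l2 (z - z') in d1 de h1 h2 a0.
have r'T : r' <= T.
  apply: le_of_sqr_le; rewrite -(ler_pM2l rho2) [leRHS]mulrDr.
  have -> : rho / 2 * ((envelope z - m) / (rho / 2)) = envelope z - m.
    by rewrite mulrC divfK// gt_eqF.
  have : rho / 2 * ((2 * r + 1) * a) <= rho / 2 * (2 * r + 1).
    by rewrite ler_wpM2l ?(ltW rho2)// ler_piMr// addr_ge0// mulr_ge0.
  rewrite -/r in h1; lra.
rewrite -/r in h1.
have u1 : rho / 2 * ((2 * r + 1) * a) <= a * L.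
  by rewrite /L [leRHS]mulrC -[leRHS]mulrA ler_wpM2l ?(ltW rho2)// ler_wpM2r//; lra.
have u2 : rho / 2 * ((2 * r' + 1) * a) <= a * L.
  by rewrite /L [leRHS]mulrC -[leRHS]mulrA ler_wpM2l ?(ltW rho2)// ler_wpM2r//; lra.
by rewrite ltr_norml; apply/andP; split; lra.
Qed.

(** One projected step: compare with the proximal point of the starting
    position, which lies in the set, so the projection does not move away from
    it. *)
Lemma envelope_descent x h (a : R) : X x ->
  envelope (proj X (x - a *: h)) <= envelope x + rho * a * dotm (prox F X rho x - x) h
     + rho / 2 * a ^+ 2 * l2 h ^+ 2.
Proof.
move=> Xx; set p := prox F X rho x.
apply: le_trans (envelope_le _ (prox_in x)) _; rewrite -/p.
rewrite /envelope -/p -!addrA lerD2l.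
have : l2 (p - proj X (x - a *: h)) ^+ 2 <= l2 (p - x + a *: h) ^+ 2.
  rewrite ler_pXn2r// ?nnegrE ?l2_ge0// l2B.
  apply: le_trans (proj_le Xcl Xcv Xx0 _ (prox_in x)) _; rewrite l2B.
  by rewrite opprB addrA addrAC.
rewrite (l2_sqrD (p - x)) dotmZr l2Z exprMn real_normK ?num_real//.
rewrite -(ler_pM2l rho2) => /le_trans; apply.
apply: le_of_eq.
by move: (l2 _ ^+ 2) (dotm _ _) (l2 _ ^+ 2) => A B C; field.
Qed.

End envelope.

(** * Measurability of matrix-valued maps *)

Section measurability.
Context {R : realType}.

(** A derivative is the limit of countably many difference quotients, which makes
    the derivatives of a measurable family measurable. *)
Lemma derive_cvg_seq (V W : normedModType R) (f : V -> W) (a v : V) :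
  derivable f a v ->
  (fun k : nat => (k.+1%:R^-1 : R)^-1 *: (f (k.+1%:R^-1 *: v + a) - f a)) @ \oo --> 'D_v f a.
Proof.
move=> fv; have inv0 : (fun k : nat => k.+1%:R^-1 : R) @ \oo --> 0^'.
  move=> A [e /= e0 eA].
  apply: filterS (near_infty_natSinv_lt (PosNum e0)) => k /= ke.
  by apply: eA => /=; rewrite ?invr_neq0// sub0r normrN gtr0_norm.
exact: (cvg_comp _ _ inv0 fv).
Qed.

Section fixed_space.
Context {dT : measure_display} {T : measurableType dT}.

(** Measurability is tested entrywise, which involves only the Borel sets of the
    real line. *)
Definition mx_measurable (m n : nat) (u : T -> 'M[R]_(m, n)) :=
  forall i j, measurable_fun setT (fun t => u t i j).

Lemma mx_measurable_cst m n (M : 'M[R]_(m, n)) : mx_measurable (fun=> M).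
Proof. by move=> i j; exact: measurable_cst. Qed.

Lemma mx_measurableD m n (u v : T -> 'M[R]_(m, n)) :
  mx_measurable u -> mx_measurable v -> mx_measurable (fun t => u t + v t).
Proof.
move=> mu mv i j; under eq_fun do rewrite mxE.
exact: measurable_funD.
Qed.

Lemma mx_measurableN m n (u : T -> 'M[R]_(m, n)) :
  mx_measurable u -> mx_measurable (fun t => - u t).
Proof.
move=> mu i j; under eq_fun do rewrite mxE.
exact: measurable_funN.
Qed.

Lemma mx_measurableB m n (u v : T -> 'M[R]_(m, n)) :
  mx_measurable u -> mx_measurable v -> mx_measurable (fun t => u t - v t).
Proof. by move=> mu mv; apply: mx_measurableD => //; exact: mx_measurableN. Qed.

Lemma mx_measurableZ m n (a : T -> R) (u : T -> 'M[R]_(m, n)) :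
  measurable_fun setT a -> mx_measurable u -> mx_measurable (fun t => a t *: u t).
Proof.
move=> ma mu i j; under eq_fun do rewrite mxE.
exact: measurable_funM.
Qed.

Lemma mx_measurable_tr m n (u : T -> 'M[R]_(m, n)) :
  mx_measurable u -> mx_measurable (fun t => (u t)^T).
Proof.
by move=> mu i j; under eq_fun do rewrite mxE; exact: mu.
Qed.

Lemma mx_measurableM m n k (u : T -> 'M[R]_(m, n)) (v : T -> 'M[R]_(n, k)) :
  mx_measurable u -> mx_measurable v -> mx_measurable (fun t => u t *m v t).
Proof.
move=> mu mv i j; under eq_fun do rewrite mxE.
by apply: measurable_sum => l; exact: measurable_funM.
Qed.

Lemma measurable_det n (u : T -> 'M[R]_n) :
  mx_measurable u -> measurable_fun setT (fun t => \det (u t)).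
Proof.
move=> mu; rewrite /determinant; apply: measurable_sum => s.
by apply: measurable_funM => //; apply: measurable_prod => i _.
Qed.

Lemma measurable_invr : measurable_fun setT (GRing.inv : R -> R).
Proof.
rewrite -(setUv [set (0 : R)]); apply/measurable_funU => //.
  exact: measurableC.
split; first exact: measurable_fun_set1.
apply: open_continuous_measurable_fun; first exact: closed_openC.
by move=> x /[!inE]/= /eqP x0; exact: inv_continuous.
Qed.

(** By the adjugate formula, inversion is a rational function of the entries. *)
Lemma mx_measurable_inv n (u : T -> 'M[R]_n) : (forall t, u t \in unitmx) ->
  mx_measurable u -> mx_measurable (fun t => invmx (u t)).
Proof.
move=> uu mu; under eq_fun do rewrite /invmx uu.
apply: mx_measurableZ; first exact: measurableT_comp measurable_invr (measurable_det mu).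
move=> i j; under eq_fun do rewrite mxE.
rewrite /cofactor; apply: measurable_funM => //; apply: measurable_det => k l.
by under eq_fun do rewrite !mxE; exact: mu.
Qed.

(** A function that is measurable in the first variable and continuous in the
    second stays measurable after a measurable substitution: round the second
    variable to a finer and finer lattice, where only countably many values
    occur, and pass to the limit. *)
Lemma measurable_caratheodory m n (h : T -> 'M[R]_(m, n) -> R) (u : T -> 'M[R]_(m, n)) :
  (forall M, measurable_fun setT (h^~ M)) -> (forall t, continuous (h t)) ->
  mx_measurable u -> measurable_fun setT (fun t => h t (u t)).
Proof.
move=> mh hc mu.
pose lat (k : nat) (z : 'M[int]_(m, n)) : 'M[R]_(m, n) :=
  k.+1%:R^-1 *: map_mx (fun a : int => a%:~R) z.
pose code (k : nat) (M : 'M[R]_(m, n)) : 'M[int]_(m, n) :=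
  map_mx (fun a : R => Num.floor (k.+1%:R * a)) M.
have k0 (k : nat) : 0 < k.+1%:R :> R by [].
have code_close k M : l2 (M - lat k (code k M)) <= (m * n)%:R * k.+1%:R^-1.
  apply: le_trans (l2_le_sum _) _.
  apply: (@le_trans _ _ (\sum_(i < m) \sum_(j < n) k.+1%:R^-1)); last first.
    by rewrite !sumr_const !card_ord -mulrnA mulr_natl mulnC.
  apply: ler_sum => i _; apply: ler_sum => j _; rewrite !mxE.
  set a := M i j; rewrite -(ler_pM2l (k0 k)) divff ?gt_eqF//.
  rewrite -{1}(gtr0_norm (k0 k)) -normrM mulrBr mulrA divff ?gt_eqF// mul1r.
  have /andP[] := floor_itv (k.+1%:R * a); rewrite intrD => h1 h2.
  by rewrite ger0_norm ?subr_ge0//; lra.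
apply: (@measurable_fun_cvg _ _ _ _ (fun k t => h t (lat k (code k (u t))))).
  move=> k _ B mB; rewrite setTI.
  have -> : (fun t => h t (lat k (code k (u t)))) @^-1` B =
     \bigcup_z ([set t | code k (u t) = z] `&` (h^~ (lat k z)) @^-1` B).
    apply/seteqP; split=> [t Bt|t [z _ [/= <-]]//].
    by exists (code k (u t)).
  apply: countable_bigcupT_measurable; first exact: countableP.
  move=> z; apply: measurableI; last first.
    by have := mh (lat k z) measurableT _ mB; rewrite setTI.
  have -> : [set t | code k (u t) = z] = \bigcap_(ij in [set: 'I_m * 'I_n])
       (fun t => u t ij.1 ij.2) @^-1` `[k.+1%:R^-1 * (z ij.1 ij.2)%:~R,
              k.+1%:R^-1 * (z ij.1 ij.2 + 1)%:~R[.
    have cell (a : R) (b : int) : (Num.floor (k.+1%:R * a) = b) <->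
         `[k.+1%:R^-1 * b%:~R, k.+1%:R^-1 * (b + 1)%:~R[%classic a.
      rewrite /= in_itv/= ler_pdivrMl// ltr_pdivlMl//; split=> [<-|]; first exact: floor_itv.
      by move/floor_def.
    apply/seteqP; split=> [t /= <- [i j] _ /=|t /= tz].
      by apply/cell; rewrite mxE.
    by apply/matrixP => i j; rewrite mxE; apply/cell; exact: (tz (i, j)).
  apply: fin_bigcap_measurable; first exact: finite_finset.
  by move=> [i j] _; have := mu i j measurableT _ (measurable_itv `[k.+1%:R^-1 * (z i j)%:~R,
              k.+1%:R^-1 * (z i j + 1)%:~R[); rewrite setTI.
move=> t _; apply/cvgrPdist_lt => e e0.
have /(@l2_continuousP _ _ _ R^o)/(_ e e0)[del del0 hd] := hc t (u t).
have N0 : 0 < (m * n)%:R + 1 :> R by rewrite ltr_wpDl.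
near=> k; apply: hd; apply: le_lt_trans (code_close k (u t)) _.
apply: (@le_lt_trans _ _ (((m * n)%:R + 1) * k.+1%:R^-1)); first by rewrite ler_wpM2r// lerDl.
rewrite mulrC -ltr_pdivlMr//; near: k.
exact: near_infty_natSinv_lt (PosNum (divr_gt0 del0 N0)).
Unshelve. all: by end_near. Qed.

Lemma mx_measurable_continuous m n p q (h : 'M[R]_(m, n) -> 'M[R]_(p, q)) u :
  continuous h -> mx_measurable u -> mx_measurable (fun t => h (u t)).
Proof.
move=> hc mu i j; apply: (@measurable_caratheodory _ _ (fun _ M => h M i j)) => //.
move=> _ M; apply: (@continuous_comp _ _ _ h (fun N : 'M[R]_(p, q) => N i j)).
  exact: hc.
exact: coord_continuous.
Qed.

Lemma measurable_l2 m n (u : T -> 'M[R]_(m, n)) :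
  mx_measurable u -> measurable_fun setT (fun t => l2 (u t)).
Proof.
by apply: (@measurable_caratheodory _ _ (fun _ M => l2 M)) => // t; exact: continuous_l2.
Qed.

Section differentiable_family.
Context {d dy : nat}.
Variable (h : T -> 'cV[R]_d -> 'cV[R]_dy -> R).
Hypotheses (hm : forall a b, measurable_fun setT (fun t => h t a b))
  (hd : forall t, joint_differentiable (h t)).
Implicit Types (x : T -> 'cV[R]_d) (y : T -> 'cV[R]_dy).

Lemma measurable_joint x y : mx_measurable x -> mx_measurable y ->
  measurable_fun setT (fun t => h t (x t) (y t)).
Proof.
move=> mx my.
apply: (@measurable_caratheodory _ _ (fun t a => h t a (y t))) => //.
  move=> a; apply: (@measurable_caratheodory _ _ (fun t b => h t a b)) => //.
  by move=> t b; exact/differentiable_continuous/joint_differentiable_y.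
by move=> t a; exact/(differentiable_continuous (f := fun a => h t a (y t)))/joint_differentiable_x.
Qed.

Lemma measurable_grad_x x y : mx_measurable x -> mx_measurable y ->
  mx_measurable (fun t => grad_x (h t) (x t) (y t)).
Proof.
move=> mx my i j; under eq_fun do rewrite mxE.
apply: (@measurable_fun_cvg _ _ _ _ (fun k t => (k.+1%:R^-1)^-1 *
   (h t (k.+1%:R^-1 *: delta_mx i 0 + x t) (y t) - h t (x t) (y t)))).
  move=> k; apply: measurable_funM => //; apply: measurable_funB; apply: measurable_joint => //.
  by apply: mx_measurableD => //; exact: mx_measurable_cst.
move=> t _; apply: (derive_cvg_seq (f := fun a => h t a (y t))).
by apply: diff_derivable; exact: joint_differentiable_x.
Qed.

Lemma measurable_grad_y x y : mx_measurable x -> mx_measurable y ->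
  mx_measurable (fun t => grad_y (h t) (x t) (y t)).
Proof.
move=> mx my i j; under eq_fun do rewrite mxE.
apply: (@measurable_fun_cvg _ _ _ _ (fun k t => (k.+1%:R^-1)^-1 *
   (h t (x t) (k.+1%:R^-1 *: delta_mx i 0 + y t) - h t (x t) (y t)))).
  move=> k; apply: measurable_funM => //; apply: measurable_funB; apply: measurable_joint => //.
  by apply: mx_measurableD => //; exact: mx_measurable_cst.
move=> t _; apply: (derive_cvg_seq (f := h t (x t))).
by apply: diff_derivable; exact: joint_differentiable_y.
Qed.

End differentiable_family.

Section twice_differentiable_family.
Context {d dy : nat}.
Variables (h : T -> 'cV[R]_d -> 'cV[R]_dy -> R) (x : T -> 'cV[R]_d) (y : T -> 'cV[R]_dy).
Hypotheses (hm : forall a b, measurable_fun setT (fun t => h t a b))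
  (hd : forall t, joint_differentiable (h t))
  (hd2 : forall t, joint_differentiable (grad_y (h t))).
Hypotheses (mx : mx_measurable x) (my : mx_measurable y).

Let grad_y_coord j a b : measurable_fun setT (fun t => grad_y (h t) a b j 0).
Proof. by apply: (measurable_grad_y hm hd); exact: mx_measurable_cst. Qed.

Lemma measurable_hess_xy : mx_measurable (fun t => hess_xy (h t) (x t) (y t)).
Proof.
move=> i j; under eq_fun do rewrite mxE.
have := @measurable_grad_x _ _ (fun t a b => grad_y (h t) a b j 0)
  (grad_y_coord j) (fun t => joint_differentiable_coord j (hd2 t)) x y mx my i 0.
by under eq_fun do rewrite mxE.
Qed.

Lemma measurable_hess_yy : mx_measurable (fun t => hess_yy (h t) (x t) (y t)).
Proof.
move=> i j; under eq_fun do rewrite mxE.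
have := @measurable_grad_y _ _ (fun t a b => grad_y (h t) a b j 0)
  (grad_y_coord j) (fun t => joint_differentiable_coord j (hd2 t)) x y mx my i 0.
by under eq_fun do rewrite mxE.
Qed.

End twice_differentiable_family.

End fixed_space.

Lemma mx_measurable_comp (d1 d2 : measure_display) (T1 : measurableType d1)
    (T2 : measurableType d2) (m n : nat) (phi : T1 -> T2) (u : T2 -> 'M[R]_(m, n)) :
  measurable_fun setT phi -> mx_measurable u -> mx_measurable (u \o phi).
Proof. by move=> mphi mu i j; exact: measurableT_comp (mu i j) mphi. Qed.

End measurability.

(** * Expectations of nonnegative functions and unbiased estimators *)

Section expectations.
Context {R : realType} {dS : measure_display} {S : measurableType dS}.

(** Monotonicity holds without measurability, because the integral of a
    nonnegative function is a supremum over the simple functions below it. *)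
Lemma ge0_le_integral_lower (P : probability S R) (f g : S -> \bar R) :
  (forall s, 0 <= f s)%E -> (forall s, f s <= g s)%E ->
  (\int[P]_s f s <= \int[P]_s g s)%E.
Proof.
move=> f0 fg; have g0 s : (0 <= g s)%E by exact: le_trans (f0 s) (fg s).
rewrite !ge0_integralE//; apply: ereal_sup_le => _ [h hf <-]; exists h => // s.
by apply: le_trans (hf s) _; rewrite !patch_setT.
Qed.

Variable P : probability S R.

Lemma le_expectation (f g : S -> R) : (forall s, 0 <= f s) -> (forall s, f s <= g s) ->
  ('E_P[f] <= 'E_P[g])%E.
Proof.
by move=> f0 fg; rewrite unlock; apply: ge0_le_integral_lower => s; rewrite lee_fin.
Qed.

(** Only the dominating functions are integrated term by term, so [h] may be
    arbitrary. *)
Lemma le_expectation_affine (h f1 f2 f3 : S -> R) (c a1 a2 a3 v1 v2 v3 : R) :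
  measurable_fun setT f1 -> measurable_fun setT f2 -> measurable_fun setT f3 ->
  (forall s, 0 <= f1 s) -> (forall s, 0 <= f2 s) -> (forall s, 0 <= f3 s) ->
  0 <= c -> 0 <= a1 -> 0 <= a2 -> 0 <= a3 ->
  ('E_P[f1] <= v1%:E)%E -> ('E_P[f2] <= v2%:E)%E -> ('E_P[f3] <= v3%:E)%E ->
  (forall s, 0 <= h s) -> (forall s, h s <= c + a1 * f1 s + a2 * f2 s + a3 * f3 s) ->
  ('E_P[h] <= (c + a1 * v1 + a2 * v2 + a3 * v3)%:E)%E.
Proof.
move=> m1 m2 m3 f10 f20 f30 c0 a10 a20 a30 e1 e2 e3 h0 hle.
apply: le_trans (le_expectation h0 hle) _; rewrite unlock in e1 e2 e3 *.
have ma (a : R) (f : S -> R) : measurable_fun setT f -> measurable_fun setT (fun s => (a * f s)%:E).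
  by move=> mf; apply/measurable_EFinP; exact: measurable_funM.
have int_scale (a v : R) (f : S -> R) : measurable_fun setT f -> (forall s, 0 <= f s) -> 0 <= a ->
    (\int[P]_s (f s)%:E <= v%:E)%E -> (\int[P]_s (a * f s)%:E <= (a * v)%:E)%E.
  move=> mf f0 a0 ev; under eq_integral do rewrite EFinM.
  rewrite ge0_integralZl ?lee_fin//; [|exact/measurable_EFinP|by move=> s _; rewrite lee_fin].
  by rewrite EFinM lee_wpmul2l.
under eq_integral do rewrite !EFinD.
have p0 (a : R) (f : S -> R) : (forall s, 0 <= f s) -> 0 <= a -> forall s, (0 <= (a * f s)%:E)%E.
  by move=> f0 a0 s; rewrite lee_fin mulr_ge0.
have ec : (\int[P]_s c%:E = c%:E)%E by have := expectation_cst P c; rewrite unlock.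
have mc : measurable_fun [set: S] (fun=> c%:E : \bar R) by exact: measurable_cst.
rewrite !ge0_integralD//=.
- rewrite ec !EFinD.
  by do 2?apply: leeD; rewrite ?leeD2l//; try exact: int_scale.
- by move=> s _; exact: p0.
- exact: ma.
- by move=> s _; rewrite adde_ge0// ?lee_fin ?mulr_ge0.
- by apply: emeasurable_funD => //; exact: ma.
- by move=> s _; exact: p0.
- exact: ma.
- by move=> s _; rewrite !adde_ge0// ?lee_fin ?mulr_ge0.
- by do 2?apply: emeasurable_funD => //; exact: ma.
- by move=> s _; exact: p0.
- exact: ma.
Qed.

(** Integrates [q * D + V <= W] when [V] and [W] are measurable and [D] is
    arbitrary: [q * D] lies below the measurable function [W - V]. *)
Lemma expectation_decrease (D V W : S -> R) (q : R) :
  measurable_fun setT V -> measurable_fun setT W -> 0 < q ->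
  (forall s, 0 <= V s) -> (forall s, 0 <= D s) -> (forall s, q * D s + V s <= W s) ->
  ('E_P[V] + q%:E * 'E_P[D] <= 'E_P[W])%E.
Proof.
move=> mV mW q0 V0 D0 DVW.
have WV s : 0 <= W s - V s by rewrite subr_ge0; apply: le_trans (DVW s); rewrite lerDr mulr_ge0// ltW.
have mWV : measurable_fun setT (fun s => W s - V s) by exact: measurable_funB.
have DWV s : D s <= q^-1 * (W s - V s).
  by rewrite -ler_pdivrMl ?invr_gt0// invrK lerBrDr.
have iW : ('E_P[W] = 'E_P[V] + 'E_P[fun s => (W s - V s)%R])%E.
  rewrite unlock -ge0_integralD//; try by [move=> s _; rewrite lee_fin | apply/measurable_EFinP].
  by apply: eq_integral => s _; rewrite -EFinD addrC subrK.
rewrite iW leeD2l//.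
have -> : ('E_P[fun s => (W s - V s)%R] = q%:E * 'E_P[fun s => (q^-1 * (W s - V s))%R])%E.
  rewrite unlock -ge0_integralZl//; [|by apply/measurable_EFinP; exact: measurable_funM| |exact: ltW].
    by apply: eq_integral => s _; rewrite -EFinM mulrA divff ?gt_eqF// mul1r.
  by move=> s _; rewrite lee_fin mulr_ge0// invr_ge0 ltW.
by rewrite lee_wpmul2l ?lee_fin ?(ltW q0)//; exact: le_expectation.
Qed.

Lemma le_expectation_affine1 (h f : S -> R) (c a v : R) :
  measurable_fun setT f -> (forall s, 0 <= f s) -> 0 <= c -> 0 <= a ->
  ('E_P[f] <= v%:E)%E -> (forall s, 0 <= h s) -> (forall s, h s <= c + a * f s) ->
  ('E_P[h] <= (c + a * v)%:E)%E.
Proof.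
move=> mf f0 c0 a0 ev h0 hle.
have -> : c + a * v = c + a * v + 0 * v + 0 * v by rewrite !mul0r !addr0.
apply: (le_expectation_affine mf mf mf f0 f0 f0 c0 a0 (lexx 0) (lexx 0) ev ev ev h0) => s.
by rewrite !mul0r !addr0.
Qed.

Section unbiased.
Context {m n : nat}.
Implicit Types (Z : S -> 'M[R]_(m, n)) (M V : 'M[R]_(m, n)).

Lemma unbiased_mx_measurable Z M : unbiased_estimator P Z M -> mx_measurable Z.
Proof.
move=> uZ i j; have [/integrableP[mZ _] _] := uZ i j.
exact/measurable_EFinP.
Qed.

Lemma unbiased_cst M : unbiased_estimator P (fun=> M) M.
Proof.
move=> i j; split; last by rewrite expectation_cst.
exact: finite_measure_integrable_cst.
Qed.

Lemma unbiasedB Z M Z' M' : unbiased_estimator P Z M -> unbiased_estimator P Z' M' ->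
  unbiased_estimator P (fun s => Z s - Z' s) (M - M').
Proof.
move=> uZ uZ' i j; have [iZ eZ] := uZ i j; have [iZ' eZ'] := uZ' i j.
have e s : (Z s - Z' s) i j = Z s i j - Z' s i j by rewrite !mxE.
rewrite !mxE unlock in eZ eZ' *; split.
  under eq_fun do rewrite e EFinB.
  exact: integrableB.
under eq_integral do rewrite e EFinB.
by rewrite integralB// eZ eZ' EFinB.
Qed.

Lemma unbiased_mulmxl (k : nat) (A : 'M[R]_(k, m)) Z M : unbiased_estimator P Z M ->
  unbiased_estimator P (fun s => A *m Z s) (A *m M).
Proof.
move=> uZ i j.
have iZ l : P.-integrable setT (fun s => (A i l * Z s l j)%:E).
  by have [iZ _] := uZ l j; under eq_fun do rewrite EFinM; exact: integrableZl.
have e s : ((A *m Z s) i j)%:E = (\sum_l (A i l * Z s l j)%:E)%E by rewrite mxE sumEFin.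
rewrite mxE; split.
  have -> : (fun s => ((A *m Z s) i j)%:E) = (fun s => \sum_l (A i l * Z s l j)%:E)%E.
    exact/funext.
  by apply: integrable_sum => // l _; exact: iZ.
rewrite unlock; under eq_integral do rewrite e.
rewrite integral_sum// -sumEFin; apply: eq_bigr => l _.
have [iZl eZl] := uZ l j; under eq_integral do rewrite EFinM.
by rewrite unlock in eZl; rewrite integralZl// eZl.
Qed.

Lemma unbiased_dotm V Z M : unbiased_estimator P Z M ->
  P.-integrable setT (fun s => (dotm V (Z s))%:E)
  /\ (\int[P]_s (dotm V (Z s))%:E = (dotm V M)%:E)%E.
Proof.
move=> uZ.
have e s : (dotm V (Z s))%:E = (\sum_(ij : 'I_m * 'I_n) (V ij.1 ij.2 * Z s ij.1 ij.2)%:E)%E.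
  by rewrite dotmE pair_bigA sumEFin.
have iZ (ij : 'I_m * 'I_n) : P.-integrable setT (fun s => (V ij.1 ij.2 * Z s ij.1 ij.2)%:E).
  by have [iZ _] := uZ ij.1 ij.2; under eq_fun do rewrite EFinM; exact: integrableZl.
split.
  have -> : (fun s => (dotm V (Z s))%:E)
      = (fun s => \sum_(ij : 'I_m * 'I_n) (V ij.1 ij.2 * Z s ij.1 ij.2)%:E)%E.
    exact/funext.
  by apply: integrable_sum => // ij _; exact: iZ.
under eq_integral do rewrite e.
rewrite integral_sum// dotmE pair_bigA -sumEFin; apply: eq_bigr => ij _.
have [iZl eZl] := uZ ij.1 ij.2; under eq_integral do rewrite EFinM.
by rewrite unlock in eZl; rewrite integralZl// eZl.
Qed.

Lemma integrable_l2_sqr Z v : mx_measurable Z ->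
  ('E_P[fun s => (l2 (Z s) ^+ 2)%R] <= v%:E)%E ->
  P.-integrable setT (fun s => (l2 (Z s) ^+ 2)%:E).
Proof.
move=> mZ ev; apply/integrableP; split.
  by apply/measurable_EFinP/measurable_funX; exact: measurable_l2.
rewrite unlock in ev; apply: le_lt_trans (ltry v); apply: le_trans ev.
by under eq_integral do rewrite gee0_abs ?lee_fin ?sqr_ge0//.
Qed.

(** The expectation sees a linear term only through the mean of the estimator;
    this is where unbiasedness is used. *)
Lemma unbiased_quadratic_bound (H : S -> R) Z M V (c a v : R) :
  unbiased_estimator P Z M -> ('E_P[fun s => (l2 (Z s) ^+ 2)%R] <= v%:E)%E -> 0 <= a ->
  (forall s, 0 <= H s) ->
  (forall s, H s <= c + dotm V (Z s) + a * l2 (Z s) ^+ 2) ->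
  ('E_P[H] <= (c + dotm V M + a * v)%:E)%E.
Proof.
move=> uZ ev a0 H0 Hle; apply: le_trans (le_expectation H0 Hle) _.
have [iV eV] := unbiased_dotm V uZ.
have iZ := integrable_l2_sqr (unbiased_mx_measurable uZ) ev.
rewrite unlock in ev *; under eq_integral do rewrite !EFinD EFinM.
have ic : P.-integrable setT (fun=> c%:E) by exact: finite_measure_integrable_cst.
have ec : (\int[P]_s c%:E = c%:E)%E by have := expectation_cst P c; rewrite unlock.
have iaZ : P.-integrable setT (fun s => (a%:E * (l2 (Z s) ^+ 2)%:E)%E) by exact: integrableZl.
rewrite integralD//; last exact: integrableD.
rewrite integralD// integralZl// eV ec !EFinD EFinM.
by rewrite leeD2l// lee_wpmul2l.
Qed.

Lemma expectation_centered_sqr Z U v : unbiased_estimator P Z 0 ->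
  ('E_P[fun s => (l2 (Z s) ^+ 2)%R] <= v%:E)%E ->
  ('E_P[fun s => (l2 (U + Z s) ^+ 2)%R] <= (l2 U ^+ 2 + v)%:E)%E.
Proof.
move=> uZ ev; have -> : l2 U ^+ 2 + v = l2 U ^+ 2 + dotm (2 *: U) 0 + 1 * v.
  by rewrite dotm0 addr0 mul1r.
apply: (unbiased_quadratic_bound uZ ev) => // s; first exact: sqr_ge0.
by rewrite l2_sqrD dotmZl mul1r.
Qed.

(** Jensen's inequality, read off the nonnegativity of the mean of
    [|Z - M|^2]. *)
Lemma l2_mean_le Z M C : 0 <= C -> unbiased_estimator P Z M ->
  ('E_P[fun s => (l2 (Z s) ^+ 2)%R] <= (C ^+ 2)%:E)%E -> l2 M <= C.
Proof.
move=> C0 uZ ev; rewrite l2_le//.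
have h : ('E_P[fun s => (l2 (Z s - M) ^+ 2)%R]
    <= (dotm M M + dotm (- 2 *: M) M + 1 * C ^+ 2)%:E)%E.
  apply: (unbiased_quadratic_bound uZ ev) => // s; first exact: sqr_ge0.
  by rewrite l2_sqrBE -!l2_sqr dotmZl (dotmC M); lra.
have := le_trans (expectation_ge0 P (fun s => sqr_ge0 (l2 (Z s - M)))) h.
by rewrite lee_fin dotmZl mul1r; lra.
Qed.

Lemma l2_mean_le_bound Z M C : 0 <= C -> unbiased_estimator P Z M ->
  (forall s, l2 (Z s) <= C) -> l2 M <= C.
Proof.
move=> C0 uZ hC; apply: (l2_mean_le C0 uZ).
apply: (@le_trans _ _ 'E_P[fun=> (C ^+ 2)%R])%E; last by rewrite expectation_cst.
apply: le_expectation => s; first exact: sqr_ge0.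
by rewrite ler_pXn2r// nnegrE l2_ge0.
Qed.

End unbiased.
End expectations.

(** * Independence and conditioning on the past *)

Section independence.
Context {R : realType} {dO : measure_display} {Omega : measurableType dO}
  (P : probability Omega R) {I : choiceType} (E : I -> set (set Omega)).
Hypotheses (E_measurable : forall i, E i `<=` measurable)
  (E_setI : forall i, setI_closed (E i)) (E_setT : forall i, E i setT)
  (E_indep : mutually_independent P E).

Definition generators (D : set I) : set (set Omega) := \bigcup_(i in D) E i.

(** The pi-system on which the product rule holds by assumption. *)
Definition cylinders (D : set I) : set (set Omega) :=
  [set C | exists (J : {fset I}) (A : I -> set Omega),
     (forall i, i \in J -> D i /\ E i (A i)) /\ C = \bigcap_(i in [set` J]) A i].

Lemma cylinders_setI_closed D : setI_closed (cylinders D).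
Proof.
move=> _ _ [J [A [JA ->]]] [J' [A' [JA' ->]]].
exists (J `|` J')%fset.
exists (fun i => (if i \in J then A i else setT) `&` (if i \in J' then A' i else setT)).
split=> [i|].
  rewrite in_fsetU => /orP[] iJ; rewrite iJ; split.
  - by have [] := JA _ iJ.
  - apply: E_setI; first by have [] := JA _ iJ.
    by case: ifPn => // /JA'[].
  - by have [] := JA' _ iJ.
  - apply: E_setI; last by have [] := JA' _ iJ.
    by case: ifPn => // /JA[].
apply/seteqP; split=> [w [wA wA'] i /= _|w wAA'].
  by split; case: ifPn => // ?; [exact: wA | exact: wA'].
split=> i /= iJ.
  by have := wAA' i; rewrite /= in_fsetU iJ => /(_ isT)[].
by have := wAA' i; rewrite /= in_fsetU iJ orbT => /(_ isT)[].
Qed.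

(** The sets generated by the past are independent of any further event: the
    product rule holds on finite intersections by assumption, and these form a
    pi-system generating the past. *)
Lemma past_indep D i A B : ~ D i -> <<s generators D >> A -> E i B ->
  P (A `&` B) = (P A * P B)%E.
Proof.
move=> Di DA EB; have mB : measurable B by exact: E_measurable EB.
have PB0 : 0 <= fine (P B) by rewrite fine_ge0.
have PBE : (P B = (NngNum PB0)%:num%:E)%E by rewrite /= fineK// fin_num_measure.
have cyl_meas : cylinders D `<=` measurable.
  move=> _ [J [A' [JA ->]]]; apply: fin_bigcap_measurable; first exact: finite_fset.
  by move=> j /= /JA[_ /E_measurable].
have cylA : <<s cylinders D >> A.
  move: A DA; apply: smallest_sub; first exact: smallest_sigma_algebra.
  move=> C [j Dj EC]; apply: sub_sigma_algebra.
  exists [fset j]%fset, (fun=> C); split=> [k|]; first by rewrite in_fset1 => /eqP ->.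
  by rewrite set_fset1 bigcap_set1.
(* As functions of [A], both sides are finite measures. *)
rewrite PBE muleC -[LHS]/(mrestr P mB A) -[RHS]/(mscale (NngNum PB0) P A).
apply: (@g_sigma_algebra_measure_unique _ _ _ (cylinders D) cyl_meas (fun=> setT)) => //.
- move=> _; exists fset0, (fun=> setT); split=> //.
  by rewrite set_fset0 bigcap_set0.
- by rewrite bigcup_const.
- exact: cylinders_setI_closed.
- move=> _ [J [A' [JA ->]]]; rewrite /= /mscale/= /mrestr.
  pose A2 j := if j == i then B else A' j.
  have iJ : i \notin J by apply/negP => /JA[].
  have A2J j : j \in J -> A2 j = A' j.
    by move=> jJ; rewrite /A2; case: eqP => // ji; rewrite -ji jJ in iJ.
  have EA2 j : j \in (i |` J)%fset -> E j (A2 j).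
    rewrite in_fset1U => /orP[/eqP ->|jJ]; first by rewrite /A2 eqxx.
    by rewrite A2J//; have [] := JA _ jJ.
  have EJ j : j \in J -> E j (A' j) by move=> /JA[].
  have -> : (\bigcap_(j in [set` J]) A' j) `&` B = \bigcap_(j in [set` (i |` J)%fset]) A2 j.
    apply/seteqP; split=> [w [wA wB] j /=|w wA].
      rewrite in_fset1U => /orP[/eqP ->|jJ]; first by rewrite /A2 eqxx.
      by rewrite A2J//; exact: wA.
    split=> [j /= jJ|]; last by have := wA i; rewrite /= in_fset1U eqxx /A2 eqxx; apply.
    by have := wA j; rewrite /= in_fset1U jJ orbT A2J//; apply.
  rewrite (E_indep EA2) (E_indep EJ) big_fsetU1//= /A2 eqxx fineK ?fin_num_measure//.
  congr (_ * _)%E; apply: eq_fbigr => j jJ _; by rewrite -/(A2 j) A2J.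
- by move=> _; rewrite /= /mrestr/= setTI -ge0_fin_numE// fin_num_measure.
Qed.

End independence.

Section conditioning.
Context {R : realType} {dO : measure_display} {Omega : measurableType dO}
  (P : probability Omega R) {dS : measure_display} {S : measurableType dS}
  (PS : probability S R) (Z : {RV P >-> S}) (G : set (set Omega)).
Hypotheses (G_measurable : G `<=` measurable)
  (Z_law : forall A, measurable A -> distribution P Z A = PS A)
  (GZ_indep : forall A B, <<s G >> A -> measurable B ->
     P (A `&` Z @^-1` B) = (P A * P (Z @^-1` B))%E).

Let measurable_id : measurable_fun setT (idfun : Omega -> g_sigma_algebraType G).
Proof.
move=> _ B mB; rewrite setTI preimage_id.
by move: B mB; apply: smallest_sub => //; exact: sigma_algebra_measurable.
Qed.

(** Tonelli's theorem with the fresh sample integrated first, the past being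
    frozen. *)
Lemma integral_fresh (h : g_sigma_algebraType G * S -> \bar R) :
  measurable_fun setT h -> (forall z, 0 <= h z)%E ->
  (\int[P]_w h (w, Z w) = \int[P]_w \int[PS]_s h (w, s))%E.
Proof.
move=> mh h0.
pose idG : {mfun Omega >-> g_sigma_algebraType G} :=
  HB.pack (idfun : Omega -> g_sigma_algebraType G)
    (isMeasurableFun.Build _ _ _ _ (idfun : Omega -> g_sigma_algebraType G) measurable_id).
have mpair : measurable_fun setT (fun w : Omega => (w : g_sigma_algebraType G, Z w)).
  by apply: measurable_fun_pair.
pose pairG : {mfun Omega >-> (g_sigma_algebraType G * S)%type} :=
  HB.pack (fun w : Omega => (w : g_sigma_algebraType G, Z w))
    (isMeasurableFun.Build _ _ _ _ (fun w : Omega => (w : g_sigma_algebraType G, Z w)) mpair).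
have -> : (\int[P]_w h (w, Z w) = \int[distribution P pairG]_z h z)%E.
  by rewrite ge0_integral_distribution.
(* The joint law of the past and the fresh sample is a product measure. *)
rewrite (@eq_measure_integral _ _ _ setT (distribution P idG \x PS)%E); last first.
  move=> A mA _; apply/esym; apply: product_measure_unique => // A1 B1 mA1 mB1.
  apply: etrans (GZ_indep mA1 mB1) _; congr (_ * _)%E; exact: Z_law.
rewrite fubini_tonelli1// -[RHS]/(\int[P]_w (fubini_F PS h (idG w)))%E.
apply: (ge0_integral_distribution idG).
  exact: measurable_fun_fubini_tonelli_F.
by move=> w; apply: integral_ge0.
Qed.

(** A bound that holds for each frozen past, averaged over a fresh sample,
    averages over the past. *)
Lemma expectation_fresh (h : g_sigma_algebraType G -> S -> R) (U : Omega -> R) :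
  measurable_fun setT (fun z : g_sigma_algebraType G * S => h z.1 z.2) ->
  (forall w s, 0 <= h w s) -> (forall w, 'E_PS[h w] <= (U w)%:E)%E ->
  ('E_P[fun w => h w (Z w)] <= 'E_P[U])%E.
Proof.
move=> mh h0 hU; rewrite unlock.
rewrite (@integral_fresh (fun z => (h z.1 z.2)%:E)).
- apply: ge0_le_integral_lower => w; last by have := hU w; rewrite unlock.
  by apply: integral_ge0 => s _; rewrite lee_fin.
- exact/measurable_EFinP.
- by move=> z; rewrite lee_fin.
Qed.

End conditioning.

(** * Perturbation of the second-order blocks *)

Section perturbation.
Context {R : realType}.

Lemma invmx_sub (n : nat) (B B' : 'M[R]_n) : B \in unitmx -> B' \in unitmx ->
  invmx B - invmx B' = invmx B *m (B' - B) *m invmx B'.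
Proof.
by move=> uB uB'; rewrite mulmxBr mulmxBl mulVmx// mul1mx -mulmxA mulmxV// mulmx1.
Qed.

Section blocks.
Context {m n : nat}.
Variables (A A' : 'M[R]_(m, n)) (B B' : 'M[R]_n) (C M : R).
Hypotheses (uB : B \in unitmx) (uB' : B' \in unitmx)
  (hA' : l2 A' <= C) (hB : l2 (invmx B) <= M) (hB' : l2 (invmx B') <= M).

Let C0 : 0 <= C. Proof. exact: le_trans (l2_ge0 _) hA'. Qed.
Let M0 : 0 <= M. Proof. exact: le_trans (l2_ge0 _) hB. Qed.

Lemma l2_invmx_sub : l2 (invmx B - invmx B') <= M * M * l2 (B - B').
Proof.
rewrite invmx_sub//; apply: le_trans (l2_mulmx _ _) _.
rewrite mulrAC; apply: ler_pM; rewrite ?l2_ge0//.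
by apply: le_trans (l2_mulmx _ _) _; rewrite l2B ler_wpM2r ?l2_ge0.
Qed.

(** Change one factor at a time, the inverses by [invmx_sub]. *)
Lemma l2_mul_inv_sub :
  l2 (A *m invmx B - A' *m invmx B') <= (M + C * (M * M)) * (l2 (A - A') + l2 (B - B')).
Proof.
have -> : A *m invmx B - A' *m invmx B' = (A - A') *m invmx B + A' *m (invmx B - invmx B').
  by rewrite mulmxBl mulmxBr addrA subrK.
apply: le_trans (l2_triangle _ _) _.
have h1 : l2 ((A - A') *m invmx B) <= l2 (A - A') * M.
  by apply: le_trans (l2_mulmx _ _) _; rewrite ler_wpM2l ?l2_ge0.
have h2 : l2 (A' *m (invmx B - invmx B')) <= C * (M * M * l2 (B - B')).
  apply: le_trans (l2_mulmx _ _) _; apply: ler_pM; rewrite ?l2_ge0//.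
  exact: l2_invmx_sub.
have a0 := l2_ge0 (A - A'); have b0 := l2_ge0 (B - B').
apply: le_trans (lerD h1 h2) _; rewrite mulrDl !mulrDr.
have := mulr_ge0 M0 b0; have := mulr_ge0 (mulr_ge0 C0 (mulr_ge0 M0 M0)) a0; lra.
Qed.

Lemma l2_inv_mul_tr_sub :
  l2 (invmx B *m A^T - invmx B' *m A'^T) <= (M + C * (M * M)) * (l2 (A - A') + l2 (B - B')).
Proof.
have -> : invmx B *m A^T - invmx B' *m A'^T
    = invmx B *m (A - A')^T + (invmx B - invmx B') *m A'^T.
  have -> : (A - A')^T = A^T - A'^T by rewrite [LHS]linearB.
  by rewrite mulmxBl mulmxBr addrA subrK.
apply: le_trans (l2_triangle _ _) _.
have h1 : l2 (invmx B *m (A - A')^T) <= M * l2 (A - A').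
  by apply: le_trans (l2_mulmx _ _) _; rewrite l2_tr ler_wpM2r ?l2_ge0.
have h2 : l2 ((invmx B - invmx B') *m A'^T) <= M * M * l2 (B - B') * C.
  apply: le_trans (l2_mulmx _ _) _; rewrite l2_tr; apply: ler_pM; rewrite ?l2_ge0//.
  exact: l2_invmx_sub.
have a0 := l2_ge0 (A - A'); have b0 := l2_ge0 (B - B').
apply: le_trans (lerD h1 h2) _; rewrite mulrDl !mulrDr.
have := mulr_ge0 M0 b0; have := mulr_ge0 (mulr_ge0 C0 (mulr_ge0 M0 M0)) a0; lra.
Qed.

End blocks.
End perturbation.

Section recursive_momentum.
Context {R : realType} {dS : measure_display} {S : measurableType dS}
  (P : probability S R) {m n : nat}.

(** Variance reduction: the old error is shrunk by [1 - t], because the sampled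
    increment from the old to the new point is subtracted with the same sample
    and hence has small variance, while a fraction [t] of a fresh estimate
    enters.  The projection onto a convex set containing the target can only
    decrease the error. *)
Lemma momentum_error (C : set 'M[R]_(m, n)) (H G0 G1 : 'M[R]_(m, n))
    (h0 h1 : S -> 'M[R]_(m, n)) (t v D : R) :
  closed C -> segment_closed C -> C G1 -> 0 <= t -> t <= 1 -> 0 <= D ->
  unbiased_estimator P h0 G0 -> unbiased_estimator P h1 G1 ->
  variance_le P h1 G1 v -> (forall s, l2 (h1 s - h0 s) <= D) ->
  ('E_P[fun s => (l2 (proj C ((1 - t) *: (H - h0 s) + h1 s) - G1) ^+ 2)%R]
    <= ((1 - t) ^+ 2 * l2 (H - G0) ^+ 2 + 2 * t ^+ 2 * v + 8 * D ^+ 2)%:E)%E.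
Proof.
move=> Ccl Ccv CG1 t0 t1 D0 u0 u1 var1 hD.
have uD := unbiasedB u1 u0.
have GD : l2 (G1 - G0) <= D := l2_mean_le_bound D0 uD hD.
(* The centered noise: the fluctuation of the sampled increment, and a fraction
   [t] of the fluctuation of the fresh sample. *)
pose Z s := (1 - t)%:M *m ((h1 s - h0 s) - (G1 - G0)) - (- t)%:M *m (h1 s - G1).
have uZ : unbiased_estimator P Z 0.
  have := unbiasedB (unbiased_mulmxl (1 - t)%:M (unbiasedB uD (unbiased_cst P (G1 - G0))))
    (unbiased_mulmxl (- t)%:M (unbiasedB u1 (unbiased_cst P G1))).
  by rewrite !subrr !mulmx0 subrr.
have m1 : mx_measurable (fun s => h1 s - G1).
  by apply: mx_measurableB; [exact: unbiased_mx_measurable u1 | exact: mx_measurable_cst].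
have ZE s : (1 - t) *: (H - h0 s) + h1 s - G1 = (1 - t) *: (H - G0) + Z s.
  by rewrite /Z !mul_scalar_mx; mx_ring.
have vZ : ('E_P[fun s => (l2 (Z s) ^+ 2)%R] <= (8 * D ^+ 2 + 2 * t ^+ 2 * v)%:E)%E.
  apply: (le_expectation_affine1 (f := fun s => l2 (h1 s - G1) ^+ 2)) => // [|s|||s|s].
  - by apply: measurable_funX; exact: measurable_l2.
  - exact: sqr_ge0.
  - by rewrite mulr_ge0// sqr_ge0.
  - by rewrite mulr_ge0// sqr_ge0.
  - exact: sqr_ge0.
  rewrite /Z !mul_scalar_mx.
  apply: le_trans (l2_sqrB_le _ _) _.
  rewrite !l2Z normrN !exprMn !real_normK ?num_real//.
  have : l2 (h1 s - h0 s - (G1 - G0)) <= 2 * D.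
    apply: le_trans (l2_sub_le _ _) _; rewrite mulrDl !mul1r.
    by apply: lerD => //; exact: hD.
  rewrite -(ler_pXn2r (n := 2)) ?nnegrE ?l2_ge0 ?mulr_ge0// exprMn => h.
  have t2 : (1 - t) ^+ 2 <= 1 by rewrite expr_le1 ?subr_ge0// gerBl.
  have := ler_wpM2r (sqr_ge0 (l2 (h1 s - h0 s - (G1 - G0)))) t2.
  lra.
apply: le_trans (le_expectation _ (g := fun s => l2 ((1 - t) *: (H - G0) + Z s) ^+ 2) _ _) _.
- by move=> s; exact: sqr_ge0.
- move=> s; rewrite ler_pXn2r ?nnegrE ?l2_ge0// -ZE.
  exact: (proj_le Ccl Ccv CG1 _ CG1).
apply: le_trans (expectation_centered_sqr _ uZ vZ) _.
rewrite lee_fin l2Z exprMn real_normK ?num_real//; lra.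
Qed.

End recursive_momentum.

(** * Regularity of the averaged derivatives *)

Section averaged_derivatives.
Context {R : realType} {d dy : nat}
  {dXi : measure_display} {Xi : measurableType dXi} (Pxi : probability Xi R)
  {dPhi : measure_display} {Phi : measurableType dPhi} (Pphi : probability Phi R)
  (fs : Xi -> 'cV[R]_d -> 'cV[R]_dy -> R) (gs : Phi -> 'cV[R]_d -> 'cV[R]_dy -> R)
  (X : set 'cV[R]_d) (p : constants R).

Let f := mean_fun Pxi fs.
Let g := mean_fun Pphi gs.

Hypotheses (pos : valid_constants p)
  (lip : lipschitz_assumption Pxi Pphi fs gs X p)
  (stoch : stochastic_assumption Pxi Pphi fs gs X p).

Definition Lip_xy (p : constants R) := p.(L_gxy) + p.(Lbar_gxy).
Definition Lip_yy (p : constants R) := p.(L_gyy) + p.(Lbar_gyy).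

Let Lxy0 : 0 <= Lip_xy p.
Proof. by have [_ _ _ ? _] := L_ge0 pos; have [_ _ ? _] := Lbar_ge0 pos; exact: addr_ge0. Qed.
Let Lyy0 : 0 <= Lip_yy p.
Proof. by have [_ _ _ _ ?] := L_ge0 pos; have [_ _ _ ?] := Lbar_ge0 pos; exact: addr_ge0. Qed.

Lemma hess_xy_sample_lipschitz s x y x' y' : X x -> X x' ->
  l2 (hess_xy (gs s) x y - hess_xy (gs s) x' y') <= Lip_xy p * (l2 (x - x') + l2 (y - y')).
Proof.
move=> Xx Xx'; apply: le_trans (l2_triangleB _ (hess_xy (gs s) x' y) _) _.
have h1 := lip_gxy_x lip s y Xx Xx'; have h2 := lip_gxy_y lip s Xx' (I : setT y) (I : setT y').
apply: le_trans (lerD h1 h2) _; clear h1 h2.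
have [_ _ _ a0 _] := L_ge0 pos; have [_ _ b0 _] := Lbar_ge0 pos.
rewrite /Lip_xy mulrDr; apply: lerD; apply: ler_wpM2r; rewrite ?l2_ge0//.
  by rewrite lerDr.
by rewrite lerDl.
Qed.

Lemma hess_yy_sample_lipschitz s x y x' y' : X x -> X x' ->
  l2 (hess_yy (gs s) x y - hess_yy (gs s) x' y') <= Lip_yy p * (l2 (x - x') + l2 (y - y')).
Proof.
move=> Xx Xx'; apply: le_trans (l2_triangleB _ (hess_yy (gs s) x' y) _) _.
have h1 := lip_gyy_x lip s y Xx Xx'; have h2 := lip_gyy_y lip s Xx' (I : setT y) (I : setT y').
apply: le_trans (lerD h1 h2) _; clear h1 h2.
have [_ _ _ _ a0] := L_ge0 pos; have [_ _ _ b0] := Lbar_ge0 pos.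
rewrite /Lip_yy mulrDr; apply: lerD; apply: ler_wpM2r; rewrite ?l2_ge0//.
  by rewrite lerDr.
by rewrite lerDl.
Qed.

(** The difference of the samples at the two points is an unbiased estimator of
    the difference of the means, so a bound valid for every sample passes to the
    mean. *)
Lemma hess_xy_lipschitz x y x' y' : X x -> X x' ->
  l2 (hess_xy g x y - hess_xy g x' y') <= Lip_xy p * (l2 (x - x') + l2 (y - y')).
Proof.
move=> Xx Xx'; have u := unbiasedB (unbiased_gxy stoch y Xx) (unbiased_gxy stoch y' Xx').
apply: (l2_mean_le_bound _ u); first by rewrite mulr_ge0// addr_ge0 ?l2_ge0.
by move=> s; exact: hess_xy_sample_lipschitz.
Qed.

Lemma hess_yy_lipschitz x y x' y' : X x -> X x' ->
  l2 (hess_yy g x y - hess_yy g x' y') <= Lip_yy p * (l2 (x - x') + l2 (y - y')).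
Proof.
move=> Xx Xx'; have u := unbiasedB (unbiased_gyy stoch y Xx) (unbiased_gyy stoch y' Xx').
apply: (l2_mean_le_bound _ u); first by rewrite mulr_ge0// addr_ge0 ?l2_ge0.
by move=> s; exact: hess_yy_sample_lipschitz.
Qed.

Lemma hess_xy_bound x y : X x -> l2 (hess_xy g x y) <= p.(C_gxy).
Proof.
move=> Xx; apply: (l2_mean_le _ (unbiased_gxy stoch y Xx) (moment_gxy stoch y Xx)).
by have [] := C_ge0 pos.
Qed.

Lemma grad_y_bound x y : X x -> l2 (grad_y f x y) <= p.(C_fy).
Proof.
move=> Xx; apply: (l2_mean_le _ (unbiased_fy stoch y Xx)); first by have [] := C_ge0 pos.
by apply: (moment_fy stoch y Xx); left.
Qed.

End averaged_derivatives.

(** * Elementary recursions for the rates *)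

Section recursion.
Context {R : realType}.
Implicit Types mu al be eta a b v x y w k c g l m p q r s : R.

(** The perturbation enters with the large factor [2 / (be * mu)] of Young's
    inequality; since [al <= be] one factor [al] absorbs it, and the remaining
    [al * x * a] is paid for by a quarter of the contraction. *)
Lemma inner_recursion mu al be eta a b v x y :
  0 < mu -> 0 <= al -> al <= be -> 0 < be -> be <= eta -> eta <= 1 -> be * mu <= 1 ->
  0 <= a -> 0 <= b -> 0 <= v -> 0 <= x -> 0 <= y ->
  (1 + 2 / mu) * x * al <= be * mu / 4 ->
  (1 + be * mu / 2) * ((1 - be * mu) * a + be ^+ 2 * v)
    + (1 + (be * mu / 2)^-1) * (x * (a + b) * al ^+ 2 + y * al ^+ 4)
  <= (1 - be * mu / 4) * a + (1 + 2 / mu) * x * eta * b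
     + (3 / 2 * v + (1 + 2 / mu) * y) * eta ^+ 2.
Proof.
move=> mu0 al0 albe be0 beeta eta1 bemu a0 b0 v0 x0 y0 small.
set m := 1 + 2 / mu in small *.
have m0 : 0 <= m by rewrite /m addr_ge0// divr_ge0// ltW.
have inv : (1 + (be * mu / 2)^-1) * al ^+ 2 <= m * al.
  have -> : m * al = m / be * (be * al) by field; rewrite gt_eqF.
  apply: ler_pM; rewrite ?sqr_ge0 ?addr_ge0 ?invr_ge0 ?divr_ge0 ?mulr_ge0 ?(ltW mu0) ?(ltW be0)//.
    have -> : (be * mu / 2)^-1 = 2 / mu / be by field; rewrite !gt_eqF.
    rewrite /m (mulrDl 1 (2 / mu)) mul1r lerD2r -[leRHS]mul1r ler_pdivlMr//.
    by rewrite mul1r; exact: le_trans eta1.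
  by rewrite expr2 ler_wpM2r.
have al_eta : al <= eta by exact: le_trans beeta.
have al2 : al ^+ 2 <= eta by rewrite expr2; nra.
have sq : be ^+ 2 <= eta ^+ 2 by rewrite ler_pXn2r// nnegrE; lra.
have h1 : (1 + be * mu / 2) * ((1 - be * mu) * a + be ^+ 2 * v)
    <= (1 - be * mu / 2) * a + 3 / 2 * v * eta ^+ 2.
  rewrite mulrDr lerD//; first by rewrite mulrA ler_wpM2r//; have := sqr_ge0 (be * mu); nra.
  rewrite mulrA [leRHS]mulrAC; apply: ler_wpM2r => //.
  apply: ler_pM => //; rewrite ?sqr_ge0//; last lra.
  by have := mulr_gt0 be0 mu0; lra.
have h2 : (1 + (be * mu / 2)^-1) * (x * (a + b) * al ^+ 2 + y * al ^+ 4)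
   <= m * x * al * (a + b) + m * y * eta ^+ 2.
  have -> : (1 + (be * mu / 2)^-1) * (x * (a + b) * al ^+ 2 + y * al ^+ 4)
     = (1 + (be * mu / 2)^-1) * al ^+ 2 * (x * (a + b) + y * al ^+ 2) by ring.
  apply: (@le_trans _ _ (m * al * (x * (a + b) + y * al ^+ 2))).
    by apply: ler_wpM2r => //; rewrite addr_ge0// mulr_ge0 ?sqr_ge0 ?addr_ge0.
  have -> : m * al * (x * (a + b) + y * al ^+ 2) = m * x * al * (a + b) + m * y * (al * al ^+ 2) by ring.
  rewrite lerD2l; apply: ler_wpM2l; first exact: mulr_ge0.
  by rewrite [leRHS]expr2; apply: ler_pM => //; exact: sqr_ge0.
apply: le_trans (lerD h1 h2) _.
have h3 : m * x * al * a <= be * mu / 4 * a by exact: ler_wpM2r.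
have h4 : m * x * al * b <= m * x * eta * b.
  by apply: ler_wpM2r => //; apply: ler_wpM2l => //; exact: mulr_ge0.
rewrite mulrDr; lra.
Qed.

Lemma estimate_recursion al be eta a b x l m v g w :
  0 <= al -> al <= be -> be <= eta -> 0 <= eta -> eta <= 1 ->
  0 <= a -> 0 <= b -> 0 <= x -> 0 <= l -> 0 <= m -> 0 <= v -> 0 <= g -> 0 <= w ->
  2 * eta ^+ 2 * w + (1 - eta) ^+ 2 * b + l * (al ^+ 2 * v)
    + l * (2 * be ^+ 2 * (g * a + x) + 2 * m * (al ^+ 2 * v))
  <= (1 - eta) * b + 2 * l * g * be ^+ 2 * a
     + (2 * w + l * v + l * (2 * x + 2 * m * v)) * eta ^+ 2.
Proof.
move=> al0 albe beeta eta0 eta1 a0 b0 x0 l0 m0 v0 g0 w0.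
have be0 : 0 <= be by exact: le_trans albe.
have s1 : al ^+ 2 <= eta ^+ 2 by rewrite ler_pXn2r ?nnegrE//; exact: le_trans beeta.
have s2 : be ^+ 2 <= eta ^+ 2 by rewrite ler_pXn2r ?nnegrE.
have hb : (1 - eta) ^+ 2 * b <= (1 - eta) * b.
  by apply: ler_wpM2r => //; rewrite expr2; apply: ler_piMl; lra.
have h1 : l * (al ^+ 2 * v) <= l * v * eta ^+ 2.
  by rewrite -mulrA; apply: ler_wpM2l => //; rewrite mulrC; apply: ler_wpM2l.
have h2 : l * (2 * m * (al ^+ 2 * v)) <= l * (2 * m * v) * eta ^+ 2.
  rewrite -[leRHS]mulrA; apply: ler_wpM2l => //; rewrite -[leRHS]mulrA; apply: ler_wpM2l.
    exact: mulr_ge0.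
  by rewrite mulrC; apply: ler_wpM2l.
have h3 : l * (2 * be ^+ 2 * x) <= l * (2 * x) * eta ^+ 2.
  rewrite -[leRHS]mulrA; apply: ler_wpM2l => //; rewrite mulrAC; apply: ler_wpM2l => //.
  exact: mulr_ge0.
have -> : l * (2 * be ^+ 2 * (g * a + x) + 2 * m * (al ^+ 2 * v))
  = 2 * l * g * be ^+ 2 * a + l * (2 * be ^+ 2 * x) + l * (2 * m * (al ^+ 2 * v)) by ring.
have -> : (2 * w + l * v + l * (2 * x + 2 * m * v)) * eta ^+ 2
  = 2 * eta ^+ 2 * w + l * v * eta ^+ 2 + l * (2 * x) * eta ^+ 2 + l * (2 * m * v) * eta ^+ 2 by ring.
lra.
Qed.

(** The weight [c] of the second-order error makes both errors contract at the
    common rate [k * eta]: [c * eta / 2] pays for its leak [s * eta] into the inner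
    error, and [be * mu / 8] for the leak in the other direction. *)
Lemma lyapunov_recursion mu be eta k s c g a b a' b' p q :
  0 <= eta -> 0 <= be -> 0 <= a -> 0 <= b -> 0 <= c -> 2 * s <= c -> k <= 1 / 2 ->
  k * eta <= be * mu / 8 -> c * g * be <= mu / 8 ->
  a' <= (1 - be * mu / 4) * a + s * eta * b + p * eta ^+ 2 ->
  b' <= (1 - eta) * b + g * be ^+ 2 * a + q * eta ^+ 2 ->
  a' + c * b' <= (1 - k * eta) * (a + c * b) + (p + c * q) * eta ^+ 2.
Proof.
move=> eta0 be0 a0 b0 c0 sc k2 kbe cg ha hb.
have hcb := ler_wpM2l c0 hb.
apply: le_trans (lerD ha hcb) _.
have e1 : c * g * be ^+ 2 * a <= be * mu / 8 * a.
  apply: ler_wpM2r => //; have := ler_wpM2l be0 cg.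
  have -> : be * (c * g * be) = c * g * be ^+ 2 by ring.
  by rewrite (mulrA be).
have e2 : k * eta * a <= be * mu / 8 * a by exact: ler_wpM2r.
have eb : 0 <= eta * b by exact: mulr_ge0.
have e3 : s * (eta * b) <= c / 2 * (eta * b) by apply: ler_wpM2r => //; lra.
have e4 : k * (c * (eta * b)) <= 1 / 2 * (c * (eta * b)) by apply: ler_wpM2r => //; exact: mulr_ge0.
have -> : (1 - k * eta) * (a + c * b) = a - k * eta * a + c * b - k * (c * (eta * b)) by ring.
have -> : c * ((1 - eta) * b + g * be ^+ 2 * a + q * eta ^+ 2)
  = c * b - c * (eta * b) + c * g * be ^+ 2 * a + c * q * eta ^+ 2 by ring.
have -> : s * eta * b = s * (eta * b) by ring.
have -> : (1 - be * mu / 4) * a = a - be * mu / 4 * a by ring.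
have -> : (p + c * q) * eta ^+ 2 = p * eta ^+ 2 + c * q * eta ^+ 2 by ring.
have -> : be * mu / 4 * a = be * mu / 8 * a + be * mu / 8 * a by field.
move: e1 e2 e3 e4; set u1 := c * g * _ * a; set u2 := be * mu / 8 * a.
by move=> e1 e2 e3 e4; lra.
Qed.

Lemma sqrt_rate (K : nat) : (0 < K)%N ->
  let eta := (Num.sqrt (K%:R : R))^-1 in
  [/\ 0 < eta, eta <= 1 & eta ^+ 2 * K%:R = 1].
Proof.
move=> K0 eta; have K0' : 0 < K%:R :> R by rewrite ltr0n.
have s0 : 0 < Num.sqrt (K%:R : R) by rewrite sqrtr_gt0.
split; first by rewrite invr_gt0.
- have h : 1 <= Num.sqrt (K%:R : R) by rewrite -{1}sqrtr1 ler_sqrt ?ler1n.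
  by rewrite /eta invf_le1.
- by rewrite exprVn sqr_sqrtr ?ltW// mulVf// gt_eqF.
Qed.

(** Bernoulli's inequality in reverse: [(1 - u)^n <= 1 / (1 + n u)]. *)
Lemma geometric_bound k eta n : 0 <= k * eta -> k * eta <= 1 ->
  (1 - k * eta) ^+ n * (1 + n%:R * (k * eta)) <= 1.
Proof.
set u := k * eta => u0 u1; elim: n => [|n IH]; first by rewrite expr0 mul0r addr0 mulr1.
have nn : 0 <= n%:R :> R by [].
have p0 : 0 <= (1 - u) ^+ n by rewrite exprn_ge0// subr_ge0.
apply: le_trans IH; rewrite exprSr -mulrA ler_wpM2l// -natr1.
have h : 0 <= n%:R * (u * u) by apply: mulr_ge0 => //; exact: mulr_ge0.
have h2 : 0 <= u * u by exact: mulr_ge0.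
have -> : (1 - u) * (1 + (n%:R + 1) * u) = 1 + n%:R * u - n%:R * (u * u) - u * u by ring.
lra.
Qed.

(** After [K - 1] contractions by [1 - k / sqrt K] the initial error is down to the
    order of the stepsize. *)
Lemma geometric_rate k (K : nat) : 0 < k -> k <= 1 / 2 -> (0 < K)%N ->
  (1 - k * (Num.sqrt (K%:R : R))^-1) ^+ K.-1 <= (Num.sqrt (K%:R : R))^-1 / k.
Proof.
move=> k0 k2 K0; have [] := sqrt_rate K0.
set eta := (Num.sqrt _)^-1 => e0 e1 eK.
have ke : k * eta <= 1 by apply: le_trans (_ : 1 * 1 <= _); [apply: ler_pM; lra | lra].
have ke0 : 0 <= k * eta by rewrite mulr_ge0; lra.
have := geometric_bound K.-1 ke0 ke; set g := (1 - _) ^+ _ => hg.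
have g0 : 0 <= g by rewrite exprn_ge0// subr_ge0.
rewrite ler_pdivlMr//.
have hk : k <= (1 + K.-1%:R * (k * eta)) * eta.
  have -> : K.-1%:R = K%:R - 1 :> R by rewrite -[K in RHS](prednK K0) -natr1 addrK.
  have -> : (1 + (K%:R - 1) * (k * eta)) * eta = eta + k * (eta ^+ 2 * K%:R) - k * eta * eta by ring.
  rewrite eK mulr1.
  have : k * eta * eta <= 1 * eta by apply: ler_wpM2r => //; exact: ltW.
  lra.
apply: le_trans (ler_wpM2l g0 hk) _; rewrite [leLHS]mulrA -[leRHS]mul1r.
by apply: ler_wpM2r => //; exact: ltW.
Qed.

Lemma geometric_sum r n : 0 < r -> r <= 1 -> \sum_(j < n) (1 - r) ^+ j <= r^-1 :> R.
Proof.
move=> r0 r1; rewrite -[leRHS]mul1r ler_pdivlMr//.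
have -> : (\sum_(j < n) (1 - r) ^+ j) * r = 1 - (1 - r) ^+ n.
  elim: n => [|n IH]; first by rewrite big_ord0 mul0r expr0 subrr.
  by rewrite big_ord_recr/= mulrDl IH exprSr; ring.
by rewrite gerBl exprn_ge0// subr_ge0.
Qed.

End recursion.

(** * One step of the method, conditionally on the past *)

(** The derivatives are replaced by abstract maps that satisfy the estimates
    proved above: the analysis of the method uses nothing else about them, and
    the limits that define derivatives stay out of sight. *)
Section oracle.
Context {R : realType} {d dy : nat}
  {dXi : measure_display} {Xi : measurableType dXi} (Pxi : probability Xi R)
  {dPhi : measure_display} {Phi : measurableType dPhi} (Pphi : probability Phi R).
Variables (X : set 'cV[R]_d) (ystar : 'cV[R]_d -> 'cV[R]_dy) (x0 : 'cV[R]_d).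
(* The derivatives of the mean functions. *)
Variables (fx : 'cV[R]_d -> 'cV[R]_dy -> 'cV[R]_d) (fy gy : 'cV[R]_d -> 'cV[R]_dy -> 'cV[R]_dy)
  (Gxy : 'cV[R]_d -> 'cV[R]_dy -> 'M[R]_(d, dy)) (Gyy : 'cV[R]_d -> 'cV[R]_dy -> 'M[R]_dy).
(* The derivatives of the sampled functions. *)
Variables (fxs : Xi -> 'cV[R]_d -> 'cV[R]_dy -> 'cV[R]_d)
  (fys : Xi -> 'cV[R]_d -> 'cV[R]_dy -> 'cV[R]_dy)
  (gys : Phi -> 'cV[R]_d -> 'cV[R]_dy -> 'cV[R]_dy)
  (gxys : Phi -> 'cV[R]_d -> 'cV[R]_dy -> 'M[R]_(d, dy))
  (gyys : Phi -> 'cV[R]_d -> 'cV[R]_dy -> 'M[R]_dy).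
(* The Moreau envelope of the outer objective, shifted to be nonnegative, and the
   proximal map. *)
Variables (env : 'cV[R]_d -> R) (pr : 'cV[R]_d -> 'cV[R]_d).
Variables (mu M1 M2 Cxy Cfx Cfy Lfx Lfy Lg Lxy Lyy curv rho kappa : R)
  (vgy vgxy vgyy : R).

Hypotheses (Xcl : closed X) (Xcv : segment_closed X) (Xx0 : X x0).
Hypotheses (mu0 : 0 < mu) (Cxy0 : 0 <= Cxy) (Cfx0 : 0 <= Cfx) (Cfy0 : 0 <= Cfy)
  (Lfx0 : 0 <= Lfx) (Lfy0 : 0 <= Lfy) (Lg0 : 0 <= Lg) (Lxy0 : 0 <= Lxy) (Lyy0 : 0 <= Lyy)
  (curv0 : 0 <= curv) (rho0 : 0 < rho) (kappa0 : 0 < kappa)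
  (vgy0 : 0 <= vgy) (vgxy0 : 0 <= vgxy) (vgyy0 : 0 <= vgyy)
  (M1_ge : Cxy <= M1) (M2_ge : l2 (1%:M : 'M[R]_dy) / mu <= M2).

(** The hypergradient [hypergrad] in terms of the abstract maps. *)
Definition hyper x :=
  fx x (ystar x) - Gxy x (ystar x) *m invmx (Gyy x (ystar x)) *m fy x (ystar x).

Hypotheses
  (lip_fx : forall x y y', X x -> l2 (fx x y - fx x y') <= Lfx * l2 (y - y'))
  (lip_fy : forall x y y', X x -> l2 (fy x y - fy x y') <= Lfy * l2 (y - y'))
  (bnd_fy : forall x y, X x -> l2 (fy x y) <= Cfy)
  (bnd_gxy : forall x y, X x -> l2 (Gxy x y) <= Cxy)
  (gyy_ge : forall x y, X x -> loewner_ge (Gyy x y) mu%:M)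
  (lip_gxy : forall x y x' y', X x -> X x' ->
     l2 (Gxy x y - Gxy x' y') <= Lxy * (l2 (x - x') + l2 (y - y')))
  (lip_gyy : forall x y x' y', X x -> X x' ->
     l2 (Gyy x y - Gyy x' y') <= Lyy * (l2 (x - x') + l2 (y - y')))
  (lip_gxys : forall s x y x' y', X x -> X x' ->
     l2 (gxys s x y - gxys s x' y') <= Lxy * (l2 (x - x') + l2 (y - y')))
  (lip_gyys : forall s x y x' y', X x -> X x' ->
     l2 (gyys s x y - gyys s x' y') <= Lyy * (l2 (x - x') + l2 (y - y')))
  (gy_contraction : forall x y b, X x -> 0 <= b ->
     l2 (y - b *: gy x y - ystar x) ^+ 2
       <= (1 - 2 * b * mu + b ^+ 2 * Lg ^+ 2) * l2 (y - ystar x) ^+ 2)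
  (gy_growth : forall x y, X x -> l2 (gy x y) <= Lg * l2 (y - ystar x))
  (ystar_expand : forall x x', X x -> X x' ->
     l2 (ystar x' - ystar x
         + invmx (Gyy x (ystar x)) *m (Gxy x (ystar x))^T *m (x' - x))
       <= curv * l2 (x' - x) ^+ 2)
  (env_ge0 : forall x, 0 <= env x) (env_continuous : continuous env)
  (env_descent : forall x h a, X x ->
     env (proj X (x - a *: h)) <= env x + rho * a * dotm (pr x - x) h
        + rho / 2 * a ^+ 2 * l2 h ^+ 2)
  (pr_descent : forall x, X x -> dotm (pr x - x) (hyper x) <= - kappa * l2 (pr x - x) ^+ 2)
  (env_ge_pr : forall x, rho / 2 * l2 (pr x - x) ^+ 2 <= env x).

Hypotheses
  (unb_fx : forall x y, X x -> unbiased_estimator Pxi (fun s => fxs s x y) (fx x y))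
  (unb_fy : forall x y, X x -> unbiased_estimator Pxi (fun s => fys s x y) (fy x y))
  (unb_gy : forall x y, X x -> unbiased_estimator Pphi (fun s => gys s x y) (gy x y))
  (unb_gxy : forall x y, X x -> unbiased_estimator Pphi (fun s => gxys s x y) (Gxy x y))
  (unb_gyy : forall x y, X x -> unbiased_estimator Pphi (fun s => gyys s x y) (Gyy x y))
  (var_gy : forall x y, X x -> variance_le Pphi (fun s => gys s x y) (gy x y) vgy)
  (var_gxy : forall x y, X x -> variance_le Pphi (fun s => gxys s x y) (Gxy x y) vgxy)
  (var_gyy : forall x y, X x -> variance_le Pphi (fun s => gyys s x y) (Gyy x y) vgyy)
  (mom_fx : forall x y q, X x -> q = 2%N \/ q = 4%N -> moment_le Pxi (fun s => fxs s x y) q Cfx)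
  (mom_fy : forall x y q, X x -> q = 2%N \/ q = 4%N -> moment_le Pxi (fun s => fys s x y) q Cfy).

Let M10 : 0 <= M1. Proof. exact: le_trans Cxy0 M1_ge. Qed.
Let M20 : 0 <= M2.
Proof. by apply: le_trans M2_ge; rewrite divr_ge0 ?l2_ge0// ltW. Qed.

Let gyy_unit x y : X x -> Gyy x y \in unitmx.
Proof. by move=> Xx; exact: loewner_ge_unit (gyy_ge _ Xx) mu0. Qed.

Let gyy_inv x y : X x -> l2 (invmx (Gyy x y)) <= M2.
Proof. by move=> Xx; apply: le_trans (loewner_ge_inv (gyy_ge _ Xx) mu0) M2_ge. Qed.

Let ler_sqr2 (a b : R) : 0 <= a -> a <= b -> a ^+ 2 <= b ^+ 2.
Proof. by move=> a0 ab; rewrite ler_pXn2r// nnegrE// (le_trans a0). Qed.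

Let sqr_sum3 (a b c : R) : (a + b + c) ^+ 2 <= 3 * (a ^+ 2 + b ^+ 2 + c ^+ 2).
Proof.
have := sqr_ge0 (a - b); have := sqr_ge0 (a - c); have := sqr_ge0 (b - c).
by rewrite !sqrrB !sqrrD; lra.
Qed.

(* The constants of the estimates below: [K_inv] for the coupling matrix, [V_dir]
   and [V4_dir] for the moments of the search direction, [K_dir] for its bias. *)
Definition K_inv := (M2 + Cxy * (M2 * M2)) ^+ 2 * (3 * (1 + (Lxy + Lyy) ^+ 2)).
Definition V_dir := 2 * Cfx ^+ 2 + 2 * (M1 * M2) ^+ 2 * Cfy ^+ 2.
Definition V4_dir := 8 * Cfx ^+ 4 + 8 * (M1 * M2) ^+ 4 * Cfy ^+ 4.
Definition K_dir := 3 * (Lfx ^+ 2 + (M1 * M2 * Lfy) ^+ 2 + Cfy ^+ 2 * K_inv).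

Lemma K_inv_ge0 : 0 <= K_inv.
Proof. by rewrite mulr_ge0 ?sqr_ge0// mulr_ge0// addr_ge0 ?sqr_ge0. Qed.

Lemma V_dir_ge0 : 0 <= V_dir.
Proof. by rewrite /V_dir addr_ge0// !mulr_ge0// exprn_ge0// mulr_ge0. Qed.

Lemma V4_dir_ge0 : 0 <= V4_dir.
Proof. by rewrite /V4_dir addr_ge0// !mulr_ge0// exprn_ge0// mulr_ge0. Qed.

Lemma K_dir_ge0 : 0 <= K_dir.
Proof. by rewrite mulr_ge0// !addr_ge0 ?sqr_ge0// mulr_ge0 ?sqr_ge0// K_inv_ge0. Qed.

Definition err_y x y := l2 (y - ystar x) ^+ 2.
Definition err_H x y A B := l2 (A - Gxy x y) ^+ 2 + l2 (B - Gyy x y) ^+ 2.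

Lemma err_y_ge0 x y : 0 <= err_y x y. Proof. exact: sqr_ge0. Qed.
Lemma err_H_ge0 x y A B : 0 <= err_H x y A B. Proof. by rewrite addr_ge0// sqr_ge0. Qed.

Definition outer_dir (hx : 'cV[R]_d) (hy : 'cV[R]_dy) (A : 'M[R]_(d, dy)) (B : 'M[R]_dy) :=
  hx - A *m invmx B *m hy.

Section state.
Variables (x : 'cV[R]_d) (y : 'cV[R]_dy) (A : 'M[R]_(d, dy)) (B : 'M[R]_dy).
Hypotheses (Xx : X x) (hA : l2 A <= M1) (uB : B \in unitmx) (hB : l2 (invmx B) <= M2).

Let err := err_y x y + err_H x y A B.
Let err0 : 0 <= err. Proof. by rewrite addr_ge0 ?err_y_ge0 ?err_H_ge0. Qed.

(** The errors are measured at [(x, y)], but the matrices that matter are those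
    at [(x, ystar x)]; the Lipschitz constants convert the distance of [y] from
    [ystar x] into an error of the blocks. *)
Let block_err : (l2 (A - Gxy x (ystar x)) + l2 (B - Gyy x (ystar x))) ^+ 2
   <= 3 * (1 + (Lxy + Lyy) ^+ 2) * err.
Proof.
have h1 := l2_triangleB A (Gxy x y) (Gxy x (ystar x)).
have h2 := l2_triangleB B (Gyy x y) (Gyy x (ystar x)).
have h3 := @lip_gxy x y x (ystar x) Xx Xx.
have h4 := @lip_gyy x y x (ystar x) Xx Xx.
rewrite (subrr x) l20 add0r in h3 h4; rewrite /err /err_y /err_H.
have := l2_ge0 (A - Gxy x (ystar x)); have := l2_ge0 (B - Gyy x (ystar x)).
have := l2_ge0 (A - Gxy x y); have := l2_ge0 (B - Gyy x y).
have := l2_ge0 (y - ystar x).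
move: (l2 (A - Gxy x (ystar x))) (l2 (B - Gyy x (ystar x)))
  (l2 (A - Gxy x y)) (l2 (B - Gyy x y)) (l2 (y - ystar x))
  (l2 (Gxy x y - Gxy x (ystar x))) (l2 (Gyy x y - Gyy x (ystar x)))
  h1 h2 h3 h4 => a b u v e r s h1 h2 h3 h4 e0 v0 u0 b0 a0.
have L0 : 0 <= Lxy + Lyy by rewrite addr_ge0.
have h : a + b <= u + v + (Lxy + Lyy) * e by lra.
apply: le_trans (ler_sqr2 (addr_ge0 a0 b0) h) _.
apply: le_trans (sqr_sum3 _ _ _) _; rewrite exprMn.
have := mulr_ge0 (sqr_ge0 (Lxy + Lyy)) (sqr_ge0 u).
have := mulr_ge0 (sqr_ge0 (Lxy + Lyy)) (sqr_ge0 v).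
by have := sqr_ge0 e; move: ((Lxy + Lyy) ^+ 2) => L; lra.
Qed.

Let inv_err (c : R) : 0 <= c ->
  c <= (M2 + Cxy * (M2 * M2)) * (l2 (A - Gxy x (ystar x)) + l2 (B - Gyy x (ystar x))) ->
  c ^+ 2 <= K_inv * err.
Proof.
move=> c0 hc; apply: le_trans (ler_sqr2 c0 hc) _.
by rewrite exprMn /K_inv -mulrA ler_wpM2l ?sqr_ge0.
Qed.

Lemma coupling_error :
  l2 (A *m invmx B - Gxy x (ystar x) *m invmx (Gyy x (ystar x))) ^+ 2 <= K_inv * err.
Proof.
apply: inv_err; first exact: l2_ge0.
apply: l2_mul_inv_sub => //; [exact: gyy_unit | exact: bnd_gxy | exact: gyy_inv].
Qed.

Lemma coupling_error_tr :
  l2 (invmx B *m A^T - invmx (Gyy x (ystar x)) *m (Gxy x (ystar x))^T) ^+ 2 <= K_inv * err.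
Proof.
apply: inv_err; first exact: l2_ge0.
apply: l2_inv_mul_tr_sub => //; [exact: gyy_unit | exact: bnd_gxy | exact: gyy_inv].
Qed.

Let dir s := outer_dir (fxs s x y) (fys s x y) A B.

Lemma unbiased_outer_dir :
  unbiased_estimator Pxi dir (outer_dir (fx x y) (fy x y) A B).
Proof. by apply: unbiasedB (unb_fx y Xx) (unbiased_mulmxl _ (unb_fy y Xx)). Qed.

Let l2_AB : l2 (A *m invmx B) <= M1 * M2.
Proof. by apply: le_trans (l2_mulmx _ _) _; rewrite ler_pM ?l2_ge0. Qed.

Let dir_sqr s :
  l2 (dir s) ^+ 2 <= 2 * l2 (fxs s x y) ^+ 2 + 2 * (M1 * M2) ^+ 2 * l2 (fys s x y) ^+ 2.
Proof.
apply: le_trans (l2_sqrB_le _ _) _; rewrite mulrDr lerD2l -mulrA ler_wpM2l// -exprMn.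
apply: ler_sqr2; first exact: l2_ge0.
by apply: le_trans (l2_mulmx _ _) _; rewrite ler_wpM2r ?l2_ge0.
Qed.

Lemma outer_dir_moment2 : ('E_Pxi[fun s => (l2 (dir s) ^+ 2)%R] <= V_dir%:E)%E.
Proof.
have mx := unbiased_mx_measurable (unb_fx y Xx).
have my := unbiased_mx_measurable (unb_fy y Xx).
have := @le_expectation_affine _ _ _ Pxi (fun s => l2 (dir s) ^+ 2)
    (fun s => l2 (fxs s x y) ^+ 2) (fun s => l2 (fys s x y) ^+ 2)
    (fun=> 0) 0 2 (2 * (M1 * M2) ^+ 2) 0 (Cfx ^+ 2) (Cfy ^+ 2) 0.
rewrite add0r mulr0 addr0; apply => //.
- by apply: measurable_funX; exact: measurable_l2.
- by apply: measurable_funX; exact: measurable_l2.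
- by move=> s; exact: sqr_ge0.
- by move=> s; exact: sqr_ge0.
- by rewrite mulr_ge0// sqr_ge0.
- by apply: mom_fx => //; left.
- by apply: mom_fy => //; left.
- by rewrite expectation_cst.
- by move=> s; exact: sqr_ge0.
by move=> s; rewrite add0r addr0; exact: dir_sqr.
Qed.

Lemma outer_dir_moment4 : ('E_Pxi[fun s => (l2 (dir s) ^+ 4)%R] <= V4_dir%:E)%E.
Proof.
have mx := unbiased_mx_measurable (unb_fx y Xx).
have my := unbiased_mx_measurable (unb_fy y Xx).
have e4 (a : R) : a ^+ 4 = (a ^+ 2) ^+ 2 by rewrite -exprM.
have := @le_expectation_affine _ _ _ Pxi (fun s => l2 (dir s) ^+ 4)
    (fun s => l2 (fxs s x y) ^+ 4) (fun s => l2 (fys s x y) ^+ 4)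
    (fun=> 0) 0 8 (8 * (M1 * M2) ^+ 4) 0 (Cfx ^+ 4) (Cfy ^+ 4) 0.
rewrite add0r mulr0 addr0; apply => //.
- by apply: measurable_funX; exact: measurable_l2.
- by apply: measurable_funX; exact: measurable_l2.
- by move=> s; rewrite e4; exact: sqr_ge0.
- by move=> s; rewrite e4; exact: sqr_ge0.
- by rewrite mulr_ge0// e4 sqr_ge0.
- by apply: mom_fx => //; right.
- by apply: mom_fy => //; right.
- by rewrite expectation_cst.
- by move=> s; rewrite e4; exact: sqr_ge0.
move=> s; rewrite add0r addr0 !e4.
apply: le_trans (ler_sqr2 (sqr_ge0 _) (dir_sqr s)) _.
move: (l2 (fxs s x y) ^+ 2) (l2 (fys s x y) ^+ 2) ((M1 * M2) ^+ 2) => b c k.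
have := sqr_ge0 (b - k * c); rewrite sqrrB sqrrD; lra.
Qed.

(** The conditional mean of the search direction differs from the hypergradient
    by the change of the two gradients between [y] and [ystar x], and by the
    error of the coupling matrix. *)
Lemma outer_dir_bias :
  l2 (outer_dir (fx x y) (fy x y) A B - hyper x) ^+ 2 <= K_dir * err.
Proof.
set A' := Gxy x (ystar x); set B' := Gyy x (ystar x).
pose u1 := fx x y - fx x (ystar x).
pose u2 := A *m invmx B *m (fy x y - fy x (ystar x)).
pose u3 := (A *m invmx B - A' *m invmx B') *m fy x (ystar x).
have -> : outer_dir (fx x y) (fy x y) A B - hyper x = u1 - u2 - u3.
  rewrite /u2 /u3 mulmxBr (mulmxBl (A *m invmx B)) /outer_dir /hyper -/A' -/B' /u1.
  by move: (A *m invmx B *m fy x y) (A *m invmx B *m fy x (ystar x))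
    (A' *m invmx B' *m fy x (ystar x)) => a b c; mx_ring.
have h1 : l2 u1 ^+ 2 <= Lfx ^+ 2 * err.
  apply: le_trans (ler_sqr2 (l2_ge0 _) (lip_fx y (ystar x) Xx)) _.
  by rewrite exprMn ler_wpM2l ?sqr_ge0// lerDl err_H_ge0.
have h2 : l2 u2 ^+ 2 <= (M1 * M2 * Lfy) ^+ 2 * err.
  apply: le_trans (_ : (M1 * M2 * Lfy * l2 (y - ystar x)) ^+ 2 <= _); last first.
    by rewrite exprMn ler_wpM2l ?sqr_ge0// lerDl err_H_ge0.
  apply: ler_sqr2; first exact: l2_ge0.
  apply: le_trans (l2_mulmx _ _) _; rewrite -(mulrA (M1 * M2)).
  by apply: ler_pM; rewrite ?l2_ge0//; exact: lip_fy.
have h3 : l2 u3 ^+ 2 <= Cfy ^+ 2 * (K_inv * err).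
  apply: le_trans (_ : (Cfy * l2 (A *m invmx B - A' *m invmx B')) ^+ 2 <= _).
    apply: ler_sqr2; first exact: l2_ge0.
    by apply: le_trans (l2_mulmx _ _) _; rewrite mulrC ler_wpM2r ?l2_ge0// bnd_fy.
  by rewrite exprMn ler_wpM2l ?sqr_ge0//; exact: coupling_error.
apply: (@le_trans _ _ ((l2 u1 + l2 u2 + l2 u3) ^+ 2)).
  apply: ler_sqr2; first exact: l2_ge0.
  by apply: le_trans (l2_sub_le _ _) _; rewrite lerD2r l2_sub_le.
apply: le_trans (sqr_sum3 _ _ _) _; rewrite /K_dir; lra.
Qed.

Section step.
Variable a : R.
Hypothesis a0 : 0 <= a.

Definition x_next s := proj X (x - a *: dir s).

Lemma x_next_in s : X (x_next s). Proof. exact: (proj_in Xcl Xx0). Qed.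

Lemma x_next_len s : l2 (x_next s - x) <= a * l2 (dir s).
Proof.
apply: le_trans (proj_le Xcl Xcv Xx0 _ Xx) _.
by rewrite addrAC subrr add0r l2N l2Z ger0_norm.
Qed.

Let dir_measurable : mx_measurable dir.
Proof. exact: unbiased_mx_measurable unbiased_outer_dir. Qed.

Lemma x_next_moment2 : ('E_Pxi[fun s => (l2 (x_next s - x) ^+ 2)%R] <= (a ^+ 2 * V_dir)%:E)%E.
Proof.
rewrite -[_ * V_dir]add0r.
apply: (le_expectation_affine1 _ _ _ _ outer_dir_moment2) => // [|s||s|s]; rewrite ?sqr_ge0//.
  by apply: measurable_funX; exact: measurable_l2.
rewrite add0r -exprMn.
by apply: ler_sqr2; [exact: l2_ge0 | exact: x_next_len].
Qed.

(** The motion of the inner iterate caused by the outer step, minus the motion of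
    the inner solution. *)
Definition drift s :=
  - (invmx B *m A^T *m (x_next s - x)) - (ystar (x_next s) - ystar x).

(** The correction term in the inner update follows the motion of the inner
    solution up to the error of the second-order estimates, times the length of
    the outer step, plus a curvature term. *)
Lemma drift_moment2 : ('E_Pxi[fun s => (l2 (drift s) ^+ 2)%R]
  <= (2 * K_inv * err * a ^+ 2 * V_dir + 2 * curv ^+ 2 * a ^+ 4 * V4_dir)%:E)%E.
Proof.
have := @le_expectation_affine _ _ _ Pxi (fun s => l2 (drift s) ^+ 2)
    (fun s => l2 (dir s) ^+ 2) (fun s => l2 (dir s) ^+ 4) (fun=> 0) 0
    (2 * K_inv * err * a ^+ 2) (2 * curv ^+ 2 * a ^+ 4) 0 V_dir V4_dir 0.
have e4 (c : R) : c ^+ 4 = (c ^+ 2) ^+ 2 by rewrite -exprM.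
rewrite add0r !mulr0 !addr0; apply => //.
- by apply: measurable_funX; exact: measurable_l2.
- by apply: measurable_funX; exact: measurable_l2.
- by move=> s; exact: sqr_ge0.
- by move=> s; rewrite e4 sqr_ge0.
- by rewrite mulr_ge0 ?sqr_ge0// mulr_ge0// mulr_ge0 ?K_inv_ge0.
- by rewrite !mulr_ge0 ?sqr_ge0// e4 sqr_ge0.
- exact: outer_dir_moment2.
- exact: outer_dir_moment4.
- by rewrite expectation_cst.
- by move=> s; exact: sqr_ge0.
move=> s; rewrite add0r addr0.
set v := x_next s - x.
set T := invmx (Gyy x (ystar x)) *m (Gxy x (ystar x))^T.
have -> : drift s = - (invmx B *m A^T - T) *m v - (ystar (x_next s) - ystar x + T *m v).
  rewrite /drift -/v mulNmx mulmxBl.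
  by move: (invmx B *m A^T *m v) (T *m v) => w1 w2; mx_ring.
apply: le_trans (l2_sqrB_le _ _) _; rewrite mulrDr; apply: lerD.
  rewrite -!(mulrA 2) ler_wpM2l//.
  apply: (@le_trans _ _ ((l2 (invmx B *m A^T - T) * (a * l2 (dir s))) ^+ 2)).
    apply: ler_sqr2; first exact: l2_ge0.
    apply: le_trans (l2_mulmx _ _) _; rewrite l2N ler_wpM2l ?l2_ge0//.
    exact: x_next_len.
  rewrite !exprMn mulrA ler_wpM2r ?sqr_ge0// ler_wpM2r ?sqr_ge0//.
  exact: coupling_error_tr.
rewrite -!(mulrA 2) ler_wpM2l//.
have h := ystar_expand Xx (x_next_in s); rewrite -/v -/T in h.
apply: le_trans (ler_sqr2 (l2_ge0 _) h) _; rewrite exprMn -mulrA ler_wpM2l ?sqr_ge0//.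
rewrite -(exprMn _ a) (e4 (a * _)); apply: ler_sqr2; first exact: sqr_ge0.
by apply: ler_sqr2; [exact: l2_ge0 | exact: x_next_len].
Qed.

(** In [env_descent] only the mean of the direction matters for the linear term;
    it is the hypergradient, for which [pr_descent] holds, plus a bias, half of
    [kappa] being spent on the latter. *)
Lemma envelope_step : ('E_Pxi[fun s => env (x_next s)]
  <= (env x - rho * a * kappa / 2 * l2 (pr x - x) ^+ 2
      + rho * a * K_dir / (2 * kappa) * err + rho / 2 * a ^+ 2 * V_dir)%:E)%E.
Proof.
have := @unbiased_quadratic_bound _ _ _ Pxi _ _ (fun s => env (x_next s)) dir
  (outer_dir (fx x y) (fy x y) A B) ((rho * a) *: (pr x - x)) (env x)
  (rho / 2 * a ^+ 2) V_dir unbiased_outer_dir outer_dir_moment2.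
have r0 : 0 <= rho / 2 * a ^+ 2 by rewrite mulr_ge0 ?sqr_ge0// divr_ge0// ltW.
move=> /(_ r0) h; apply: le_trans (h _ _) _ => [s|s|].
- exact: env_ge0.
- by rewrite dotmZl; exact: env_descent.
rewrite lee_fin lerD2r -addrA lerD2l dotmZl.
set hb := outer_dir _ _ _ _; set v := pr x - x.
have h1 := pr_descent Xx; rewrite -/v in h1.
have h2 : dotm v (hb - hyper x) <= kappa / 2 * l2 v ^+ 2 + K_dir / (2 * kappa) * err.
  apply: le_trans (ler_dotm _ _) _.
  have h3 := outer_dir_bias; rewrite -/hb in h3.
  have k2 : 0 < (2 * kappa)^-1 by rewrite invr_gt0 mulr_gt0.
  rewrite (mulrAC K_dir); have h4 : l2 v * l2 (hb - hyper x)
      <= kappa / 2 * l2 v ^+ 2 + l2 (hb - hyper x) ^+ 2 / (2 * kappa).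
    have := mulr_ge0 (ltW k2) (sqr_ge0 (kappa * l2 v - l2 (hb - hyper x))).
    move=> h5; rewrite -subr_ge0; apply: le_trans h5 _.
    by apply: le_of_eq; field; rewrite gt_eqF.
  by apply: le_trans h4 _; rewrite lerD2l ler_wpM2r ?(ltW k2).
have ra0 : 0 <= rho * a by rewrite mulr_ge0// ltW.
have -> : dotm v hb = dotm v (hyper x) + dotm v (hb - hyper x).
  by rewrite -dotmDr addrC subrK.
have := ler_wpM2l ra0 (lerD h1 h2); lra.
Qed.

End step.

(** The mean gradient step contracts, and unbiasedness makes the variance enter
    only additively. *)
Lemma gradient_step b : 0 <= b -> b * Lg ^+ 2 <= mu ->
  ('E_Pphi[fun s => (l2 (y - b *: gys s x y - ystar x) ^+ 2)%R]
    <= ((1 - b * mu) * err_y x y + b ^+ 2 * vgy)%:E)%E.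
Proof.
move=> b0 bL.
have uZ := unbiasedB (unbiased_mulmxl b%:M (unb_gy y Xx)) (unbiased_cst Pphi (b%:M *m gy x y)).
rewrite subrr in uZ.
have m1 : mx_measurable (fun s => gys s x y - gy x y).
  apply: mx_measurableB; first exact: unbiased_mx_measurable (unb_gy y Xx).
  exact: mx_measurable_cst.
have vZ : ('E_Pphi[fun s => (l2 (b%:M *m gys s x y - b%:M *m gy x y) ^+ 2)%R]
    <= (b ^+ 2 * vgy)%:E)%E.
  rewrite -[_ * vgy]add0r.
  apply: (le_expectation_affine1 _ _ _ _ (var_gy y Xx)) => // [|s||s|s]; rewrite ?sqr_ge0//.
    by apply: measurable_funX; exact: measurable_l2.
  by rewrite add0r -mulmxBr mul_scalar_mx l2Z exprMn real_normK ?num_real.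
have h := expectation_centered_sqr (b *: gy x y + ystar x - y) uZ vZ.
rewrite (_ : (fun s => _) = (fun s => l2 (b *: gy x y + ystar x - y
   + (b%:M *m gys s x y - b%:M *m gy x y)) ^+ 2)); last first.
  apply/funext => s; rewrite -l2N; congr (l2 _ ^+ 2).
  by rewrite !mul_scalar_mx; mx_ring.
apply: le_trans h _; rewrite lee_fin lerD2r -l2N.
rewrite (_ : - _ = y - b *: gy x y - ystar x); last by mx_ring.
apply: le_trans (gy_contraction y Xx b0) _; rewrite ler_wpM2r ?sqr_ge0//.
have := ler_wpM2l b0 bL; lra.
Qed.

Lemma inner_gradient_moment2 :
  ('E_Pphi[fun s => (l2 (gys s x y) ^+ 2)%R] <= (Lg ^+ 2 * err_y x y + vgy)%:E)%E.
Proof.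
have uZ := unbiasedB (unb_gy y Xx) (unbiased_cst Pphi (gy x y)).
rewrite subrr in uZ.
have h := expectation_centered_sqr (gy x y) uZ (var_gy y Xx).
rewrite (_ : (fun s => _) = (fun s => l2 (gy x y + (gys s x y - gy x y)) ^+ 2)); last first.
  by apply/funext => s; rewrite addrC subrK.
apply: le_trans h _; rewrite lee_fin lerD2r -exprMn.
by apply: ler_sqr2; [exact: l2_ge0 | exact: gy_growth].
Qed.

End state.

Definition xy_step x y x1 y1 (A : 'M[R]_(d, dy)) t s :=
  proj [set H | l2 H <= Cxy] ((1 - t) *: (A - gxys s x y) + gxys s x1 y1).
Definition yy_step x y x1 y1 (B : 'M[R]_dy) t s :=
  proj [set H | loewner_ge H mu%:M] ((1 - t) *: (B - gyys s x y) + gyys s x1 y1).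

Let momentum_len (L u v : R) : 0 <= u -> 0 <= v ->
  8 * (L * (u + v)) ^+ 2 <= 16 * L ^+ 2 * (u ^+ 2 + v ^+ 2).
Proof.
move=> u0 v0; rewrite exprMn.
have := mulr_ge0 (sqr_ge0 L) (sqr_ge0 (u - v)); rewrite sqrrB sqrrD; lra.
Qed.

Lemma xy_step_error x y x1 y1 A t : X x -> X x1 -> 0 <= t -> t <= 1 ->
  ('E_Pphi[fun s => (l2 (xy_step x y x1 y1 A t s - Gxy x1 y1) ^+ 2)%R]
    <= ((1 - t) ^+ 2 * l2 (A - Gxy x y) ^+ 2 + 2 * t ^+ 2 * vgxy
        + 16 * Lxy ^+ 2 * (l2 (x1 - x) ^+ 2 + l2 (y1 - y) ^+ 2))%:E)%E.
Proof.
move=> Xx Xx1 t0 t1.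
have D0 : 0 <= Lxy * (l2 (x1 - x) + l2 (y1 - y)) by rewrite mulr_ge0// addr_ge0 ?l2_ge0.
apply: le_trans (momentum_error A (@closed_l2_ball _ _ _ _) (@segment_closed_l2_ball _ _ _ _)
  (bnd_gxy y1 Xx1) t0 t1 D0 (unb_gxy y Xx) (unb_gxy y1 Xx1) (var_gxy y1 Xx1) _) _.
  by move=> s; exact: lip_gxys.
by rewrite lee_fin lerD2l momentum_len ?l2_ge0.
Qed.

Lemma yy_step_error x y x1 y1 B t : X x -> X x1 -> 0 <= t -> t <= 1 ->
  ('E_Pphi[fun s => (l2 (yy_step x y x1 y1 B t s - Gyy x1 y1) ^+ 2)%R]
    <= ((1 - t) ^+ 2 * l2 (B - Gyy x y) ^+ 2 + 2 * t ^+ 2 * vgyy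
        + 16 * Lyy ^+ 2 * (l2 (x1 - x) ^+ 2 + l2 (y1 - y) ^+ 2))%:E)%E.
Proof.
move=> Xx Xx1 t0 t1.
have D0 : 0 <= Lyy * (l2 (x1 - x) + l2 (y1 - y)) by rewrite mulr_ge0// addr_ge0 ?l2_ge0.
apply: le_trans (momentum_error B (@closed_loewner _ _ _) (@segment_closed_loewner _ _ _)
  (gyy_ge y1 Xx1) t0 t1 D0 (unb_gyy y Xx) (unb_gyy y1 Xx1) (var_gyy y1 Xx1) _) _.
  by move=> s; exact: lip_gyys.
by rewrite lee_fin lerD2l momentum_len ?l2_ge0.
Qed.

(** * The iterates as an adapted process *)

Section process.
Context {dO : measure_display} {Omega : measurableType dO} (P : probability Omega R)
  (xi : nat -> {RV P >-> Xi}) (phi : nat -> {RV P >-> Phi}).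
Variables (y0 : 'cV[R]_dy) (A0 : 'M[R]_(d, dy)) (B0 : 'M[R]_dy).
Hypotheses (fresh : fresh_samples Pxi Pphi xi phi).
Hypotheses (hA0 : l2 A0 <= M1) (uB0 : B0 \in unitmx) (hB0 : l2 (invmx B0) <= M2).
Hypotheses
  (meas_fxs : forall (dT : measure_display) (T : measurableType dT) (t : T -> Xi) x y,
    measurable_fun setT t -> mx_measurable x -> mx_measurable y ->
    mx_measurable (fun w => fxs (t w) (x w) (y w)))
  (meas_fys : forall (dT : measure_display) (T : measurableType dT) (t : T -> Xi) x y,
    measurable_fun setT t -> mx_measurable x -> mx_measurable y ->
    mx_measurable (fun w => fys (t w) (x w) (y w)))
  (meas_gys : forall (dT : measure_display) (T : measurableType dT) (t : T -> Phi) x y,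
    measurable_fun setT t -> mx_measurable x -> mx_measurable y ->
    mx_measurable (fun w => gys (t w) (x w) (y w)))
  (meas_gxys : forall (dT : measure_display) (T : measurableType dT) (t : T -> Phi) x y,
    measurable_fun setT t -> mx_measurable x -> mx_measurable y ->
    mx_measurable (fun w => gxys (t w) (x w) (y w)))
  (meas_gyys : forall (dT : measure_display) (T : measurableType dT) (t : T -> Phi) x y,
    measurable_fun setT t -> mx_measurable x -> mx_measurable y ->
    mx_measurable (fun w => gyys (t w) (x w) (y w)))
  (meas_Gxy : forall (dT : measure_display) (T : measurableType dT) (x : T -> _) y,
    mx_measurable x -> mx_measurable y -> mx_measurable (fun w => Gxy (x w) (y w)))
  (meas_Gyy : forall (dT : measure_display) (T : measurableType dT) (x : T -> _) y,
    mx_measurable x -> mx_measurable y -> mx_measurable (fun w => Gyy (x w) (y w)))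
  (meas_ystar : forall (dT : measure_display) (T : measurableType dT) (x : T -> _),
    mx_measurable x -> (forall w, X (x w)) -> mx_measurable (fun w => ystar (x w))).

Section stepsizes.
Variables alpha beta tau : nat -> R.

Definition y_next b s s' (st : state R d dy) a :=
  let: State x y A B := st in
  y - b *: gys s' x y - invmx B *m A^T *m (x_next x y A B a s - x).

Definition step a b t s s' s'' (st : state R d dy) : state R d dy :=
  let: State x y A B := st in
  let x1 := x_next x y A B a s in
  let y1 := y_next b s s' st a in
  State x1 y1 (xy_step x y x1 y1 A t s'') (yy_step x y x1 y1 B t s'').

Fixpoint stable_path k w : state R d dy :=
  if k is k'.+1 then
    step (alpha k') (beta k') (tau k'.+1) (xi k' w) (phi k' w) (phi k'.+1 w) (stable_path k' w)
  else State x0 y0 A0 B0.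

Let px k w := st_x (stable_path k w).
Let py k w := st_y (stable_path k w).
Let pA k w := st_Hxy (stable_path k w).
Let pB k w := st_Hyy (stable_path k w).

Lemma path_xE k w : px k.+1 w = x_next (px k w) (py k w) (pA k w) (pB k w) (alpha k) (xi k w).
Proof. by rewrite /px /py /pA /pB /=; case: (stable_path k w). Qed.

Lemma path_yE k w : py k.+1 w = py k w - beta k *: gys (phi k w) (px k w) (py k w)
  - invmx (pB k w) *m (pA k w)^T *m (px k.+1 w - px k w).
Proof. by rewrite /px /py /pA /pB /=; case: (stable_path k w). Qed.

Lemma path_AE k w : pA k.+1 w =
  xy_step (px k w) (py k w) (px k.+1 w) (py k.+1 w) (pA k w) (tau k.+1) (phi k.+1 w).
Proof. by rewrite /px /py /pA /pB /=; case: (stable_path k w). Qed.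

Lemma path_BE k w : pB k.+1 w =
  yy_step (px k w) (py k w) (px k.+1 w) (py k.+1 w) (pB k w) (tau k.+1) (phi k.+1 w).
Proof. by rewrite /px /py /pA /pB /=; case: (stable_path k w). Qed.

Let ball0 : l2 (0 : 'M[R]_(d, dy)) <= Cxy. Proof. by rewrite l20. Qed.
Let loewner0 : loewner_ge (mu%:M : 'M[R]_dy) mu%:M.
Proof. by apply: loewner_ge_refl; rewrite tr_scalar_mx. Qed.

Lemma path_in k w : X (px k w).
Proof. by case: k => [//|k]; rewrite path_xE; exact: x_next_in. Qed.

Lemma path_A_le k w : l2 (pA k w) <= M1.
Proof.
case: k => [//|k]; rewrite path_AE; apply: le_trans M1_ge.
exact: (proj_in (@closed_l2_ball _ _ _ _) ball0).
Qed.

Let path_B_ge k w : loewner_ge (pB k.+1 w) mu%:M.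
Proof. by rewrite path_BE; exact: (proj_in (@closed_loewner _ _ _) loewner0). Qed.

Lemma path_B_unit k w : pB k w \in unitmx.
Proof. by case: k => [//|k]; exact: loewner_ge_unit (path_B_ge k w) mu0. Qed.

Lemma path_B_inv k w : l2 (invmx (pB k w)) <= M2.
Proof.
case: k => [//|k]; apply: le_trans M2_ge.
exact: loewner_ge_inv (path_B_ge k w) mu0.
Qed.

Section step_measurability.
Context {dT : measure_display} {T : measurableType dT}.
Variables (x : T -> 'cV[R]_d) (y : T -> 'cV[R]_dy) (A : T -> 'M[R]_(d, dy)) (B : T -> 'M[R]_dy).
Hypotheses (mx : mx_measurable x) (my : mx_measurable y) (mA : mx_measurable A)
  (mB : mx_measurable B) (uB : forall w, B w \in unitmx).

Lemma measurable_x_next a (t : T -> Xi) : measurable_fun setT t ->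
  mx_measurable (fun w => x_next (x w) (y w) (A w) (B w) a (t w)).
Proof.
move=> mt; apply: mx_measurable_continuous.
  apply: (@l2_lipschitz_continuous _ _ _ _ _ _ 1) => u v; rewrite mul1r.
  exact: (proj_nonexpansive Xcl Xcv Xx0).
apply: mx_measurableB => //; apply: mx_measurableZ; first exact: measurable_cst.
apply: mx_measurableB; first exact: meas_fxs.
apply: mx_measurableM; last exact: meas_fys.
by apply: mx_measurableM => //; exact: mx_measurable_inv.
Qed.

Lemma measurable_xy_step x1 y1 t (s : T -> Phi) : mx_measurable x1 -> mx_measurable y1 ->
  measurable_fun setT s ->
  mx_measurable (fun w => xy_step (x w) (y w) (x1 w) (y1 w) (A w) t (s w)).
Proof.
move=> mx1 my1 ms; apply: mx_measurable_continuous.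
  apply: (@l2_lipschitz_continuous _ _ _ _ _ _ 1) => u v; rewrite mul1r.
  exact: (proj_nonexpansive (@closed_l2_ball _ _ _ _) (@segment_closed_l2_ball _ _ _ _) ball0).
apply: mx_measurableD; last exact: meas_gxys.
apply: mx_measurableZ; first exact: measurable_cst.
by apply: mx_measurableB => //; exact: meas_gxys.
Qed.

Lemma measurable_yy_step x1 y1 t (s : T -> Phi) : mx_measurable x1 -> mx_measurable y1 ->
  measurable_fun setT s ->
  mx_measurable (fun w => yy_step (x w) (y w) (x1 w) (y1 w) (B w) t (s w)).
Proof.
move=> mx1 my1 ms; apply: mx_measurable_continuous.
  apply: (@l2_lipschitz_continuous _ _ _ _ _ _ 1) => u v; rewrite mul1r.
  exact: (proj_nonexpansive (@closed_loewner _ _ _) (@segment_closed_loewner _ _ _) loewner0).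
apply: mx_measurableD; last exact: meas_gyys.
apply: mx_measurableZ; first exact: measurable_cst.
by apply: mx_measurableB => //; exact: meas_gyys.
Qed.

End step_measurability.

Let E := sample_events xi phi.

Let E_measurable i : E i `<=` measurable.
Proof.
by case: i => j _ [B mB <-]; exact: measurable_funPT.
Qed.

Let E_setI i : setI_closed (E i).
Proof.
case: i => j _ _ [B mB <-] [B' mB' <-]; exists (B `&` B'); rewrite ?preimage_setI ?setTI//;
  exact: measurableI.
Qed.

Let E_setT i : E i setT.
Proof. by case: i => j; exists setT; rewrite ?preimage_setT ?setTI. Qed.

(** The indices of the samples that [(x^k, y^k)] depends on, [inl] for the outer
    and [inr] for the inner samples. *)
Definition before (k : nat) : set (nat + nat) :=
  [set i | match i with inl j => (j < k)%N | inr j => (j < k)%N end].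

(** The second-order estimates of iteration [k] already use the inner sample of
    that iteration. *)
Definition before_outer (k : nat) : set (nat + nat) :=
  [set i | match i with inl j => (j < k)%N | inr j => (j <= k)%N end].

Definition past (D : set (nat + nat)) := g_sigma_algebraType (generators E D).

Let gen_measurable D : generators E D `<=` measurable.
Proof. by move=> A [i _]; exact: E_measurable. Qed.

Lemma past_mono D D' (m n : nat) (u : Omega -> 'M[R]_(m, n)) : D `<=` D' ->
  mx_measurable (u : past D -> 'M[R]_(m, n)) -> mx_measurable (u : past D' -> 'M[R]_(m, n)).
Proof.
move=> DD' mu' i j _ Y mY; have := mu' i j measurableT Y mY.
move: (_ `&` _); apply: smallest_sub; first exact: smallest_sigma_algebra.
by move=> A [l Dl El]; apply: sub_sigma_algebra; exists l => //; exact: DD'.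
Qed.

Lemma past_ambient_fun D (u : Omega -> R) :
  measurable_fun setT (u : past D -> R) -> measurable_fun setT u.
Proof.
move=> mu' _ Y mY; have := mu' measurableT Y mY.
move: (_ `&` _); apply: smallest_sub; first exact: sigma_algebra_measurable.
exact: gen_measurable.
Qed.

Lemma past_xi (D : set (nat + nat)) j : D (inl j) -> measurable_fun setT (xi j : past D -> Xi).
Proof.
move=> Dj _ Y mY; apply: sub_sigma_algebra; exists (inl j) => //.
by exists Y => //.
Qed.

Lemma past_phi (D : set (nat + nat)) j : D (inr j) -> measurable_fun setT (phi j : past D -> Phi).
Proof.
move=> Dj _ Y mY; apply: sub_sigma_algebra; exists (inr j) => //.
by exists Y => //.
Qed.

(** The pair [(x^k, y^k)] and the second-order estimates live on different
    pasts: the latter have already seen the sample [phi^k] that drives the next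
    inner gradient step. *)
Lemma path_adapted k :
  [/\ mx_measurable (px k : past (before k) -> _), mx_measurable (py k : past (before k) -> _),
      mx_measurable (pA k : past (before_outer k) -> _)
    & mx_measurable (pB k : past (before_outer k) -> _)].
Proof.
elim: k => [|k [mx my mA mB]]; first by split; exact: mx_measurable_cst.
have s1 : before k `<=` before k.+1 by move=> [] j /= /ltnW.
have s2 : before_outer k `<=` before k.+1 by move=> [] j //= /ltnW.
have s3 : before k.+1 `<=` before_outer k.+1 by move=> [] j //= /ltnW.
have s4 : before k `<=` before_outer k.+1 by exact: subset_trans s1 s3.
have s5 : before_outer k `<=` before_outer k.+1 by exact: subset_trans s2 s3.
have mx1 : mx_measurable (px k.+1 : past (before k.+1) -> _).
  rewrite (_ : px k.+1 = fun w => x_next (px k w) (py k w) (pA k w) (pB k w) (alpha k) (xi k w)).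
    apply: measurable_x_next; try by [exact: past_mono s1 _ | exact: past_mono s2 _].
      by move=> w; exact: path_B_unit.
    by apply: past_xi => /=.
  by apply/funext => w; exact: path_xE.
have my1 : mx_measurable (py k.+1 : past (before k.+1) -> _).
  rewrite (_ : py k.+1 = fun w => py k w - beta k *: gys (phi k w) (px k w) (py k w)
     - invmx (pB k w) *m (pA k w)^T *m (px k.+1 w - px k w)).
    have mx' := past_mono s1 mx; have my' := past_mono s1 my.
    have mA' := past_mono s2 mA; have mB' := past_mono s2 mB.
    apply: mx_measurableB; last first.
      apply: mx_measurableM; last exact: mx_measurableB.
      apply: mx_measurableM; last exact: mx_measurable_tr.
      by apply: mx_measurable_inv => // w; exact: path_B_unit.
    apply: mx_measurableB => //; apply: mx_measurableZ; first exact: measurable_cst.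
    by apply: meas_gys => //; apply: past_phi => /=.
  by apply/funext => w; exact: path_yE.
split=> //.
- rewrite (_ : pA k.+1 = fun w => xy_step (px k w) (py k w) (px k.+1 w) (py k.+1 w) (pA k w)
     (tau k.+1) (phi k.+1 w)); last by apply/funext => w; exact: path_AE.
  apply: measurable_xy_step; try by [exact: past_mono s4 _ | exact: past_mono s5 _ | exact: past_mono s3 _].
  by apply: past_phi => /=.
- rewrite (_ : pB k.+1 = fun w => yy_step (px k w) (py k w) (px k.+1 w) (py k.+1 w) (pB k w)
     (tau k.+1) (phi k.+1 w)); last by apply/funext => w; exact: path_BE.
  apply: measurable_yy_step; try by [exact: past_mono s4 _ | exact: past_mono s5 _ | exact: past_mono s3 _].
  by apply: past_phi => /=.
Qed.

Let xi_indep D k A B : ~ D (inl k) -> <<s generators E D >> A -> measurable B ->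
  P (A `&` xi k @^-1` B) = (P A * P (xi k @^-1` B))%E.
Proof.
move=> Dk DA mB; apply: (past_indep E_measurable E_setI E_setT (indep_samples fresh) Dk DA).
by exists B => //; rewrite setTI.
Qed.

Let phi_indep D k A B : ~ D (inr k) -> <<s generators E D >> A -> measurable B ->
  P (A `&` phi k @^-1` B) = (P A * P (phi k @^-1` B))%E.
Proof.
move=> Dk DA mB; apply: (past_indep E_measurable E_setI E_setT (indep_samples fresh) Dk DA).
by exists B => //; rewrite setTI.
Qed.

Lemma integral_fresh_xi D k (h : past D * Xi -> \bar R) : ~ D (inl k) ->
  measurable_fun setT h -> (forall z, 0 <= h z)%E ->
  (\int[P]_w h (w, xi k w) = \int[P]_w \int[Pxi]_s h (w, s))%E.
Proof.
move=> Dk.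
exact: (integral_fresh (@gen_measurable D) (law_xi fresh k) (fun A B => @xi_indep D k A B Dk)).
Qed.

(** A bound that holds for each frozen past, averaged over a fresh sample,
    averages over the past. *)
Lemma expectation_fresh_xi D k (h : past D -> Xi -> R) (U : Omega -> R) : ~ D (inl k) ->
  measurable_fun setT (fun z : past D * Xi => h z.1 z.2) -> (forall w s, 0 <= h w s) ->
  (forall w, 'E_Pxi[h w] <= (U w)%:E)%E -> ('E_P[fun w => h w (xi k w)] <= 'E_P[U])%E.
Proof.
move=> Dk.
exact: (expectation_fresh (@gen_measurable D) (law_xi fresh k) (fun A B => @xi_indep D k A B Dk)).
Qed.

Lemma expectation_fresh_phi D k (h : past D -> Phi -> R) (U : Omega -> R) : ~ D (inr k) ->
  measurable_fun setT (fun z : past D * Phi => h z.1 z.2) -> (forall w s, 0 <= h w s) ->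
  (forall w, 'E_Pphi[h w] <= (U w)%:E)%E -> ('E_P[fun w => h w (phi k w)] <= 'E_P[U])%E.
Proof.
move=> Dk.
exact: (expectation_fresh (@gen_measurable D) (law_phi fresh k) (fun A B => @phi_indep D k A B Dk)).
Qed.

Let before_sub k : before k `<=` before_outer k.
Proof. by move=> [] j //= /ltnW. Qed.

Let before_outer_sub k : before_outer k `<=` before k.+1.
Proof. by move=> [] j //= /ltnW. Qed.

Let mpx k : mx_measurable (px k : past (before_outer k) -> _).
Proof. by have [h _ _ _] := path_adapted k; exact: past_mono (@before_sub k) h. Qed.
Let mpy k : mx_measurable (py k : past (before_outer k) -> _).
Proof. by have [_ h _ _] := path_adapted k; exact: past_mono (@before_sub k) h. Qed.
Let mpA k : mx_measurable (pA k : past (before_outer k) -> _).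
Proof. by have [] := path_adapted k. Qed.
Let mpB k : mx_measurable (pB k : past (before_outer k) -> _).
Proof. by have [] := path_adapted k. Qed.

Let ambient (D : set (nat + nat)) (m n : nat) (u : past D -> 'M[R]_(m, n)) :
  mx_measurable u -> mx_measurable (u : Omega -> 'M[R]_(m, n)).
Proof. by move=> mu' i j; exact: (@past_ambient_fun D _ (mu' i j)). Qed.

Let mfst (D : set (nat + nat)) (dS : measure_display) (S : measurableType dS) (m n : nat)
  (u : past D -> 'M[R]_(m, n)) : mx_measurable u ->
  mx_measurable (fun z : past D * S => u z.1).
Proof. by move=> mu'; exact: (mx_measurable_comp measurable_fst mu'). Qed.

Let sqr_l2_meas (dT : measure_display) (T : measurableType dT) (m n : nat)
  (u : T -> 'M[R]_(m, n)) : mx_measurable u -> measurable_fun setT (fun t => l2 (u t) ^+ 2).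
Proof. by move=> mu'; apply: measurable_funX; exact: measurable_l2. Qed.

Let mnext k : mx_measurable (fun z : past (before_outer k) * Xi =>
  x_next (px k z.1) (py k z.1) (pA k z.1) (pB k z.1) (alpha k) z.2).
Proof.
have uB (z : past (before_outer k) * Xi) : pB k z.1 \in unitmx by exact: path_B_unit.
exact: (measurable_x_next (mfst (@mpx k)) (mfst (@mpy k)) (mfst (@mpA k)) (mfst (@mpB k)) uB
  (alpha k) measurable_snd).
Qed.

Definition erry k w := err_y (px k w) (py k w).
Definition errH k w := err_H (px k w) (py k w) (pA k w) (pB k w).
Definition outer_move k w := l2 (px k.+1 w - px k w) ^+ 2.
Definition inner_move k w := l2 (py k.+1 w - py k w) ^+ 2.

Let erry_ge0 k w : 0 <= erry k w. Proof. exact: err_y_ge0. Qed.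
Let errH_ge0 k w : 0 <= errH k w. Proof. exact: err_H_ge0. Qed.
Let outer_move_ge0 k w : 0 <= outer_move k w. Proof. exact: sqr_ge0. Qed.
Let inner_move_ge0 k w : 0 <= inner_move k w. Proof. exact: sqr_ge0. Qed.

Let merry k : measurable_fun setT (erry k).
Proof.
apply: (@past_ambient_fun (before_outer k)); apply: sqr_l2_meas.
apply: mx_measurableB => //; apply: meas_ystar => // w; exact: path_in.
Qed.

Let merrH k : measurable_fun setT (errH k).
Proof.
apply: (@past_ambient_fun (before_outer k)).
apply: measurable_funD; apply: sqr_l2_meas; apply: mx_measurableB => //.
  exact: meas_Gxy.
exact: meas_Gyy.
Qed.

Let mpx1 k : mx_measurable (px k.+1 : past (before k.+1) -> _).
Proof. by have [] := path_adapted k.+1. Qed.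
Let mpy1 k : mx_measurable (py k.+1 : past (before k.+1) -> _).
Proof. by have [] := path_adapted k.+1. Qed.

Let mouter_move k : measurable_fun setT (outer_move k).
Proof.
apply: (@past_ambient_fun (before k.+1)); apply: sqr_l2_meas.
by apply: mx_measurableB => //; exact: (past_mono (@before_outer_sub k) (@mpx k)).
Qed.

Let minner_move k : measurable_fun setT (inner_move k).
Proof.
apply: (@past_ambient_fun (before k.+1)); apply: sqr_l2_meas.
by apply: mx_measurableB => //; exact: (past_mono (@before_outer_sub k) (@mpy k)).
Qed.

Section iteration.
Variables (k : nat) (a b : R).
Hypotheses (ha : ('E_P[erry k] <= a%:E)%E) (hb : ('E_P[errH k] <= b%:E)%E)
  (alpha0 : 0 <= alpha k) (beta0 : 0 < beta k).

Let Dxi : ~ before_outer k (inl k). Proof. by rewrite /= ltnn. Qed.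
Let Dphi : ~ before k (inr k). Proof. by rewrite /= ltnn. Qed.
Let Dphi1 : ~ before k.+1 (inr k.+1). Proof. by rewrite /= ltnn. Qed.

Lemma expected_outer_move : ('E_P[outer_move k] <= (alpha k ^+ 2 * V_dir)%:E)%E.
Proof.
pose h (w : past (before_outer k)) s :=
  l2 (x_next (px k w) (py k w) (pA k w) (pB k w) (alpha k) s - px k w) ^+ 2.
have -> : outer_move k = fun w => h w (xi k w).
  by apply/funext => w; rewrite /outer_move /h path_xE.
apply: (@le_trans _ _ ('E_P[fun=> (alpha k ^+ 2 * V_dir)%R])%E); last by rewrite expectation_cst.
apply: (expectation_fresh_xi Dxi) => [|w s|w]; last exact: (x_next_moment2 _ (path_in k w) (path_A_le k w) (path_B_inv k w)).
- exact: sqr_l2_meas (mx_measurableB (@mnext k) (mfst (@mpx k))).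
- exact: sqr_ge0.
Qed.

Definition path_drift w := drift (px k w) (py k w) (pA k w) (pB k w) (alpha k) (xi k w).

Lemma expected_drift : ('E_P[fun w => (l2 (path_drift w) ^+ 2)%R]
  <= (2 * K_inv * (a + b) * alpha k ^+ 2 * V_dir + 2 * curv ^+ 2 * alpha k ^+ 4 * V4_dir)%:E)%E.
Proof.
pose h (w : past (before_outer k)) s :=
  l2 (drift (px k w) (py k w) (pA k w) (pB k w) (alpha k) s) ^+ 2.
pose c1 := 2 * K_inv * alpha k ^+ 2 * V_dir.
pose c0 := 2 * curv ^+ 2 * alpha k ^+ 4 * V4_dir.
have c10 : 0 <= c1 by rewrite /c1 mulr_ge0 ?V_dir_ge0// mulr_ge0 ?sqr_ge0// mulr_ge0// K_inv_ge0.
have c00 : 0 <= c0 by rewrite /c0 mulr_ge0 ?V4_dir_ge0// mulr_ge0 ?exprn_even_ge0// mulr_ge0// sqr_ge0.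
apply: (@le_trans _ _ ('E_P[fun w => (c0 + c1 * erry k w + c1 * errH k w + 0 * erry k w)%R])%E).
  apply: (@expectation_fresh_xi _ _ h _ Dxi) => [|w s|w].
  - apply: sqr_l2_meas; apply: mx_measurableB.
      apply: mx_measurableN; apply: mx_measurableM; last exact: mx_measurableB (@mnext k) (mfst (@mpx k)).
      apply: mx_measurableM; last exact: mx_measurable_tr (mfst (@mpA k)).
      by apply: mx_measurable_inv (mfst (@mpB k)) => z; exact: path_B_unit.
    apply: mx_measurableB.
      by apply: meas_ystar (@mnext k) _ => z; apply: x_next_in; exact: path_in.
    by apply: meas_ystar (mfst (@mpx k)) _ => z; exact: path_in.
  - exact: sqr_ge0.
  - apply: le_trans (drift_moment2 _ (path_in k w) (path_A_le k w) (path_B_unit k w) (path_B_inv k w) alpha0) _.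
    by rewrite lee_fin /c0 /c1 /erry /errH; apply: le_of_eq; ring.
apply: (@le_trans _ _ (c0 + c1 * a + c1 * b + 0 * a)%:E).
  apply: le_expectation_affine ha hb ha _ _ => // w; rewrite ?addr_ge0// mulr_ge0//.
by rewrite lee_fin /c0 /c1; apply: le_of_eq; ring.
Qed.

Definition gradient_moved w := py k w - beta k *: gys (phi k w) (px k w) (py k w) - ystar (px k w).

Hypothesis betaLg : beta k * Lg ^+ 2 <= mu.
Hypothesis beta_mu : beta k * mu <= 1.

Let mgys : mx_measurable (fun z : past (before k) * Phi => gys z.2 (px k z.1) (py k z.1)).
Proof.
have [mx my _ _] := path_adapted k.
by apply: meas_gys (mfst mx) (mfst my); exact: measurable_snd.
Qed.

Lemma expected_gradient_moved : ('E_P[fun w => (l2 (gradient_moved w) ^+ 2)%R]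
  <= ((1 - beta k * mu) * a + beta k ^+ 2 * vgy)%:E)%E.
Proof.
have [mx my _ _] := path_adapted k.
pose h (w : past (before k)) s := l2 (py k w - beta k *: gys s (px k w) (py k w) - ystar (px k w)) ^+ 2.
pose c1 := 1 - beta k * mu; pose c0 := beta k ^+ 2 * vgy.
have c10 : 0 <= c1 by rewrite /c1 subr_ge0.
have c00 : 0 <= c0 by rewrite /c0 mulr_ge0// sqr_ge0.
apply: (@le_trans _ _ ('E_P[fun w => (c0 + c1 * erry k w)%R])%E).
  apply: (@expectation_fresh_phi _ _ h _ Dphi) => [|w s|w].
  - apply: sqr_l2_meas; apply: mx_measurableB.
      apply: mx_measurableB (mfst my) _; apply: mx_measurableZ mgys; exact: measurable_cst.
    by apply: meas_ystar (mfst mx) _ => z; exact: path_in.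
  - exact: sqr_ge0.
  - apply: le_trans (gradient_step _ (path_in k w) (ltW beta0) betaLg) _.
    by rewrite lee_fin /c0 /c1 /erry /errH; apply: le_of_eq; ring.
apply: (@le_trans _ _ (c0 + c1 * a)%:E).
  by apply: le_expectation_affine1 ha _ _ => // w; rewrite addr_ge0// mulr_ge0.
by rewrite lee_fin /c0 /c1; apply: le_of_eq; ring.
Qed.

Lemma expected_inner_gradient : ('E_P[fun w => (l2 (gys (phi k w) (px k w) (py k w)) ^+ 2)%R]
  <= (Lg ^+ 2 * a + vgy)%:E)%E.
Proof.
pose h (w : past (before k)) s := l2 (gys s (px k w) (py k w)) ^+ 2.
have c10 : 0 <= Lg ^+ 2 by exact: sqr_ge0.
apply: (@le_trans _ _ ('E_P[fun w => (vgy + Lg ^+ 2 * erry k w)%R])%E).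
  apply: (@expectation_fresh_phi _ _ h _ Dphi) => [|w s|w].
  - by apply: sqr_l2_meas; exact: mgys.
  - exact: sqr_ge0.
  - apply: le_trans (inner_gradient_moment2 _ (path_in k w)) _.
    by rewrite lee_fin /erry /errH; apply: le_of_eq; ring.
rewrite addrC; apply: le_expectation_affine1 ha _ _ => // w.
by rewrite addr_ge0// mulr_ge0.
Qed.

Let ambient_gys : mx_measurable (fun w => gys (phi k w) (px k w) (py k w)).
Proof.
have mx := ambient (@mpx k).
have my := ambient (@mpy k).
exact: meas_gys.
Qed.

Let ambient_moved : measurable_fun setT (fun w => l2 (gradient_moved w) ^+ 2).
Proof.
have mx := ambient (@mpx k).
have my := ambient (@mpy k).
apply: sqr_l2_meas; apply: mx_measurableB.
  by apply: mx_measurableB => //; apply: mx_measurableZ => //; exact: measurable_cst.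
by apply: meas_ystar => // w; exact: path_in.
Qed.

Let ambient_drift : measurable_fun setT (fun w => l2 (path_drift w) ^+ 2).
Proof.
have mx := ambient (@mpx k).
have mx1 := ambient (@mpx1 k).
have mA := ambient (@mpA k).
have mB := ambient (@mpB k).
have -> : path_drift = fun w => - (invmx (pB k w) *m (pA k w)^T *m (px k.+1 w - px k w))
   - (ystar (px k.+1 w) - ystar (px k w)).
  by apply/funext => w; rewrite /path_drift /drift -path_xE.
apply: sqr_l2_meas; apply: mx_measurableB.
  apply: mx_measurableN; apply: mx_measurableM; last exact: mx_measurableB.
  apply: mx_measurableM; last exact: mx_measurable_tr.
  by apply: mx_measurable_inv => // z; exact: path_B_unit.
by apply: mx_measurableB; apply: meas_ystar => // w; exact: path_in.
Qed.

Let path_errorE w : py k.+1 w - ystar (px k.+1 w) = gradient_moved w + path_drift w.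
Proof.
rewrite path_yE /gradient_moved /path_drift /drift -path_xE.
by move: (gys _ _ _) (invmx _ *m _ *m _) => u v; mx_ring.
Qed.

(** Young's inequality applied to the gradient step and the drift, with the
    parameter [beta * mu / 2] that gives up half of the contraction. *)
Lemma expected_inner_error : ('E_P[erry k.+1]
  <= ((1 + beta k * mu / 2) * ((1 - beta k * mu) * a + beta k ^+ 2 * vgy)
      + (1 + (beta k * mu / 2)^-1) *
        (2 * K_inv * (a + b) * alpha k ^+ 2 * V_dir + 2 * curv ^+ 2 * alpha k ^+ 4 * V4_dir))%:E)%E.
Proof.
have e0 : 0 < beta k * mu / 2 by rewrite divr_gt0// mulr_gt0.
have e1 : 0 <= 1 + beta k * mu / 2 by rewrite addr_ge0// ltW.
have e2 : 0 <= 1 + (beta k * mu / 2)^-1 by rewrite addr_ge0// invr_ge0 ltW.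
rewrite -[X in (_ <= X%:E)%E]add0r addrA -[X in (_ <= X%:E)%E]addr0 -[X in (_ <= (_ + X)%:E)%E](mul0r a).
apply: le_expectation_affine expected_gradient_moved expected_drift ha _ _ => // w; try exact: sqr_ge0.
by rewrite mul0r addr0 add0r /erry /err_y path_errorE; exact: l2_sqrD_young.
Qed.

Lemma expected_inner_move : ('E_P[inner_move k]
  <= (2 * beta k ^+ 2 * (Lg ^+ 2 * a + vgy) + 2 * (M1 * M2) ^+ 2 * (alpha k ^+ 2 * V_dir))%:E)%E.
Proof.
rewrite -[X in (_ <= X%:E)%E]add0r addrA -[X in (_ <= X%:E)%E]addr0 -[X in (_ <= (_ + X)%:E)%E](mul0r a).
apply: le_expectation_affine expected_inner_gradient expected_outer_move ha _ _ => //;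
  do ?[by move=> w; exact: sqr_ge0 | by rewrite mulr_ge0// sqr_ge0 | exact: sqr_l2_meas].
move=> w; rewrite mul0r addr0 add0r /inner_move path_yE.
have -> : py k w - beta k *: gys (phi k w) (px k w) (py k w)
    - invmx (pB k w) *m (pA k w)^T *m (px k.+1 w - px k w) - py k w
   = - (beta k *: gys (phi k w) (px k w) (py k w))
    - invmx (pB k w) *m (pA k w)^T *m (px k.+1 w - px k w).
  by rewrite [LHS]addrAC; congr (_ - _); rewrite addrAC subrr add0r.
apply: le_trans (l2_sqrB_le _ _) _; rewrite l2N l2Z mulrDr exprMn real_normK ?num_real//.
rewrite mulrA lerD2l -mulrA ler_pM2l// /outer_move -exprMn.
apply: ler_sqr2; first exact: l2_ge0.
apply: le_trans (l2_mulmx _ _) _; rewrite ler_wpM2r ?l2_ge0//.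
apply: le_trans (l2_mulmx _ _) _; rewrite l2_tr mulrC ler_pM ?l2_ge0//; [exact: path_A_le|exact: path_B_inv].
Qed.

Hypotheses (tau0 : 0 <= tau k.+1) (tau1 : tau k.+1 <= 1).

(** Conditionally on the past of step [k + 1], both points at which the samples
    are taken are fixed, and their distance is that of the last move. *)
Lemma expected_estimate_error : ('E_P[errH k.+1]
  <= (2 * tau k.+1 ^+ 2 * (vgxy + vgyy) + (1 - tau k.+1) ^+ 2 * b
      + 16 * (Lxy ^+ 2 + Lyy ^+ 2) * (alpha k ^+ 2 * V_dir)
      + 16 * (Lxy ^+ 2 + Lyy ^+ 2) *
        (2 * beta k ^+ 2 * (Lg ^+ 2 * a + vgy) + 2 * (M1 * M2) ^+ 2 * (alpha k ^+ 2 * V_dir)))%:E)%E.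
Proof.
have [mx1 my1 _ _] := path_adapted k.+1.
pose hA (w : past (before k.+1)) s :=
  xy_step (px k w) (py k w) (px k.+1 w) (py k.+1 w) (pA k w) (tau k.+1) s - Gxy (px k.+1 w) (py k.+1 w).
pose hB (w : past (before k.+1)) s :=
  yy_step (px k w) (py k w) (px k.+1 w) (py k.+1 w) (pB k w) (tau k.+1) s - Gyy (px k.+1 w) (py k.+1 w).
pose h w s := l2 (hA w s) ^+ 2 + l2 (hB w s) ^+ 2.
have mhA : mx_measurable (fun z : past (before k.+1) * Phi => hA z.1 z.2).
  apply: mx_measurableB; last exact: meas_Gxy (mfst mx1) (mfst my1).
  exact: (measurable_xy_step (mfst (past_mono (@before_outer_sub k) (@mpx k))) (mfst (past_mono (@before_outer_sub k) (@mpy k)))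
    (mfst (past_mono (@before_outer_sub k) (@mpA k))) (tau k.+1) (mfst mx1) (mfst my1) measurable_snd).
have mhB : mx_measurable (fun z : past (before k.+1) * Phi => hB z.1 z.2).
  apply: mx_measurableB; last exact: meas_Gyy (mfst mx1) (mfst my1).
  exact: (measurable_yy_step (mfst (past_mono (@before_outer_sub k) (@mpx k))) (mfst (past_mono (@before_outer_sub k) (@mpy k)))
    (mfst (past_mono (@before_outer_sub k) (@mpB k))) (tau k.+1) (mfst mx1) (mfst my1) measurable_snd).
pose L := 16 * (Lxy ^+ 2 + Lyy ^+ 2); pose c0 := 2 * tau k.+1 ^+ 2 * (vgxy + vgyy).
have L0 : 0 <= L by rewrite /L mulr_ge0// addr_ge0// sqr_ge0.
have c00 : 0 <= c0 by rewrite /c0 mulr_ge0 ?addr_ge0// mulr_ge0// sqr_ge0.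
have c10 : 0 <= (1 - tau k.+1) ^+ 2 by exact: sqr_ge0.
rewrite -/L -/c0.
apply: le_trans (le_expectation_affine (merrH k) (mouter_move k) (minner_move k) _ _ _
  c00 c10 L0 L0 hb expected_outer_move expected_inner_move _ (fun=> lexx _)) => //; last first.
  by move=> w; rewrite ?addr_ge0// mulr_ge0.
rewrite (_ : errH k.+1 = fun w => h w (phi k.+1 w)); last first.
  by apply/funext => w; rewrite /h /hA /hB /errH /err_H path_AE path_BE.
apply: (@expectation_fresh_phi _ _ h _ Dphi1) => [|w s|w].
- by apply: measurable_funD; exact: sqr_l2_meas.
- by rewrite addr_ge0// sqr_ge0.
- have mA : measurable_fun setT (fun s => l2 (hA w s) ^+ 2).
    by apply: sqr_l2_meas; exact: (mx_measurable_comp (pair1_measurable w) mhA).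
  have mB : measurable_fun setT (fun s => l2 (hB w s) ^+ 2).
    by apply: sqr_l2_meas; exact: (mx_measurable_comp (pair1_measurable w) mhB).
  have eA := xy_step_error (py k w) (py k.+1 w) (pA k w) (path_in k w) (path_in k.+1 w) tau0 tau1.
  have eB := yy_step_error (py k w) (py k.+1 w) (pB k w) (path_in k w) (path_in k.+1 w) tau0 tau1.
  have sq (m n : nat) (Z : Phi -> 'M[R]_(m, n)) s : 0 <= l2 (Z s) ^+ 2 by exact: sqr_ge0.
  apply: le_trans (le_expectation_affine mA mB mA (sq _ _ _) (sq _ _ _) (sq _ _ _) (lexx 0) ler01 ler01 (lexx 0) eA eB eA _ _) _.
  + by move=> s; rewrite addr_ge0// sqr_ge0.
  + by move=> s; rewrite !mul1r mul0r addr0 add0r.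
  + rewrite lee_fin /L /c0 /errH /err_H /outer_move /inner_move; apply: le_of_eq.
    by ring.
Qed.

End iteration.

(** Stated between extended reals, so that finiteness of the mean of the envelope
    comes out of the induction over [k] and need not go into it. *)
Lemma expected_envelope k (a b : R) : ('E_P[erry k] <= a%:E)%E -> ('E_P[errH k] <= b%:E)%E ->
  0 < alpha k ->
  ('E_P[fun w => env (px k.+1 w)]
     + (rho * alpha k * kappa / 2)%:E * 'E_P[fun w => (l2 (pr (px k w) - px k w) ^+ 2)%R]
   <= 'E_P[fun w => env (px k w)]
     + (rho * alpha k * K_dir / (2 * kappa) * (a + b) + rho / 2 * alpha k ^+ 2 * V_dir)%:E)%E.
Proof.
move=> ha hb al0.
pose q := rho * alpha k * kappa / 2; pose c1 := rho * alpha k * K_dir / (2 * kappa).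
pose c2 := rho / 2 * alpha k ^+ 2 * V_dir.
have q0 : 0 < q by rewrite /q divr_gt0// !mulr_gt0.
have c10 : 0 <= c1.
  apply: divr_ge0; last by rewrite mulr_ge0// ltW.
  by rewrite mulr_ge0 ?K_dir_ge0// mulr_ge0// ltW.
have c20 : 0 <= c2 by rewrite /c2 mulr_ge0 ?V_dir_ge0// mulr_ge0 ?sqr_ge0// divr_ge0// ltW.
have Dxi : ~ before_outer k (inl k) by rewrite /= ltnn.
pose h (z : past (before_outer k) * Xi) :=
  (env (x_next (px k z.1) (py k z.1) (pA k z.1) (pB k z.1) (alpha k) z.2))%:E.
have h0 z : (0 <= h z)%E by rewrite lee_fin.
have menv (dT : measure_display) (T : measurableType dT) (u : T -> 'cV[R]_d) :
    mx_measurable u -> measurable_fun setT (fun t => env (u t)).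
  by apply: (@measurable_caratheodory _ _ _ _ _ (fun _ M => env M)).
have mh : measurable_fun setT h by apply/measurable_EFinP; exact: menv (@mnext k).
pose U w := env (px k w) + c1 * erry k w + c1 * errH k w + c2
  - q * l2 (pr (px k w) - px k w) ^+ 2.
have hU w : (\int[Pxi]_s h (w, s) <= (U w)%:E)%E.
  have := envelope_step (py k w) (path_in k w) (path_A_le k w) (path_B_unit k w) (path_B_inv k w) (ltW al0).
  rewrite unlock => /le_trans; apply; rewrite lee_fin /U /c1 /c2 /q /erry /errH.
  by apply: le_of_eq; ring.
(* The mean of the next envelope with the past frozen. *)
pose V (w : Omega) := fine (\int[Pxi]_s h (w : past (before_outer k), s))%E.
have V0 w : 0 <= V w by rewrite fine_ge0// integral_ge0.
have VE w : (V w)%:E = (\int[Pxi]_s h (w, s))%E.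
  rewrite fineK// ge0_fin_numE ?integral_ge0//; exact: le_lt_trans (hU w) (ltry _).
have mV : measurable_fun setT V.
  apply: (@past_ambient_fun (before_outer k)); apply: measurableT_comp; first exact: fine_measurable.
  exact: (measurable_fun_fubini_tonelli_F h mh h0).
have menvk : measurable_fun setT (fun w => env (px k w)) by apply: menv; exact: ambient (@mpx k).
have merr c (u : Omega -> R) : measurable_fun setT u -> measurable_fun setT (fun w => c * u w).
  by move=> mu'; exact: measurable_funM.
have mW : measurable_fun setT (fun w => env (px k w) + c1 * erry k w + c1 * errH k w + c2).
  apply: measurable_funD => //; apply: measurable_funD; last exact: merr (merrH k).
  by apply: measurable_funD => //; exact: merr (merry k).
have -> : ('E_P[fun w => env (px k.+1 w)] = 'E_P[V])%E.
  rewrite unlock (_ : (\int[P]_w (V w)%:E = \int[P]_w \int[Pxi]_s h (w, s))%E); last first.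
    by apply: eq_integral => w _; rewrite VE.
  rewrite -(integral_fresh_xi Dxi mh h0); apply: eq_integral => w _.
  by rewrite /h path_xE.
have DVW w : q * l2 (pr (px k w) - px k w) ^+ 2 + V w
    <= env (px k w) + c1 * erry k w + c1 * errH k w + c2.
  by have := hU w; rewrite -VE lee_fin /U lerBrDl.
pose D w := l2 (pr (px k w) - px k w) ^+ 2.
have D0 w : 0 <= D w by exact: sqr_ge0.
rewrite -/q; apply: le_trans (@expectation_decrease _ _ _ P D V _ q mV mW q0 V0 D0 DVW) _.
have E0 : (0 <= 'E_P[fun w => env (px k w)])%E by exact: expectation_ge0.
case Ee : ('E_P[fun w => env (px k w)])%E => [r| |]; last by rewrite Ee in E0.
  have er : ('E_P[fun w => env (px k w)] <= r%:E)%E by rewrite Ee.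
  apply: (@le_trans _ _ (c2 + 1 * r + c1 * a + c1 * b)%:E).
    apply: (le_expectation_affine menvk (merry k) (merrH k) _ _ _ c20 ler01 c10 c10 er ha hb) => // w.
      by rewrite !addr_ge0// mulr_ge0.
    by rewrite mul1r; apply: le_of_eq; ring.
  rewrite -EFinD lee_fin -/c1 -/c2; apply: le_of_eq; ring.
by rewrite addye// leey.
Qed.
(** * Rates of convergence *)

(* [leak * eta] is the factor with which the second-order error enters the inner
   recursion, [back_leak * beta^2] that of the inner error in the second-order
   recursion; [noise * eta^2] is what is added in each step. *)
Definition leak := (1 + 2 / mu) * (2 * K_inv * V_dir).
Definition weight := 2 * leak + 1.
Definition back_leak := 2 * (16 * (Lxy ^+ 2 + Lyy ^+ 2)) * Lg ^+ 2.
Definition noise_y := 3 / 2 * vgy + (1 + 2 / mu) * (2 * curv ^+ 2 * V4_dir).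
Definition noise_H := 2 * (vgxy + vgyy) + 16 * (Lxy ^+ 2 + Lyy ^+ 2) * V_dir
  + 16 * (Lxy ^+ 2 + Lyy ^+ 2) * (2 * vgy + 2 * (M1 * M2) ^+ 2 * V_dir).
Definition noise := noise_y + weight * noise_H.
Definition init_error := err_y x0 y0 + weight * err_H x0 y0 A0 B0.

Lemma leak_ge0 : 0 <= leak.
Proof.
rewrite /leak mulr_ge0// ?addr_ge0 ?divr_ge0 ?(ltW mu0)//.
by rewrite mulr_ge0 ?V_dir_ge0// mulr_ge0// K_inv_ge0.
Qed.

Lemma weight_ge1 : 1 <= weight.
Proof. by rewrite /weight lerDr mulr_ge0// leak_ge0. Qed.

Let weight_ge0 : 0 <= weight. Proof. exact: le_trans ler01 weight_ge1. Qed.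

Lemma back_leak_ge0 : 0 <= back_leak.
Proof. by rewrite /back_leak !mulr_ge0 ?addr_ge0 ?sqr_ge0. Qed.

Lemma noise_y_ge0 : 0 <= noise_y.
Proof.
rewrite /noise_y addr_ge0//; first by rewrite mulr_ge0// divr_ge0.
rewrite mulr_ge0//; first by rewrite addr_ge0 ?divr_ge0 ?(ltW mu0).
by rewrite mulr_ge0 ?V4_dir_ge0// mulr_ge0 ?sqr_ge0.
Qed.

Lemma noise_H_ge0 : 0 <= noise_H.
Proof.
have L0 : 0 <= 16 * (Lxy ^+ 2 + Lyy ^+ 2) by rewrite mulr_ge0// addr_ge0// sqr_ge0.
rewrite /noise_H addr_ge0//.
  apply: addr_ge0; last by rewrite mulr_ge0// V_dir_ge0.
  by rewrite mulr_ge0// addr_ge0.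
apply: mulr_ge0 => //; rewrite addr_ge0//; first by rewrite mulr_ge0.
by rewrite mulr_ge0 ?V_dir_ge0// mulr_ge0// sqr_ge0.
Qed.

Lemma noise_ge0 : 0 <= noise.
Proof. by rewrite /noise addr_ge0 ?noise_y_ge0// mulr_ge0 ?noise_H_ge0. Qed.

Lemma init_error_ge0 : 0 <= init_error.
Proof. by rewrite /init_error addr_ge0 ?err_y_ge0// mulr_ge0 ?err_H_ge0. Qed.

Section rates.
Variables (K : nat) (c0 : R).
Let eta := (Num.sqrt (K%:R : R))^-1.
Hypotheses (K0 : (0 < K)%N) (c00 : 0 < c0).
Hypothesis steps : forall k, (k < K)%N ->
  [/\ 0 < alpha k, alpha k <= beta k, beta k <= eta, c0 * eta <= alpha k & tau k = eta].
Hypothesis small : forall k, (k < K)%N ->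
  [/\ beta k * Lg ^+ 2 <= mu, beta k * mu <= 1, leak * alpha k <= beta k * mu / 4
    & weight * back_leak * beta k <= mu / 8].

Definition rate := Num.min (c0 * mu / 8) (1 / 2).

Let rate_gt0 : 0 < rate.
Proof. by rewrite /rate lt_min !divr_gt0// mulr_gt0. Qed.

Let rate_le : rate <= 1 / 2.
Proof. by rewrite /rate ge_min lexx orbT. Qed.

Let eta0 : 0 < eta. Proof. by have [] := @sqrt_rate R K K0. Qed.
Let eta1 : eta <= 1. Proof. by have [] := @sqrt_rate R K K0. Qed.
Let etaK : eta ^+ 2 * K%:R = 1. Proof. by have [] := @sqrt_rate R K K0. Qed.

(** The closed form of the solution of [w' = (1 - rate eta) w + noise eta^2]. *)
Definition error_bound k := init_error * (1 - rate * eta) ^+ k + noise * eta / rate.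

Let error_bound_next k :
  (1 - rate * eta) * error_bound k + noise * eta ^+ 2 = error_bound k.+1.
Proof.
by rewrite /error_bound (exprS _ k); field; rewrite gt_eqF.
Qed.

Let rate_eta : 0 <= 1 - rate * eta.
Proof.
have : rate * eta <= 1 * 1 by apply: ler_pM => //; [exact: ltW|exact: ltW|apply: le_trans rate_le _; lra].
by rewrite mulr1 subr_ge0.
Qed.

Let error_bound_ge0 k : 0 <= error_bound k.
Proof.
rewrite /error_bound addr_ge0//; first by apply: mulr_ge0; [exact: init_error_ge0|exact: exprn_ge0].
by rewrite divr_ge0 ?(ltW rate_gt0)// mulr_ge0 ?noise_ge0// ltW.
Qed.

Let controlled k w := exists a b, [/\ 0 <= a, 0 <= b, ('E_P[erry k] <= a%:E)%E,
  ('E_P[errH k] <= b%:E)%E & a + weight * b <= w].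

Let next_inner_error k a b : (k < K)%N -> 0 <= a -> 0 <= b ->
  ('E_P[erry k] <= a%:E)%E -> ('E_P[errH k] <= b%:E)%E ->
  ('E_P[erry k.+1] <= ((1 - beta k * mu / 4) * a + leak * eta * b + noise_y * eta ^+ 2)%:E)%E.
Proof.
move=> kK a0 b0 ha hb.
have [al0 albe beeta _ _] := steps kK; have [s1 s2 s3 _] := small kK.
have be0 : 0 < beta k by exact: lt_le_trans albe.
apply: le_trans (expected_inner_error ha hb (ltW al0) be0 s1 s2) _; rewrite lee_fin.
have x0' : 0 <= 2 * K_inv * V_dir by rewrite mulr_ge0 ?V_dir_ge0// mulr_ge0// K_inv_ge0.
have y0' : 0 <= 2 * curv ^+ 2 * V4_dir by rewrite mulr_ge0 ?V4_dir_ge0// mulr_ge0// sqr_ge0.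
apply: le_trans (inner_recursion mu0 (ltW al0) albe be0 beeta eta1 s2 a0 b0 vgy0 x0' y0' s3).
by apply: le_of_eq; ring.
Qed.

(** Both expectations are followed through real upper bounds, which also shows
    them finite. *)
Let error_decay k : (k < K)%N -> controlled k (error_bound k).
Proof.
elim: k => [_|k IH kK].
  exists (err_y x0 y0), (err_H x0 y0 A0 B0); split; rewrite ?err_y_ge0 ?err_H_ge0//.
  - by rewrite (_ : erry 0 = cst (err_y x0 y0))// expectation_cst.
  - by rewrite (_ : errH 0 = cst (err_H x0 y0 A0 B0))// expectation_cst.
  - rewrite /error_bound expr0 mulr1 lerDl; apply: divr_ge0; last exact: ltW.
    by apply: mulr_ge0; [exact: noise_ge0|exact: ltW].
have kK' := ltnW kK; have [a [b [a0 b0 ha hb hw]]] := IH kK'.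
have [al0 albe beeta c0al _] := steps kK'; have [s1 s2 s3 s4] := small kK'.
have [_ _ _ _ tauk] := steps kK.
have be0 : 0 < beta k by exact: lt_le_trans albe.
have hy := next_inner_error kK' a0 b0 ha hb.
have hH := expected_estimate_error ha hb (ltW al0).
rewrite tauk in hH; have {}hH := hH (ltW eta0) eta1.
have L0 : 0 <= 16 * (Lxy ^+ 2 + Lyy ^+ 2) by rewrite mulr_ge0// addr_ge0// sqr_ge0.
have hor := estimate_recursion (ltW al0) albe beeta (ltW eta0) eta1 a0 b0 vgy0 L0 (sqr_ge0 (M1 * M2))
   V_dir_ge0 (sqr_ge0 Lg) (addr_ge0 vgxy0 vgyy0).
have {hor}hH : ('E_P[errH k.+1] <= ((1 - eta) * b + back_leak * beta k ^+ 2 * a + noise_H * eta ^+ 2)%:E)%E.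
  by apply: le_trans hH _; rewrite lee_fin; exact: hor.
exists ((1 - beta k * mu / 4) * a + leak * eta * b + noise_y * eta ^+ 2).
exists ((1 - eta) * b + back_leak * beta k ^+ 2 * a + noise_H * eta ^+ 2).
have be1 : beta k * mu / 4 <= 1 by lra.
split=> //.
- apply: addr_ge0; last by apply: mulr_ge0; [exact: noise_y_ge0|exact: sqr_ge0].
  apply: addr_ge0; first by rewrite mulr_ge0// subr_ge0.
  by apply: mulr_ge0 => //; apply: mulr_ge0; [exact: leak_ge0|exact: ltW].
- apply: addr_ge0; last by apply: mulr_ge0; [exact: noise_H_ge0|exact: sqr_ge0].
  apply: addr_ge0; first by rewrite mulr_ge0// subr_ge0.
  by apply: mulr_ge0 => //; apply: mulr_ge0; [exact: back_leak_ge0|exact: sqr_ge0].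
- have kbe : rate * eta <= beta k * mu / 8.
    apply: (@le_trans _ _ (c0 * mu / 8 * eta)).
      by rewrite ler_wpM2r ?(ltW eta0)// /rate ge_min lexx.
    have -> : c0 * mu / 8 * eta = c0 * eta * mu / 8 by ring.
    by rewrite ler_wpM2r// ler_wpM2r ?(ltW mu0)//; exact: le_trans albe.
  have sw : 2 * leak <= weight by rewrite /weight lerDl.
  apply: le_trans (lyapunov_recursion (ltW eta0) (ltW be0) a0 b0 weight_ge0 sw rate_le kbe s4 (lexx _) (lexx _)) _.
  by rewrite -error_bound_next lerD2r ler_wpM2l.
Qed.

Definition inner_rate := init_error / rate + noise / rate + noise_y.

(** The last step has its own argument: the contraction of the weighted sum would
    involve the estimates [H^K], whereas [y^K] only depends on those of the step
    before. *)
Lemma inner_error_rate : ('E_P[erry K] <= (inner_rate * eta)%:E)%E.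
Proof.
have kK : (K.-1 < K)%N by rewrite prednK.
have [a [b [a0 b0 ha hb hw]]] := error_decay kK.
have [al0 albe beeta c0al _] := steps kK; have [s1 s2 s3 s4] := small kK.
have be0 : 0 < beta K.-1 by exact: lt_le_trans albe.
have := next_inner_error kK a0 b0 ha hb; rewrite prednK// => /le_trans; apply; rewrite lee_fin.
have h1 : (1 - beta K.-1 * mu / 4) * a <= a.
  by rewrite ler_piMl// gerBl divr_ge0// mulr_ge0// ltW.
have h2 : leak * eta * b <= weight * b.
  apply: ler_wpM2r => //; apply: (@le_trans _ _ (leak * 1)).
    by rewrite ler_wpM2l ?leak_ge0.
  by rewrite /weight; have := leak_ge0; lra.
have h3 : noise_y * eta ^+ 2 <= noise_y * eta.
  by rewrite ler_wpM2l ?noise_y_ge0// expr2 ler_piMl// ltW.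
have h4 : error_bound K.-1 <= init_error / rate * eta + noise / rate * eta.
  rewrite /error_bound lerD//.
    rewrite -mulrA ler_wpM2l ?init_error_ge0// [leRHS]mulrC; exact: geometric_rate.
  by rewrite mulrAC.
rewrite /inner_rate (mulrDl _ noise_y) (mulrDl (init_error / rate)); apply: le_trans (lerD (lerD h1 h2) h3) _.
by rewrite lerD2r; exact: le_trans h4.
Qed.

Definition gap k w := l2 (pr (px k w) - px k w) ^+ 2.
Definition env_noise k := (rho * K_dir / (2 * kappa) * error_bound k + rho / 2 * V_dir * eta) * eta.
Definition gap_weight := rho * kappa * c0 / 2.

Let gap_ge0 k w : 0 <= gap k w. Proof. exact: sqr_ge0. Qed.
Let Egap_ge0 k : (0 <= 'E_P[gap k])%E. Proof. exact: expectation_ge0. Qed.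

Let coupling_ge0 : 0 <= rho * K_dir / (2 * kappa).
Proof.
apply: divr_ge0; first by apply: mulr_ge0 K_dir_ge0; exact: ltW.
by rewrite mulr_ge0// ltW.
Qed.

Let gap_weight_gt0 : 0 < gap_weight.
Proof. by rewrite /gap_weight divr_gt0// !mulr_gt0. Qed.

(** Each step contributes at least [c0 * eta], the lower bound on the stepsizes. *)
Let envelope_telescope k : (k <= K)%N ->
  ('E_P[fun w => env (px k w)] + (gap_weight * eta)%:E * \sum_(0 <= j < k) 'E_P[gap j]
    <= (env x0 + \sum_(0 <= j < k) env_noise j)%:E)%E.
Proof.
elim: k => [_|k IH kK].
  rewrite !big_geq// mule0 adde0 addr0 (_ : (fun w => env (px 0 w)) = cst (env x0))//.
  by rewrite expectation_cst.
have {}IH := IH (ltnW kK).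
have [a [b [a0 b0 ha hb hw]]] := error_decay kK.
have [al0 albe beeta c0al _] := steps kK.
have := expected_envelope ha hb al0 => step.
have al_eta : alpha k <= eta by exact: le_trans beeta.
have hq : gap_weight * eta <= rho * alpha k * kappa / 2.
  have -> : gap_weight * eta = rho * kappa / 2 * (c0 * eta) by rewrite /gap_weight; ring.
  have -> : rho * alpha k * kappa / 2 = rho * kappa / 2 * alpha k by ring.
  by rewrite ler_wpM2l// divr_ge0// mulr_ge0// ltW.
have hr : rho * alpha k * K_dir / (2 * kappa) * (a + b) + rho / 2 * alpha k ^+ 2 * V_dir <= env_noise k.
  have ab : a + b <= error_bound k.
    by apply: le_trans hw; rewrite lerD2l ler_peMl// weight_ge1.
  have -> : rho * alpha k * K_dir / (2 * kappa) * (a + b) = rho * K_dir / (2 * kappa) * (a + b) * alpha k by ring.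
  have -> : rho / 2 * alpha k ^+ 2 * V_dir = rho / 2 * V_dir * alpha k * alpha k by ring.
  have rV : 0 <= rho / 2 * V_dir by rewrite mulr_ge0 ?V_dir_ge0// divr_ge0// ltW.
  rewrite -mulrDl /env_noise [_ * eta]mulrC [_ * alpha k]mulrC; apply: ler_pM => //.
  - exact: ltW.
  - by apply: addr_ge0; rewrite mulr_ge0 ?addr_ge0 ?(ltW al0).
  - by apply: lerD; rewrite ler_wpM2l.
rewrite !big_nat_recr//= ge0_muleDr ?sume_ge0// addrA EFinD.
set S := (_ * \sum_(0 <= j < k) _)%E in IH *.
rewrite addeAC.
apply: (@le_trans _ _ ('E_P[fun w => env (px k.+1 w)] + (rho * alpha k * kappa / 2)%:E * 'E_P[gap k] + S)%E).
  by rewrite leeD2r// leeD2l// lee_wpmul2r// lee_fin.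
apply: (@le_trans _ _ ('E_P[fun w => env (px k w)] + (env_noise k)%:E + S)%E).
  rewrite leeD2r//; apply: le_trans step _; by rewrite leeD2l// lee_fin.
rewrite addeAC; apply: le_trans (leeD2r (env_noise k)%:E IH) _.
by rewrite -!EFinD addrA.
Qed.

Definition env_total := env x0 + rho * K_dir / (2 * kappa) * ((init_error + noise) / rate) + rho / 2 * V_dir.

Let env_noise_sum : env x0 + \sum_(0 <= j < K) env_noise j <= env_total.
Proof.
have unit_time (v : R) : v = v * (eta ^+ 2 * K%:R) by rewrite etaK mulr1.
rewrite /env_total -addrA lerD2l big_mkord -mulr_suml big_split/= mulrDl; apply: lerD; last first.
  rewrite sumr_const card_ord -mulr_natr [leRHS]unit_time.
  by apply: le_of_eq; ring.
rewrite -mulr_sumr -mulrA ler_wpM2l//.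
rewrite big_split/= -mulr_sumr sumr_const card_ord mulrDl [leRHS]mulrDl.
have re0 : 0 < rate * eta by exact: mulr_gt0.
apply: lerD.
  rewrite -mulrA; apply: ler_wpM2l; first exact: init_error_ge0.
  apply: (@le_trans _ _ ((rate * eta)^-1 * eta)).
    apply: ler_wpM2r; first exact: ltW.
    by apply: geometric_sum => //; rewrite -subr_ge0.
  by rewrite invfM -mulrA mulVf ?mulr1// gt_eqF.
rewrite -mulr_natr [leRHS]unit_time.
by apply: le_of_eq; ring.
Qed.

Definition outer_rate := env_total / gap_weight + 2 / rho * env_total.

Let env_total_ge0 : 0 <= env_total.
Proof.
rewrite /env_total !addr_ge0 ?env_ge0//.
  apply: mulr_ge0 => //; apply: divr_ge0; last exact: ltW.
  by apply: addr_ge0; [exact: init_error_ge0|exact: noise_ge0].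
by rewrite mulr_ge0 ?V_dir_ge0// divr_ge0// ltW.
Qed.

(** The sum runs to [k = K], from which no step is taken; that last term is
    bounded by the envelope itself. *)
Lemma outer_gap_rate : ((K%:R^-1)%:E * \sum_(1 <= k < K.+1) 'E_P[gap k] <= (outer_rate * eta)%:E)%E.
Proof.
have tele := envelope_telescope (leqnn K).
have {}tele : ('E_P[fun w => env (px K w)] + (gap_weight * eta)%:E * \sum_(0 <= j < K) 'E_P[gap j]
   <= env_total%:E)%E by apply: le_trans tele _; rewrite lee_fin; exact: env_noise_sum.
have ge0 : 0 < gap_weight * eta by exact: mulr_gt0.
have S0 : (0 <= \sum_(0 <= j < K) 'E_P[gap j])%E by apply: sume_ge0.
have Eenv0 : (0 <= 'E_P[fun w => env (px K w)])%E by exact: expectation_ge0.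
have hS : (\sum_(0 <= j < K) 'E_P[gap j] <= (env_total / (gap_weight * eta))%:E)%E.
  rewrite EFinM lee_pdivlMr//.
  by rewrite muleC; apply: le_trans tele; rewrite leeDr.
have hlast : ('E_P[gap K] <= (2 / rho * env_total)%:E)%E.
  have hE : ('E_P[fun w => env (px K w)] <= env_total%:E)%E.
    by apply: le_trans tele; rewrite leeDl// mule_ge0// lee_fin ltW.
  have menv : measurable_fun setT (fun w => env (px K w)).
    apply: (@measurable_caratheodory _ _ _ _ _ (fun _ M => env M)) => //.
    exact: ambient (@mpx K).
  have r0 : 0 <= 2 / rho by rewrite divr_ge0// ltW.
  have en (w : Omega) : 0 <= env (px K w) by [].
  rewrite -[2 / rho * _]add0r.
  apply: (le_expectation_affine1 menv en (lexx 0) r0 hE (gap_ge0 K)) => w.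
  by rewrite add0r /gap -ler_pdivrMl ?divr_gt0// invf_div; exact: env_ge_pr.
apply: (@le_trans _ _ ((K%:R^-1)%:E * ((env_total / (gap_weight * eta))%:E + (2 / rho * env_total)%:E))%E).
  apply: lee_wpmul2l; first by rewrite lee_fin invr_ge0.
  rewrite big_nat_recr//= leeD//; apply: le_trans hS.
  by rewrite [leRHS](big_ltn K0) leeDr.
have -> : K%:R^-1 = eta ^+ 2 :> R.
  have Kn0 : K%:R != 0 :> R by rewrite pnatr_eq0 -lt0n.
  by apply: (mulIf Kn0); rewrite mulVf// etaK.
rewrite -EFinD -EFinM lee_fin /outer_rate.
have -> : eta ^+ 2 * (env_total / (gap_weight * eta) + 2 / rho * env_total)
   = env_total / gap_weight * eta + 2 / rho * env_total * eta * eta.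
  by field; rewrite !gt_eqF.
rewrite (mulrDl (env_total / gap_weight)) lerD2l -[leRHS]mulr1 ler_wpM2l//.
apply: mulr_ge0; last exact: ltW.
by rewrite mulr_ge0// divr_ge0// ltW.
Qed.

End rates.
End stepsizes.

(** The constant [c] majorizes every coefficient that the smallness of [beta] and
    of [alpha / beta] has to dominate. *)
Lemma path_rates (b0 : R) : 0 <= b0 -> exists c : R, 0 < c /\
  forall c0 : R, 0 < c0 -> exists C : R, forall (K : nat) (alpha beta tau : nat -> R),
  let eta := (Num.sqrt (K%:R : R))^-1 in
  (0 < K)%N ->
  (forall k, (k < K)%N -> [/\ 0 < alpha k, alpha k <= beta k, beta k <= eta,
     c0 * eta <= alpha k & tau k = eta]) ->
  (forall k, (k < K)%N -> beta k <= b0 / c /\ alpha k <= beta k * mu / (2 * c)) ->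
  let x k w := st_x (stable_path alpha beta tau k w) in
  let y k w := st_y (stable_path alpha beta tau k w) in
  ((K%:R^-1)%:E * \sum_(1 <= k < K.+1) 'E_P[fun w => (l2 (pr (x k w) - x k w) ^+ 2)%R]
    <= (C * eta)%:E)%E /\
  ('E_P[fun w => (l2 (y K w - ystar (x K w)) ^+ 2)%R] <= (C * eta)%:E)%E.
Proof.
move=> b00.
pose c1 := b0 * Lg ^+ 2 / mu; pose c2 := b0 * mu; pose c3 := 8 * b0 * (weight * back_leak) / mu.
have l0 : 0 <= 2 * leak by rewrite mulr_ge0// leak_ge0.
have c10 : 0 <= c1 by rewrite /c1 divr_ge0 ?(ltW mu0)// mulr_ge0 ?sqr_ge0.
have c20 : 0 <= c2 by rewrite /c2 mulr_ge0// ltW.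
have wb0 : 0 <= weight * back_leak.
  by apply: mulr_ge0; [exact: le_trans weight_ge1|exact: back_leak_ge0].
have c30 : 0 <= c3.
  by apply: divr_ge0; [apply: mulr_ge0 => //; exact: mulr_ge0|exact: ltW].
pose c := 1 + c1 + c2 + c3 + 2 * leak.
have [cgt0 c1c c2c c3c lc] : [/\ 0 < c, c1 <= c, c2 <= c, c3 <= c & 2 * leak <= c].
  rewrite /c; move: (c1) (c2) (c3) (2 * leak) c10 c20 c30 l0 => u1 u2 u3 u4 h1 h2 h3 h4.
  by split; lra.
exists c; split=> // c0 c00; exists (Num.max (inner_rate c0) (outer_rate c0)).
move=> K alpha beta tau eta K0 steps bounds x y.
have eta0 : 0 < eta by have [] := @sqrt_rate R K K0.
have small k : (k < K)%N -> [/\ beta k * Lg ^+ 2 <= mu, beta k * mu <= 1,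
    leak * alpha k <= beta k * mu / 4 & weight * back_leak * beta k <= mu / 8].
  move=> kK; have [al0 albe _ _ _] := steps k kK; have [hb ha] := bounds k kK.
  have be0 : 0 < beta k by exact: lt_le_trans albe.
  have dom u v : 0 <= u -> 0 < v -> b0 * u / v <= c -> beta k * u <= v.
    move=> u0 v0 huv; apply: (@le_trans _ _ (b0 / c * u)); first exact: ler_wpM2r.
    by rewrite mulrAC ler_pdivrMr// mulrC [v * c]mulrC -ler_pdivrMr// [u * b0]mulrC.
  split.
  - by apply: dom; rewrite ?sqr_ge0.
  - by apply: dom; rewrite ?(ltW mu0)// divr1.
  - have := leak_ge0 => lk0; apply: le_trans (ler_wpM2l lk0 ha) _.
    rewrite mulrA ler_pdivrMr ?mulr_gt0//.
    have -> : beta k * mu / 4 * (2 * c) = beta k * mu * (c / 2) by field.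
    by rewrite mulrC ler_wpM2l ?mulr_ge0 ?(ltW be0) ?(ltW mu0)// ler_pdivlMr// mulrC.
  - rewrite mulrC; apply: dom; rewrite ?divr_gt0//.
    by rewrite (_ : b0 * (weight * back_leak) / (mu / 8) = c3)// /c3; field; rewrite gt_eqF.
split.
  apply: le_trans (outer_gap_rate K0 c00 steps small) _.
  by rewrite lee_fin ler_wpM2r ?(ltW eta0)// le_max lexx orbT.
apply: le_trans (inner_error_rate K0 c00 steps small) _.
by rewrite lee_fin ler_wpM2r ?(ltW eta0)// le_max lexx.
Qed.

End process.

End oracle.

(** * The bilevel problem *)

Section bilevel_problem.
Context {R : realType} {d dy : nat}
  {dXi : measure_display} {Xi : measurableType dXi} (Pxi : probability Xi R)
  {dPhi : measure_display} {Phi : measurableType dPhi} (Pphi : probability Phi R)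
  (fs : Xi -> 'cV[R]_d -> 'cV[R]_dy -> R) (gs : Phi -> 'cV[R]_d -> 'cV[R]_dy -> R)
  (X : set 'cV[R]_d) (ystar : 'cV[R]_d -> 'cV[R]_dy) (p : constants R) (rho : R).

Let f := mean_fun Pxi fs.
Let g := mean_fun Pphi gs.
Let F := outer_obj f ystar.

Hypotheses (Xcl : closed X) (Xcv : segment_closed X)
  (smooth : smooth_problem Pxi Pphi fs gs)
  (ystar_min : forall x, X x -> argmin_on setT (g x) (ystar x))
  (pos : valid_constants p)
  (lip : lipschitz_assumption Pxi Pphi fs gs X p)
  (g_convex : strong_convexity_assumption g X p.(mu_g))
  (stoch : stochastic_assumption Pxi Pphi fs gs X p)
  (F_convex : weak_convexity_assumption F X p.(mu_F))
  (rho_gt : `|p.(mu_F)| < rho).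

Let mu0 := mu_g_gt0 pos.
Let Cxy0 : 0 <= p.(C_gxy). Proof. by have [] := C_ge0 pos. Qed.
Let Cfx0 : 0 <= p.(C_fx). Proof. by have [] := C_ge0 pos. Qed.
Let Cfy0 : 0 <= p.(C_fy). Proof. by have [] := C_ge0 pos. Qed.
Let Lg0 : 0 <= p.(L_g). Proof. by have [] := L_ge0 pos. Qed.
Let Lxy0 : 0 <= Lip_xy p.
Proof. by have [_ _ _ ? _] := L_ge0 pos; have [_ _ ? _] := Lbar_ge0 pos; exact: addr_ge0. Qed.
Let Lyy0 : 0 <= Lip_yy p.
Proof. by have [_ _ _ _ ?] := L_ge0 pos; have [_ _ _ ?] := Lbar_ge0 pos; exact: addr_ge0. Qed.

Let rho0 : 0 < rho. Proof. exact: le_lt_trans (normr_ge0 _) rho_gt. Qed.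
Let kappa0 : 0 < (rho + p.(mu_F)) / 2.
Proof. by rewrite divr_gt0// -ltrBlDr sub0r; apply: le_lt_trans rho_gt; rewrite -normrN ler_norm. Qed.

Let F_continuous x : X x -> {for x, continuous F}.
Proof. by move=> Xx; have [dF _ _] := F_convex Xx; exact: differentiable_continuous. Qed.

Let bnd_gxy x y : X x -> l2 (hess_xy g x y) <= p.(C_gxy).
Proof. by move=> Xx; exact: hess_xy_bound pos stoch x y Xx. Qed.

Let bnd_fy x y : X x -> l2 (grad_y f x y) <= p.(C_fy).
Proof. by move=> Xx; exact: grad_y_bound pos stoch x y Xx. Qed.

Let lip_gxy x y x' y' : X x -> X x' ->
  l2 (hess_xy g x y - hess_xy g x' y') <= Lip_xy p * (l2 (x - x') + l2 (y - y')).
Proof. exact: hess_xy_lipschitz pos lip stoch x y x' y'. Qed.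

Let lip_gyy x y x' y' : X x -> X x' ->
  l2 (hess_yy g x y - hess_yy g x' y') <= Lip_yy p * (l2 (x - x') + l2 (y - y')).
Proof. exact: hess_yy_lipschitz pos lip stoch x y x' y'. Qed.

Let grad_y_growth x y : X x -> l2 (grad_y g x y) <= p.(L_g) * l2 (y - ystar x).
Proof.
move=> Xx; have := lip_gy_y lip Xx (I : setT y) (I : setT (ystar x)).
by rewrite -/g (grad_y_ystar (diff_g smooth) ystar_min Xx) subr0.
Qed.

Let ystar_expand x x' : X x -> X x' ->
  l2 (ystar x' - ystar x
      + invmx (hess_yy g x (ystar x)) *m (hess_xy g x (ystar x))^T *m (x' - x))
    <= ystar_curv p.(mu_g) p.(C_gxy) (Lip_xy p) (Lip_yy p) * l2 (x' - x) ^+ 2.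
Proof.
move=> Xx Xx'; have := ystar_expansion Xcv mu0 Cxy0 Lxy0 Lyy0 (diff_g smooth) (diff_grad_g smooth)
  ystar_min g_convex bnd_gxy lip_gxy lip_gyy Xx Xx'.
by rewrite /ystar_dir opprK.
Qed.

(** On [X] the solution map agrees with its composition with the projection,
    which is Lipschitz on the whole space. *)
Let measurable_ystar (dT : measure_display) (T : measurableType dT) (x : T -> 'cV[R]_d) :
  mx_measurable x -> (forall w, X (x w)) -> mx_measurable (fun w => ystar (x w)).
Proof.
move=> mx Xx.
have [[w0 _]|T0] := pselect (exists w : T, True); last first.
  by move=> i j _ Y mY; rewrite (_ : _ `&` _ = set0)//; apply/seteqP; split=> // w; case: T0; exists w.
have -> : (fun w => ystar (x w)) = fun w => ystar (proj X (x w)).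
  by apply/funext => w; rewrite (proj_id Xcl (Xx w0) (Xx w)).
apply: (mx_measurable_continuous (h := fun v => ystar (proj X v))) => //.
apply: (@l2_lipschitz_continuous _ _ _ _ _ _ (p.(C_gxy) / p.(mu_g))) => u v.
have XP z : X (proj X z) by exact: proj_in Xcl (Xx w0) z.
apply: le_trans (ystar_lipschitz Xcv mu0 Cxy0 (diff_g smooth) (diff_grad_g smooth)
   ystar_min g_convex bnd_gxy (XP v) (XP u)) _.
rewrite ler_wpM2l ?divr_ge0 ?(ltW mu0)//.
exact: (proj_nonexpansive Xcl Xcv (Xx w0)).
Qed.

(** Weak convexity of the outer objective along the segment to its proximal
    point, together with the optimality of that point. *)
Let prox_descent m x0 x : X x0 -> (forall x, X x -> m <= F x) -> X x ->
  dotm (prox F X rho x - x) (hypergrad f g ystar x)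
    <= - ((rho + p.(mu_F)) / 2) * l2 (prox F X rho x - x) ^+ 2.
Proof.
move=> Xx0 Fm Xx.
have Xp := prox_in Xcl Xx0 rho0 F_continuous Fm x.
have h1 := outer_obj_lower_bound Xcv mu0 Cxy0 Lxy0 Lyy0 Cfy0 (diff_f smooth) (diff_g smooth)
  (diff_grad_g smooth) ystar_min g_convex bnd_gxy lip_gxy lip_gyy bnd_fy F_convex Xx Xp.
have := envelope_le Xcl Xx0 rho0 F_continuous Fm x Xx.
rewrite subrr l20 expr0n/= mulr0 addr0 /envelope => h2.
move: h1 h2; rewrite dotmC -/F.
move: (dotm _ _) (F _) (F x) (l2 _ ^+ 2) (mu_F p) => D Fp Fx L m' h1 h2; lra.
Qed.

Section samples.
Context {dO : measure_display} {Omega : measurableType dO} (P : probability Omega R)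
  (xi : nat -> {RV P >-> Xi}) (phi : nat -> {RV P >-> Phi})
  (x0 : 'cV[R]_d) (y0 : 'cV[R]_dy) (Hxy0 : 'M[R]_(d, dy)) (Hyy0 : 'M[R]_dy).

Lemma stable_iter_path (alpha beta tau : nat -> R) k w :
  stable_iter X p.(C_gxy) p.(mu_g) alpha beta tau (fun j => fs (xi j w))
    (fun j => gs (phi j w)) (State x0 y0 Hxy0 Hyy0) k =
  stable_path X x0 (fun s => grad_x (fs s)) (fun s => grad_y (fs s)) (fun s => grad_y (gs s))
    (fun s => hess_xy (gs s)) (fun s => hess_yy (gs s)) p.(mu_g) p.(C_gxy) xi phi
    y0 Hxy0 Hyy0 alpha beta tau k w.
Proof.
elim: k => [//|k IH]; rewrite [LHS]/= IH [RHS]/=.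
by case: (stable_path _ _ _ _ _ _ _ _ _ _ _ _ _ _ _ _ _ k w).
Qed.

Hypotheses (fresh : fresh_samples Pxi Pphi xi phi) (F_lbound : has_lbound (F @` X))
  (Xx0 : X x0) (uHyy0 : Hyy0 \in unitmx).

(** The bounds [M1] and [M2] have to cover the initial estimates, which need not
    satisfy the constraints imposed by the projections from the first step on. *)
Lemma stable_iter_rates (b0 : R) : 0 <= b0 -> exists c : R, 0 < c /\
  forall c0 : R, 0 < c0 -> exists C : R, forall (K : nat) (alpha beta tau : nat -> R),
  let eta := (Num.sqrt (K%:R : R))^-1 in
  (0 < K)%N ->
  (forall k, (k < K)%N -> [/\ 0 < alpha k, alpha k <= beta k, beta k <= eta,
     c0 * eta <= alpha k & tau k = eta]) ->
  (forall k, (k < K)%N -> beta k <= b0 / c /\ alpha k <= beta k * p.(mu_g) / (2 * c)) ->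
  let s k w := stable_iter X p.(C_gxy) p.(mu_g) alpha beta tau
     (fun j => fs (xi j w)) (fun j => gs (phi j w)) (State x0 y0 Hxy0 Hyy0) k in
  ((K%:R^-1)%:E * \sum_(1 <= k < K.+1)
     'E_P[fun w => (l2 (prox F X rho (st_x (s k w)) - st_x (s k w)) ^+ 2)%R]
    <= (C * eta)%:E)%E /\
  ('E_P[fun w => (l2 (st_y (s K w) - ystar (st_x (s K w))) ^+ 2)%R] <= (C * eta)%:E)%E.
Proof.
move=> b00.
have [m Fm'] := F_lbound.
have Fm x : X x -> m <= F x by move=> Xx; apply: Fm'; exists x.
have mf a b : measurable_fun setT (fun s => fs s a b).
  by have /integrableP[/measurable_EFinP] := integrable_f smooth a b.
have mg a b : measurable_fun setT (fun s => gs s a b).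
  by have /integrableP[/measurable_EFinP] := integrable_g smooth a b.
have [L1 L2 _ _ _] := L_ge0 pos.
have M1_ge : p.(C_gxy) <= p.(C_gxy) + l2 Hxy0 by rewrite lerDl l2_ge0.
have M1_ge' : l2 Hxy0 <= p.(C_gxy) + l2 Hxy0 by rewrite lerDr.
have i0 : 0 <= l2 (1%:M : 'M[R]_dy) / p.(mu_g) by rewrite divr_ge0 ?l2_ge0// ltW.
have M2_ge : l2 (1%:M : 'M[R]_dy) / p.(mu_g) <= l2 (1%:M : 'M[R]_dy) / p.(mu_g) + l2 (invmx Hyy0).
  by rewrite lerDl l2_ge0.
have M2_ge' : l2 (invmx Hyy0) <= l2 (1%:M : 'M[R]_dy) / p.(mu_g) + l2 (invmx Hyy0) by rewrite lerDr.
have curv0 : 0 <= ystar_curv p.(mu_g) p.(C_gxy) (Lip_xy p) (Lip_yy p).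
  have q0 : 0 <= p.(C_gxy) / p.(mu_g) by rewrite divr_ge0// ltW.
  rewrite /ystar_curv; apply: divr_ge0; last exact: ltW.
  by apply: mulr_ge0; apply: addr_ge0 => //; exact: mulr_ge0.
have lfx x y y' : X x -> l2 (grad_x f x y - grad_x f x y') <= p.(L_fx) * l2 (y - y').
  by move=> Xx; exact: (lip_fx_y lip Xx I I).
have lfy x y y' : X x -> l2 (grad_y f x y - grad_y f x y') <= p.(L_fy) * l2 (y - y').
  by move=> Xx; exact: (lip_fy_y lip Xx I I).
have contraction x y b : X x -> 0 <= b ->
    l2 (y - b *: grad_y g x y - ystar x) ^+ 2
      <= (1 - 2 * b * p.(mu_g) + b ^+ 2 * p.(L_g) ^+ 2) * l2 (y - ystar x) ^+ 2.
  exact: (gradient_step_contraction (diff_g smooth) (diff_grad_g smooth) ystar_min g_convex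
    (lip_gy_y lip)).
have env0 x : 0 <= envelope F X rho x - m by exact: (envelope_sub_ge0 Xcl Xx0 rho0 F_continuous Fm).
have envc : continuous (fun x => envelope F X rho x - m).
  move=> x; apply: (@continuousB R R^o); last exact: cst_continuous.
  exact: (envelope_continuous Xcl Xx0 rho0 F_continuous Fm).
have envd x h a : X x -> envelope F X rho (proj X (x - a *: h)) - m
    <= envelope F X rho x - m + rho * a * dotm (prox F X rho x - x) h
       + rho / 2 * a ^+ 2 * l2 h ^+ 2.
  move=> Xx; have := envelope_descent Xcl Xcv Xx0 rho0 F_continuous Fm h a Xx; lra.
have envp x : rho / 2 * l2 (prox F X rho x - x) ^+ 2 <= envelope F X rho x - m.
  by rewrite lerBrDl; exact: (envelope_ge Xcl Xx0 rho0 F_continuous Fm).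
have [c [cgt0 H]] := path_rates Xcl Xcv Xx0 mu0 Cxy0 Cfx0 Cfy0 Lg0 Lxy0 Lyy0 curv0 rho0 kappa0
  (sqr_ge0 _) (sqr_ge0 _) (sqr_ge0 _) M1_ge M2_ge lfx lfy bnd_fy bnd_gxy g_convex lip_gxy lip_gyy
  (hess_xy_sample_lipschitz pos lip) (hess_yy_sample_lipschitz pos lip) contraction
  grad_y_growth ystar_expand env0 envc envd (fun x => @prox_descent m x0 x Xx0 Fm) envp
  (unbiased_fx stoch) (unbiased_fy stoch) (unbiased_gy stoch) (unbiased_gxy stoch)
  (unbiased_gyy stoch) (variance_gy stoch) (variance_gxy stoch) (variance_gyy stoch)
  (moment_fx stoch) (moment_fy stoch) y0 fresh M1_ge' uHyy0 M2_ge'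
  (fun _ _ t x y mt => @measurable_grad_x _ _ _ _ _ (fun w => fs (t w))
    (fun a b => measurableT_comp (mf a b) mt) (fun w => diff_fs smooth (t w)) x y)
  (fun _ _ t x y mt => @measurable_grad_y _ _ _ _ _ (fun w => fs (t w))
    (fun a b => measurableT_comp (mf a b) mt) (fun w => diff_fs smooth (t w)) x y)
  (fun _ _ t x y mt => @measurable_grad_y _ _ _ _ _ (fun w => gs (t w))
    (fun a b => measurableT_comp (mg a b) mt) (fun w => diff_gs smooth (t w)) x y)
  (fun _ _ t x y mt => @measurable_hess_xy _ _ _ _ _ (fun w => gs (t w)) x y
    (fun a b => measurableT_comp (mg a b) mt) (fun w => diff_gs smooth (t w))
    (fun w => diff_grad_gs smooth (t w)))
  (fun _ _ t x y mt => @measurable_hess_yy _ _ _ _ _ (fun w => gs (t w)) x y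
    (fun a b => measurableT_comp (mg a b) mt) (fun w => diff_gs smooth (t w))
    (fun w => diff_grad_gs smooth (t w)))
  (fun _ _ x y => @measurable_hess_xy _ _ _ _ _ (fun=> g) x y (fun _ _ => measurable_cst _)
    (fun=> diff_g smooth) (fun=> diff_grad_g smooth))
  (fun _ _ x y => @measurable_hess_yy _ _ _ _ _ (fun=> g) x y (fun _ _ => measurable_cst _)
    (fun=> diff_g smooth) (fun=> diff_grad_g smooth))
  measurable_ystar b00.
exists c; split=> // c0 c00; have [C HC] := H c0 c00; exists C => K alpha beta tau eta K0 h1 h2 s.
have := HC K alpha beta tau K0 h1 h2.
have -> : s = fun k w => stable_path X x0 (fun s => grad_x (fs s)) (fun s => grad_y (fs s)) (fun s => grad_y (gs s))
    (fun s => hess_xy (gs s)) (fun s => hess_yy (gs s)) p.(mu_g) p.(C_gxy) xi phi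
    y0 Hxy0 Hyy0 alpha beta tau k w.
  by apply/funext => k; apply/funext => w; exact: stable_iter_path.
exact.
Qed.

End samples.
End bilevel_problem.

(** * Stepsizes and the final rates *)

Theorem theorem2 (R : realType) (d dy : nat)
    (dXi : measure_display) (Xi : measurableType dXi) (Pxi : probability Xi R)
    (dPhi : measure_display) (Phi : measurableType dPhi)
    (Pphi : probability Phi R)
    (fs : Xi -> 'cV[R]_d -> 'cV[R]_dy -> R)
    (gs : Phi -> 'cV[R]_d -> 'cV[R]_dy -> R)
    (X : set 'cV[R]_d) (ystar : 'cV[R]_d -> 'cV[R]_dy)
    (p : constants R) (rho : R)
    (dO : measure_display) (Omega : measurableType dO) (P : probability Omega R)
    (xi : nat -> {RV P >-> Xi}) (phi : nat -> {RV P >-> Phi})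
    (x0 : 'cV[R]_d) (y0 : 'cV[R]_dy) (Hxy0 : 'M[R]_(d, dy)) (Hyy0 : 'M[R]_dy) :
  let f := mean_fun Pxi fs in
  let g := mean_fun Pphi gs in
  let F := outer_obj f ystar in
  closed X -> convex_set X ->
  smooth_problem Pxi Pphi fs gs ->
  (forall x, X x -> argmin_on setT (g x) (ystar x)) ->
  has_lbound (F @` X) ->
  valid_constants p ->
  lipschitz_assumption Pxi Pphi fs gs X p ->
  strong_convexity_assumption g X p.(mu_g) ->
  stochastic_assumption Pxi Pphi fs gs X p ->
  weak_convexity_assumption F X p.(mu_F) ->
  `|p.(mu_F)| < rho ->
  fresh_samples Pxi Pphi xi phi ->
  X x0 -> Hyy0 \in unitmx ->
  exists c : R, 0 < c /\
  forall c0 : R, 0 < c0 ->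
  exists C : R, forall (K : nat) (alpha beta tau : nat -> R),
    (0 < K)%N ->
    (forall k, (k < K)%N ->
      [/\ 0 < alpha k, 0 < beta k,
          tau k = (Num.sqrt K%:R)^-1,
          beta k <= Num.min (Num.sqrt K%:R)^-1
            (p.(mu_g) / p.(L_g) / (32 * (p.(mu_g) + p.(L_g)) * c))
        & alpha k <=
            Num.min (beta k) (Num.min
              ((Num.sqrt K%:R)^-1 *
                (c + 4 * rho * p.(C_gxy) ^+ 2 * p.(C_fy) ^+ 2
                     / ((p.(mu_F) + rho) * p.(mu_g) ^+ 4))^-1) (Num.min
              ((Num.sqrt K%:R)^-1 *
                (c + 4 * rho * p.(C_fy) ^+ 2
                     / ((p.(mu_F) + rho) * p.(mu_g) ^+ 2))^-1)
              (p.(mu_g) * p.(L_g) * beta k / (p.(mu_g) + p.(L_g))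
                / (2 * (c + 2 * rho * L_f p ^+ 2 / (p.(mu_F) + rho))))))]) ->
    (* the stepsizes are of exact order 1 / sqrt K *)
    (forall k, (k < K)%N -> c0 / Num.sqrt K%:R <= alpha k) ->
    let s k w := stable_iter X p.(C_gxy) p.(mu_g) alpha beta tau
                   (fun j => fs (xi j w)) (fun j => gs (phi j w))
                   (State x0 y0 Hxy0 Hyy0) k in
    ((K%:R^-1)%:E *
       \sum_(1 <= k < K.+1)
         'E_P[fun w => (l2 (prox F X rho (st_x (s k w)) - st_x (s k w)) ^+ 2)%R]
      <= (C / Num.sqrt K%:R)%:E)%E /\
    ('E_P[fun w => (l2 (st_y (s K w) - ystar (st_x (s K w))) ^+ 2)%R]
      <= (C / Num.sqrt K%:R)%:E)%E.
Proof.
move=> f g F Xcl Xcv smooth ystar_min F_lbound pos lip g_convex stoch F_convex rho_gt fresh Xx0 uHyy0.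
have mu0 := mu_g_gt0 pos.
have Lg0 : 0 <= p.(L_g) by have [] := L_ge0 pos.
(* The second bound on [beta k] is [b0 / c]; it is zero, hence contradictory, if
   [L_g = 0]. *)
pose b0 := p.(mu_g) / p.(L_g) / (32 * (p.(mu_g) + p.(L_g))).
have b00 : 0 <= b0.
  by rewrite /b0; apply: divr_ge0; [apply: divr_ge0 => //; exact: ltW|rewrite mulr_ge0// addr_ge0// ltW].
have [c [cgt0 H]] := stable_iter_rates Xcl (convex_set_segment_closed Xcv) smooth ystar_min
  pos lip g_convex stoch F_convex rho_gt y0 Hxy0 fresh F_lbound Xx0 uHyy0 b00.
exists c; split=> // c0 c00; have [C HC] := H c0 c00; exists C.
move=> K alpha beta tau K0 steps lower; apply: HC => // k kK.
  have [al0 be0 tauk] := steps k kK; rewrite !le_min => /andP[be_eta _] /andP[al_be _].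
  by split=> //; exact: lower.
have [al0 be0 tauk] := steps k kK; rewrite !le_min => /andP[_ be_c] /and4P[_ _ _ al_c].
split; first by apply: le_trans be_c _; rewrite /b0 invfM mulrA.
apply: le_trans al_c _.
set q := 2 * rho * _ / _.
have q0 : 0 <= q.
  have rho0 : 0 <= rho by exact: le_trans (ltW rho_gt).
  apply: divr_ge0; first by rewrite mulr_ge0 ?sqr_ge0// mulr_ge0.
  by rewrite addrC -lerBlDr sub0r; apply: le_trans (ltW rho_gt); rewrite -normrN ler_norm.
have frac : p.(mu_g) * p.(L_g) * beta k / (p.(mu_g) + p.(L_g)) <= beta k * p.(mu_g).
  have mL : 0 < p.(mu_g) + p.(L_g) by rewrite ltr_wpDr.
  rewrite ler_pdivrMr// [_ * beta k]mulrC mulrA.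
  by rewrite ler_wpM2l ?lerDr ?mulr_ge0 ?(ltW mu0) ?(ltW be0).
apply: ler_pM => //.
- by rewrite !mulr_ge0 ?invr_ge0 ?addr_ge0 ?(ltW mu0) ?(ltW be0).
- by rewrite invr_ge0 mulr_ge0// addr_ge0// ltW.
- by rewrite lef_pV2 ?posrE ?mulr_gt0 ?ltr_wpDr// ler_pM2l// lerDl.
Qed.
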